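(* Let $\mathcal{P}$ be a Beurling generalized prime system, with associated generalized integers $\mathcal{N}$, such that the Dirichlet series $\zeta_{\mathcal{P}}(s)=\sum_{n\in\mathcal{N}} n^{-s}$ has abscissa of convergence $1$. Suppose there exist $\rho>0$ and real numbers $\alpha,\beta,\gamma<1$ such that, for every $\varepsilon>0$, \[\psi_{\mathcal{P}}(x)=x+O(x^{\alpha+\varepsilon}),\qquad N_{\mathcal{P}}(x)=\rho x+O(x^{\beta+\varepsilon}),\qquad M_{\mathcal{P}}(x)=O(x^{\gamma+\varepsilon}),\] while for no $\varepsilon<0$ does the respective estimate hold (i.e. $\alpha,\beta,\gamma$ are the infima of the admissible exponents). Then among $\alpha,\beta,\gamma$ the two largest are equal: if $a\ge b\ge c$ denotes $\alpha,\beta,\gamma$ in decreasing order, then $a=b$. Moreover this common value satisfies $a=b\ge \tfrac12$.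
   Context: A Beurling generalized prime system $\mathcal{P}$ is an unbounded sequence of reals $1<p_1\le p_2\le p_3\le\cdots$ (a multiset; elements are called $g$-primes). The associated system $\mathcal{N}$ of generalized integers is the multiset of all products $p_1^{a_1}p_2^{a_2}\cdots p_k^{a_k}$ with $a_i\in\mathbb{N}_0$ (counted with multiplicity according to the representation). Counting functions: $N_{\mathcal{P}}(x)=\#\{n\in\mathcal{N}: n\le x\}$ (with multiplicity), $\psi_{\mathcal{P}}(x)=\sum_{p\in\mathcal{P},\,k\in\mathbb{N},\,p^k\le x}\log p$. The generalized Möbius function is $\mu_{\mathcal{P}}(1)=1$, $\mu_{\mathcal{P}}(p_{i_1}\cdots p_{i_k})=(-1)^k$ when the indices $i_1,\dots,i_k$ are distinct, and $0$ otherwise (defined on the formal products), and $M_{\mathcal{P}}(x)=\sum_{n\in\mathcal{N},\,n\le x}\mu_{\mathcal{P}}(n)$. The Beurling zeta function is $\zeta_{\mathcal{P}}(s)=\prod_{p\in\mathcal{P}}(1-p^{-s})^{-1}=\sum_{n\in\mathcal{N}}n^{-s}$. *)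

(* Defs.v *)
From HB Require Import structures.
From mathcomp Require Import all_boot all_order all_algebra.
From mathcomp Require Import finmap complex ring.
From mathcomp Require Import all_classical all_reals all_analysis.

Set Implicit Arguments.
Unset Strict Implicit.
Unset Printing Implicit Defensive.

Import Order.TTheory GRing.Theory Num.Theory.
Import numFieldNormedType.Exports.

Local Open Scope classical_set_scope.
Local Open Scope ring_scope.

(* The g-primes are listed with repetition, so equal values at different
   indices are different g-primes. *)
Record gprimes (R : realType) := GPrimes {
  gprime :> nat -> R;
  gprime_gt1 : forall i, 1 < gprime i;
  gprime_nondecreasing : nondecreasing_seq gprime;
  gprime_unbounded : forall x, exists i, x < gprime i }.

(* A generalized integer is a formal product, i.e. a finitely supported
   exponent vector; a real value is counted once per representation. *)
Notation gint := {fsfun nat -> nat with 0%N}.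

Section Beurling.
Variables (R : realType) (P : gprimes R).
Implicit Types (n : gint) (x : R) (s : R[i]).

Definition gval n : R := \prod_(i <- finsupp n) P i ^+ n i.

(* The index sets of the sums below are finite ([finite_gint_le] and
   [finite_gprimepow_le]), as required for [\sum_(_ \in _)] to be meaningful. *)
Definition gint_le x : set gint := [set n | gval n <= x].

Definition gprimepow_le x : set (nat * nat) :=
  [set ik | (0 < ik.2)%N /\ P ik.1 ^+ ik.2 <= x].

Lemma gprime_gt0 i : 0 < P i.
Proof. exact: lt_trans ltr01 (gprime_gt1 P i). Qed.

Lemma index_bound x : exists K : nat, forall i, P i <= x -> (i < K)%N.
Proof.
have [K xK] := gprime_unbounded P x; exists K => i Pix.
rewrite ltnNge; apply/negP => /(gprime_nondecreasing P) KI.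
by have := lt_le_trans xK (le_trans KI Pix); rewrite ltxx.
Qed.

Lemma exponent_bound x :
  exists m : nat, forall i k, P i ^+ k <= x -> (k < m)%N.
Proof.
have e0 : 0 < P 0%N - 1 by rewrite subr_gt0 gprime_gt1.
have [m xm] : exists m : nat, x < m%:R * (P 0%N - 1).
  exists (Num.bound `|x / (P 0%N - 1)|); rewrite -ltr_pdivrMr//.
  by apply: le_lt_trans (ler_norm _) (archi_boundP _).
exists m => i k Pkx; rewrite ltnNge; apply/negP => mk.
suff : x < P i ^+ k by rewrite ltNge Pkx.
apply: (lt_le_trans xm); apply: (@le_trans _ _ (P 0%N ^+ m)).
  have bern : 1 + m%:R * (P 0%N - 1) <= P 0%N ^+ m.
    elim: m {xm mk} => [|m IH]; first by rewrite mul0r addr0 expr0.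
    rewrite exprS; apply: (@le_trans _ _ (P 0%N * (1 + m%:R * (P 0%N - 1)))).
      rewrite -natr1; set e := P 0%N - 1; have -> : P 0%N = 1 + e by rewrite addrC subrK.
      rewrite -subr_ge0 (_ : _ - _ = m%:R * (e * e)); last by ring.
      by rewrite mulr_ge0 ?mulr_ge0// ltW.
    by rewrite ler_pM2l ?gprime_gt0.
  by apply: le_trans bern; rewrite lerDr.
apply: (@le_trans _ _ (P 0%N ^+ k)).
  by rewrite ler_weXn2l// ltW// gprime_gt1.
apply: lerXn2r; rewrite ?nnegrE; do ?exact: ltW (gprime_gt0 _).
exact: (gprime_nondecreasing P (leq0n i)).
Qed.

Lemma gprimeX_le_gval n i : P i ^+ n i <= gval n.
Proof.
have [ni|ni] := boolP (i \in finsupp n); last first.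
  rewrite fsfun_dflt// expr0 /gval.
  by elim/big_rec: _ => // j y _ y1; rewrite mulr_ege1// exprn_ege1// ltW// gprime_gt1.
rewrite /gval (big_fsetD1 i)//= ler_peMr ?exprn_ge0 ?(ltW (gprime_gt0 _))//.
by elim/big_rec: _ => // j y _ y1; rewrite mulr_ege1// exprn_ege1// ltW// gprime_gt1.
Qed.

Lemma finite_gprimepow_le x : finite_set (gprimepow_le x).
Proof.
have [K HK] := index_bound x; have [m Hm] := exponent_bound x.
apply: (@sub_finite_set _ _ (`I_K `*` `I_m)).
  move=> [i k] [/= k0 le_x]; split => /=; last exact: Hm le_x.
  apply: HK; apply: le_trans le_x; rewrite -[leLHS]expr1.
  by rewrite ler_weXn2l// ltW// gprime_gt1.
by apply: finite_setX; apply: finite_II.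
Qed.

Lemma finite_gint_le x : finite_set (gint_le x).
Proof.
have [K HK] := index_bound x; have [m Hm] := exponent_bound x.
pose g (f : {ffun 'I_K -> 'I_m}) : gint :=
  [fsfun i in [fset j in iota 0 K]%fset =>
    if insub i is Some j then nat_of_ord (f j) else 0%N].
apply: (@sub_finite_set _ _ (g @` setT)); last first.
  by apply: finite_image; apply: finite_finset.
move=> n /= nx.
have nm i : (n i < m)%N by apply: (Hm i); apply: le_trans (gprimeX_le_gval n i) nx.
exists [ffun j : 'I_K => Ordinal (nm j)] => //.
apply/fsfunP => i; rewrite fsfunE !inE mem_iota /= add0n.
case: ifPn => [iK|]; first by rewrite insubT ffunE.
rewrite -leqNgt => Ki; apply/esym/fsfun_dflt/negP => ni.
have ni0 : (0 < n i)%N by rewrite lt0n -mem_finsupp.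
suff : (i < K)%N by rewrite ltnNge Ki.
apply: HK; apply: le_trans (le_trans (gprimeX_le_gval n i) nx).
by rewrite -[leLHS]expr1 ler_weXn2l// ltW// gprime_gt1.
Qed.

Definition gmu n : R :=
  if all (fun i => n i == 1%N) (finsupp n) then (-1) ^+ #|` finsupp n| else 0.

Definition gN x : R := \sum_(n \in gint_le x) (1 : R).

Definition gpsi x : R := \sum_(ik \in gprimepow_le x) ln (P ik.1).

Definition gM x : R := \sum_(n \in gint_le x) gmu n.

End Beurling.

(* u ^ (- s) = exp (- s * ln u) for real u > 0. *)
Definition cpowN (R : realType) (u : R) (s : R[i]) : R[i] :=
  (u `^ (- complex.Re s) * cos (complex.Im s * ln u)
    -i* (u `^ (- complex.Re s) * sin (complex.Im s * ln u)))%C.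

(* The series over the generalized integers is summed in increasing order of
   their values. *)
Definition zeta_partial (R : realType) (P : gprimes R) (s : R[i]) (x : R)
  : R[i]^o := \sum_(n \in gint_le P x) cpowN (gval P n) s.

Definition zeta_converges (R : realType) (P : gprimes R) (s : R[i]) :=
  cvg (zeta_partial P s x @[x --> +oo]).

Definition zeta_abscissa_of_convergence (R : realType) (P : gprimes R)
    (sigma : R) :=
  forall s : R[i],
    (sigma < complex.Re s -> zeta_converges P s) /\
    (complex.Re s < sigma -> ~ zeta_converges P s).

(* Lets the Landau notations be used at [+oo]. *)
Canonical pinfty_filter_on (R : numFieldType) :=
  FilterType (pinfty_nbhs R) (@filter_filter _ _ (proper_pinfty_nbhs (R := R))).

Section Estimates.
Variables (R : realType) (P : gprimes R).

(* [x] is not fixed here: [forall x, f x = g x +O_(x \near F) h x] is the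
   pointwise form of [f = g +O_F h]. *)
Definition psi_estimate (a : R) :=
  forall x, gpsi P x = x +O_(x \near +oo_R) (x `^ a).

Definition N_estimate (rho b : R) :=
  forall x, gN P x = rho * x +O_(x \near +oo_R) (x `^ b).

Definition M_estimate (c : R) :=
  forall x, gM P x =O_(x \near +oo_R) (x `^ c).

End Estimates.

(* Main.v *)
Require Import Defs.
From HB Require Import structures.
From mathcomp Require Import all_boot all_order all_algebra.
From mathcomp Require Import finmap complex.
From mathcomp Require Import all_classical all_reals all_analysis.
From mathcomp Require Import ring lra.
From mathcomp Require Import measurable_realfun ftc.

Import Order.TTheory GRing.Theory Num.Theory.
Import numFieldNormedType.Exports.
Import Normc.

Local Open Scope classical_set_scope.
Local Open Scope ring_scope.

Set Implicit Arguments.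
Unset Strict Implicit.
Unset Printing Implicit Defensive.

(* The Dirichlet series Z of the generalized integers, I of mu and L of the prime
   powers are expanded at the points c = 2 + it of a fixed vertical line, as power
   series in w = c - s; an estimate with error O(x^theta) makes the corresponding
   coefficients O((2 - theta)^(-n)), up to a power of t. This replaces analytic
   continuation throughout.

   Two of the three estimates give such bounds for Y = (s-1) Z or for its inverse,
   and for Y'/Y. Borel-Caratheodory improves the bound for Y'/Y to O(log t), and
   then, by the differential equation for Y and the boundedness of Y'/Y on the line,
   Y^(+-1) is O(t^(+-1+eps)) (a Lindelof hypothesis). Each of the three counting
   functions has a transform equal to one of these series divided by s, hence
   O(t^(eps-1)), and a Fejer kernel localizing near a point u turns this into a
   pointwise estimate, the one-sided regularity coming from the monotonicity of N
   and psi. For N one treats N(e^v) - W(v), with W the primitive of N(e^v), and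
   recovers W from (W e^(-v))' = (N - W) e^(-v). So each exponent is at most the
   maximum of the other two.

   If that maximum were below 1/2, the mean square over |t| <= T of suitable
   coefficients of Z would be O(T^eps), while its diagonal terms alone amount to a
   truncation of the divergent sum of n^(-2 sigma) for some sigma < 1/2. *)

(** * Complex exponentials and power series *)

(** With [w = c - s], exp(-s v) expands with coefficients [gammaw 2 n v] = v^n / n! exp(-2 v) times
    a phase, so moduli are positive weights and Dirichlet series keep their positivity. The series
    are formal: products and differential equations raise no question of convergence, and
    analyticity in a disc of radius r about 2 + it reads as coefficients O(r^-n). Pointwise
    information is read off a single coefficient. For n near r u the weight [gammaw 2 n] near u is
    about r^-n exp(-(2 - r) u), so a coefficient of size r^-n, once localized, bounds the function
    by exp((2 - r) u); taking r close to 2 - theta gives the exponent theta. The same n serves in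
    the mean square. The obstacle for N is the pole at s = 1: dividing Y by s - 1 destroys the
    bounds for small t. The transform of N - W is Y / s^2, which needs no such division. The
    obstacle for M is that it is not monotone; M + N is, so M is treated with an estimate of N at
    hand. *)

Lemma normc_nneg (R : realType) (z : R[i]) : 0 <= normc z.
Proof. by case: z => a b; exact: sqrtr_ge0. Qed.

Ltac pos := first [ assumption | by [] | by apply: ltW |
  lazymatch goal with
  | |- is_true (@Order.le _ _ _ (@GRing.mul _ _ _)) => apply: mulr_ge0; pos
  | |- is_true (@Order.le _ _ _ (@Algebra.add _ _ _)) => apply: addr_ge0; pos
  | |- is_true (@Order.le _ _ _ (@GRing.exp _ _ _)) => apply: exprn_ge0; pos
  | |- is_true (@Order.le _ _ _ (@GRing.inv _ _)) => rewrite invr_ge0; pos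
  | |- is_true (@Order.le _ _ _ (@expR _ _)) => exact: expR_ge0
  | |- is_true (@Order.le _ _ _ (@Num.norm _ _ _)) => exact: normr_ge0
  | |- is_true (@Order.le _ _ _ (@normc _ _)) => exact: normc_nneg
  | |- is_true (@Order.le _ _ _ (@powR _ _ _)) => exact: powR_ge0
  | |- is_true (@Order.le _ _ _ (@Algebra.natmul _ _ _)) => exact: ler0n
  | |- is_true (@Order.lt _ _ _ (@GRing.mul _ _ _)) => apply: mulr_gt0; pos
  | |- is_true (@Order.lt _ _ _ (@Algebra.add _ _ _)) =>
      first [ solve [apply: addr_gt0; pos] | solve [apply: ltr_wpDl; pos]
            | solve [apply: ltr_wpDr; pos] ]
  | |- is_true (@Order.lt _ _ _ (@GRing.exp _ _ _)) => apply: exprn_gt0; pos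
  | |- is_true (@Order.lt _ _ _ (@GRing.inv _ _)) => rewrite invr_gt0; pos
  | |- is_true (@Order.lt _ _ _ (@expR _ _)) => exact: expR_gt0
  | |- is_true (@Order.lt _ _ _ (@Algebra.natmul _ _ _)) => by rewrite ltr0n
  | |- is_true (~~ _) => apply: lt0r_neq0; pos
  end ].

Section Complex.
Variable R : realType.
Implicit Types (x y : R) (z : R[i]).

Definition cis x : R[i] := (cos x +i* sin x)%C.

Lemma cisD x y : cis (x + y) = cis x * cis y.
Proof.
by apply/eqP; rewrite eq_complex /= cosD sinD; apply/andP; split; apply/eqP => //; ring.
Qed.

Lemma cis0 : cis 0 = 1.
Proof. by rewrite /cis cos0 sin0. Qed.

Lemma normc_cis x : normc (cis x) = 1.
Proof. by rewrite /= cos2Dsin2 sqrtr1. Qed.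

Lemma cisX x n : cis x ^+ n = cis (n%:R * x).
Proof.
by elim: n => [|n IH]; rewrite ?mul0r ?cis0// exprS IH -cisD -natr1 mulrDl mul1r addrC.
Qed.

Lemma conjc_cis x : (cis x)^*%C = cis (- x).
Proof. by rewrite /cis /= cosN sinN. Qed.

Lemma normcR x : normc (x%:C)%C = `|x|.
Proof. by rewrite /= expr0n /= addr0 sqrtr_sqr. Qed.

Lemma normcX z n : normc (z ^+ n) = normc z ^+ n.
Proof. by elim: n => [|n IH]; rewrite ?expr0 ?normc1 // !exprS normcM IH. Qed.

Lemma normcD z1 z2 : normc (z1 + z2) <= normc z1 + normc z2.
Proof. exact: (@le_normcD R z1 z2). Qed.

Lemma normcB z1 z2 : normc (z1 - z2) <= normc z1 + normc z2.
Proof. by rewrite -(normcN z2); exact: normcD. Qed.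

Lemma normc_sum I (r : seq I) (Q : pred I) (F : I -> R[i]) :
  normc (\sum_(i <- r | Q i) F i) <= \sum_(i <- r | Q i) normc (F i).
Proof.
elim/big_rec2 : _ => [|i a b _ le_ab]; first by rewrite normc0.
by apply: le_trans (normcD _ _) _; rewrite lerD2l.
Qed.

Lemma normc_nat n : normc (n%:R : R[i]) = n%:R.
Proof.
by rewrite -[n%:R in LHS](rmorph_nat (real_complex R)) normcR ger0_norm.
Qed.

Lemma normc_eq0 z : (normc z == 0) = (z == 0).
Proof. by apply/eqP/eqP => [/eq0_normc//|->]; exact: normc0. Qed.

Lemma normc_gt0 z : (0 < normc z) = (z != 0).
Proof. by rewrite lt_neqAle normc_nneg andbT eq_sym normc_eq0. Qed.

Lemma abs_Re_le z : `|complex.Re z| <= normc z.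
Proof.
case: z => a b /=; rewrite -sqrtr_sqr ler_sqrt ?lerDl ?sqr_ge0 //.
by rewrite addr_ge0 ?sqr_ge0.
Qed.

Lemma abs_Im_le z : `|complex.Im z| <= normc z.
Proof.
case: z => a b /=; rewrite -sqrtr_sqr ler_sqrt ?lerDr ?sqr_ge0 //.
by rewrite addr_ge0 ?sqr_ge0.
Qed.

Lemma normc_le_ReIm z : normc z <= `|complex.Re z| + `|complex.Im z|.
Proof.
case: z => a b; rewrite (_ : (a +i* b)%C = (a%:C)%C + (0 +i* b)%C); last first.
  by apply/eqP; rewrite eq_complex /= addr0 add0r !eqxx.
apply: le_trans (normcD _ _) _; rewrite normcR /= expr0n /= add0r sqrtr_sqr.
by rewrite addr0 add0r.
Qed.

Lemma normc2E z : normc z ^+ 2 = complex.Re z ^+ 2 + complex.Im z ^+ 2.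
Proof. by case: z => a b /=; rewrite sqr_sqrtr // addr_ge0 ?sqr_ge0. Qed.

Lemma ReD z1 z2 : complex.Re (z1 + z2) = complex.Re z1 + complex.Re z2.
Proof. by case: z1 z2 => [a b] [d e]. Qed.

Lemma ImD z1 z2 : complex.Im (z1 + z2) = complex.Im z1 + complex.Im z2.
Proof. by case: z1 z2 => [a b] [d e]. Qed.

Lemma Re_sum I (r : seq I) (Q : pred I) (F : I -> R[i]) :
  complex.Re (\sum_(i <- r | Q i) F i) = \sum_(i <- r | Q i) complex.Re (F i).
Proof. by apply: (big_morph _ ReD). Qed.

Lemma Im_sum I (r : seq I) (Q : pred I) (F : I -> R[i]) :
  complex.Im (\sum_(i <- r | Q i) F i) = \sum_(i <- r | Q i) complex.Im (F i).
Proof. by apply: (big_morph _ ImD). Qed.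

(** The sum times [cis x - 1] telescopes to [cis (M x) - 1], which is 0. The factor does not vanish:
    [0 < x / 2 < pi], so [sin (x / 2)] is positive and [cos x < 1]. *)
Lemma sum_cis_root M m : (0 < m < M)%N ->
  \sum_(j < M) cis (2 * pi / M%:R * m%:R * j%:R) = 0 :> R[i].
Proof.
move=> /andP[m0 mM]; set x : R := 2 * pi / M%:R * m%:R.
have M0 : 0 < M%:R :> R by rewrite ltr0n (leq_ltn_trans _ mM).
have E : (cis x - 1) * \sum_(j < M) cis (x * j%:R) = 0.
  transitivity ((cis x - 1) * \sum_(j < M) cis x ^+ j).
    by congr (_ * _); apply: eq_bigr => j _; rewrite cisX mulrC.
  rewrite -subrX1 cisX; set y := _ * x.
  have -> : y = pi + pi + m.-1%:R * (pi + pi) :> R.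
    have mE : m%:R = m.-1%:R + 1 :> R by rewrite natr1 prednK.
    by rewrite /y /x; set k := m.-1 in mE *; rewrite mE; field; rewrite gt_eqF.
  have c2 : cis (pi + pi) = 1 :> R[i].
    rewrite /cis cosD sinD cospi sinpi; apply/eqP.
    by rewrite eq_complex /=; apply/andP; split; apply/eqP; ring.
  by rewrite cisD -cisX c2 expr1n mulr1 subrr.
move/eqP: E; rewrite mulf_eq0 => /orP[|/eqP //].
rewrite subr_eq0 eq_complex /= => /andP[/eqP cx1 _].
have x2 : 0 < x / 2 < pi.
  have -> : x / 2 = pi * (m%:R / M%:R) by rewrite /x; field; rewrite gt_eqF.
  have mM0 : 0 < m%:R / M%:R :> R by rewrite divr_gt0 // ltr0n.
  rewrite mulr_gt0 ?pi_gt0//= -[ltRHS]mulr1 ltr_pM2l ?pi_gt0//.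
  by rewrite ltr_pdivrMr// mul1r ltr_nat.
have s0 := sin_gt0_pi x2; have c2 := cos2Dsin2 (x / 2).
have xE : x = x / 2 + x / 2 by field.
move: cx1; rewrite xE cosD -!expr2 => c1.
have s2 : sin (x / 2) ^+ 2 > 0 by rewrite exprn_gt0.
by exfalso; lra.
Qed.

End Complex.

(** * Formal power series in [w] *)

Section PowerSeries.
Variable R : realType.

(** A name of its own carries the Cauchy product as ring structure, so that identities between
    series can be settled by [ring]. *)
Definition fps := nat -> R[i].
Implicit Types a b : fps.

HB.instance Definition _ := gen_eqMixin fps.
HB.instance Definition _ := gen_choiceMixin fps.

(** A coefficient of a product depends only on coefficients of no larger index, so associativity,
    commutativity and the Leibniz rule are inherited from polynomials. *)
Definition fps_trunc N a : {poly R[i]} := \poly_(i < N) a i.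

Let fadd a b : fps := fun n => a n + b n.
Let fopp a : fps := fun n => - a n.
Let fzero : fps := fun=> 0.
Let fone : fps := fun n => (n == 0%N)%:R.
Let fmul a b : fps := fun n => \sum_(i < n.+1) a i * b (n - i)%N.

Let faddA : associative fadd.
Proof. by move=> a b d; apply/funext => n; exact: addrA. Qed.
Let faddC : commutative fadd.
Proof. by move=> a b; apply/funext => n; exact: addrC. Qed.
Let fadd0 : left_id fzero fadd.
Proof. by move=> a; apply/funext => n; exact: add0r. Qed.
Let faddN : left_inverse fzero fopp fadd.
Proof. by move=> a; apply/funext => n; exact: addNr. Qed.

HB.instance Definition _ := GRing.isZmodule.Build fps faddA faddC fadd0 faddN.

Let fmulE N a b n : (n < N)%N ->
  fmul a b n = (fps_trunc N a * fps_trunc N b)`_n.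
Proof.
move=> nN; rewrite coefM; apply: eq_bigr => i _.
rewrite !coef_poly ifT; last by apply: leq_ltn_trans nN; rewrite -ltnS.
by rewrite ifT// (leq_ltn_trans (leq_subr _ _) nN).
Qed.

Let fmulA : associative fmul.
Proof.
move=> a b d; apply/funext => n.
have e1 : fmul a (fmul b d) n =
    (fps_trunc n.+1 a * (fps_trunc n.+1 b * fps_trunc n.+1 d))`_n.
  rewrite coefM; apply: eq_bigr => i _.
  rewrite coef_poly ltn_ord; congr (_ * _).
  by apply: fmulE; rewrite ltnS leq_subr.
have e2 : fmul (fmul a b) d n =
    ((fps_trunc n.+1 a * fps_trunc n.+1 b) * fps_trunc n.+1 d)`_n.
  rewrite coefM; apply: eq_bigr => i _.
  rewrite coef_poly ltnS leq_subr; congr (_ * _).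
  exact: fmulE.
by rewrite e1 e2 mulrA.
Qed.
Let fmulC : commutative fmul.
Proof.
by move=> a b; apply/funext => n; rewrite !(@fmulE n.+1)// mulrC.
Qed.
Let fmul1 : left_id fone fmul.
Proof.
move=> a; apply/funext => n; rewrite /fmul big_ord_recl /= subn0 mul1r.
by rewrite big1 ?addr0// => i _; rewrite mul0r.
Qed.
Let fmulDl : left_distributive fmul fadd.
Proof.
move=> a b d; apply/funext => n; rewrite /fmul /fadd -big_split /=.
by apply: eq_bigr => i _; rewrite mulrDl.
Qed.
Let fone_neq0 : fone != 0.
Proof.
apply/eqP => /(congr1 (fun f : fps => f 0%N)) /eqP.
by rewrite /fone eqxx oner_eq0.
Qed.

HB.instance Definition _ := GRing.Zmodule_isComNzRing.Build fps
  fmulA fmulC fmul1 fmulDl fone_neq0.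

Lemma fpsDE a b n : (a + b) n = a n + b n. Proof. by []. Qed.
Lemma fpsNE a n : (- a) n = - a n. Proof. by []. Qed.
Lemma fps0E n : (0 : fps) n = 0. Proof. by []. Qed.
Lemma fps1E n : (1 : fps) n = (n == 0%N)%:R. Proof. by []. Qed.
Lemma fpsME a b n : (a * b) n = \sum_(i < n.+1) a i * b (n - i)%N.
Proof. by []. Qed.

Lemma fps_sumE I (r : seq I) (Q : pred I) (F : I -> fps) n :
  (\sum_(i <- r | Q i) F i) n = \sum_(i <- r | Q i) F i n.
Proof.
exact: (big_morph (fun f : fps => f n) (fun a b => fpsDE a b n) (fps0E n)).
Qed.

Lemma fpsM_coef N a b n : (n < N)%N ->
  (a * b) n = (fps_trunc N a * fps_trunc N b)`_n.
Proof. exact: fmulE. Qed.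

Definition fpsC (z : R[i]) : fps := fun n => if n is 0%N then z else 0.

Lemma fpsCM z a n : (fpsC z * a) n = z * a n.
Proof.
by rewrite fpsME big_ord_recl /= subn0 big1 ?addr0// => i _; rewrite mul0r.
Qed.

Lemma fpsC1 : fpsC 1 = 1.
Proof. by apply/funext => -[|n]. Qed.

Lemma fpsCMC z1 z2 : fpsC (z1 * z2) = fpsC z1 * fpsC z2.
Proof. by apply/funext => n; rewrite fpsCM; case: n => //= n; rewrite mulr0. Qed.

(* the Taylor expansion of [s] at [s = c - w] *)
Definition fpsS (c : R[i]) : fps :=
  fun n => match n with 0%N => c | 1%N => -1 | _ => 0 end.

Lemma fpsSM0 c a : (fpsS c * a) 0%N = c * a 0%N.
Proof. by rewrite fpsME big_ord1. Qed.

Lemma fpsSMS c a n : (fpsS c * a) n.+1 = c * a n.+1 - a n.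
Proof.
rewrite fpsME !big_ord_recl /= subn0 subSS subn0 big1 ?addr0 ?mulN1r//.
by move=> i _; rewrite mul0r.
Qed.

Lemma fpsS1 c : fpsS c - 1 = fpsS (c - 1).
Proof.
apply/funext => -[|[|n]]; rewrite fpsDE fpsNE fps1E /= ?subr0 //.
Qed.

(** The derivative in [w = c - s], opposite to the one in [s]; this is why [fpsD (fpsS c)] is -1 and
    why Z' = L Z holds with a plus sign. *)
Definition fpsD a : fps := fun n => a n.+1 *+ n.+1.

Lemma fpsDD a b : fpsD (a + b) = fpsD a + fpsD b.
Proof. by apply/funext => n; exact: mulrnDl. Qed.

Lemma fpsDN a : fpsD (- a) = - fpsD a.
Proof. by apply/funext => n; exact: mulNrn. Qed.

Lemma fpsD1 : fpsD 1 = 0.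
Proof. by apply/funext => n; rewrite /fpsD fps1E mul0rn. Qed.

Lemma fpsDS c : fpsD (fpsS c) = - 1.
Proof.
apply/funext => -[|n]; rewrite fpsNE fps1E; first by [].
by rewrite /fpsD /= mul0rn oppr0.
Qed.

Lemma fpsDM a b : fpsD (a * b) = fpsD a * b + a * fpsD b.
Proof.
apply/funext => n; rewrite fpsDE /fpsD (@fpsM_coef n.+2)// -coef_deriv derivM coefD.
congr (_ + _).
  rewrite coefM fpsME; apply: eq_bigr => i _.
  rewrite coef_deriv !coef_poly !ifT//; first by rewrite ltnS ltnW// ltnS leq_subr.
  by rewrite ltnS ltn_ord.
rewrite coefM fpsME; apply: eq_bigr => i _.
by rewrite coef_deriv !coef_poly !ifT// ?ltnS ?leq_subr// ltnW// ltn_ord.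
Qed.

End PowerSeries.

(** * Elementary estimates *)

Section Growth.
Variable R : realType.
Local Notation nc := (@normc R).
Implicit Types (lam y : fps R).

Lemma poly_le_expR (a : R) k : 0 < a ->
  exists2 C, 0 < C & forall v, 0 <= v -> (1 + v) ^+ k <= C * expR (a * v).
Proof.
elim: k a => [|k IH] a a0.
  exists 1 => // v v0; rewrite expr0 mul1r.
  by apply: le_trans (expR_ge1Dx _); rewrite lerDl mulr_ge0// ltW.
have a2 : 0 < a / 2 by rewrite divr_gt0.
have [C C0 HC] := IH _ a2.
have D0 : 0 < (a / 2)^-1 by rewrite invr_gt0.
exists ((1 + (a / 2)^-1) * C) => [|v v0]; first by rewrite mulr_gt0// addr_gt0.
have -> : expR (a * v) = expR (a / 2 * v) * expR (a / 2 * v).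
  by rewrite -expRD -mulrDl -splitr.
rewrite exprS mulrACA.
apply: ler_pM; rewrite ?exprn_ge0 ?addr_ge0 ?HC//.
apply: (@le_trans _ _ ((1 + (a / 2)^-1) * (1 + a / 2 * v))); last first.
  by rewrite ler_pM2l ?expR_ge1Dx// addr_gt0.
rewrite mulrDl mul1r mulrDr mulr1 mulrA mulVf ?gt_eqF// mul1r.
have : 0 <= a / 2 * v by rewrite mulr_ge0// ltW.
move: D0; lra.
Qed.

Lemma poly_le_expn (x : R) k : 1 < x ->
  exists2 C, 0 < C & forall n : nat, (1 + n%:R) ^+ k <= C * x ^+ n.
Proof.
move=> x1; have [C C0 HC] := poly_le_expR k (ln_gt0 x1).
exists C => // n; apply: le_trans (HC n%:R (ler0n _ _)) _.
by rewrite expRM_natr lnK// posrE (lt_trans _ x1).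
Qed.

(** Majorant method: with [lam k] replaced by [B / rho^(k+1)] the equation is solved by (1 - w /
    rho)^(-B), whose coefficients dominate those of [y] up to the factor [nc (y 0)]. A natural [B]
    turns them into binomial coefficients. *)
Lemma exp_majorant lam y (rho q : R) (B : nat) : 0 < rho -> 0 < q < 1 ->
  fpsD y = lam * y -> (forall k, nc (lam k) * rho ^+ k.+1 <= B%:R) ->
  forall n, nc (y n) * (q * rho) ^+ n <= nc (y 0%N) * (1 - q)^-1 ^+ B.
Proof.
move=> rho0 /andP[q0 q1] ode lamB n.
pose h j := nc (y j) * rho ^+ j.
have h0 j : 0 <= h j by rewrite mulr_ge0 ?normc_nneg// exprn_ge0// ltW.
have step m : m.+1%:R * h m.+1 <= B%:R * \sum_(j < m.+1) h j.
  have -> : m.+1%:R * h m.+1 = nc ((lam * y) m) * rho ^+ m.+1.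
    by rewrite -ode /fpsD -[y m.+1 *+ m.+1]mulr_natl normcM normc_nat mulrA.
  rewrite fpsME mulr_sumr (reindex_inj rev_ord_inj) /=.
  apply: (@le_trans _ _ (\sum_(j < m.+1)
     nc (lam (m.+1 - j.+1)%N * y (m - (m.+1 - j.+1))%N) * rho ^+ m.+1)).
    rewrite -mulr_suml ler_wpM2r ?exprn_ge0 ?(ltW rho0)//; exact: normc_sum.
  apply: ler_sum => j _; rewrite subSS.
  have jm : (j <= m)%N by rewrite -ltnS.
  rewrite subKn// normcM (_ : rho ^+ m.+1 = rho ^+ (m - j).+1 * rho ^+ j); last first.
    by rewrite -exprD addSn subnK.
  by rewrite mulrACA; apply: ler_wpM2r; [exact: h0|exact: lamB].
(* The recursion [step] involves partial sums, so these are what is bounded: ['C(m + B, m)] is the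
   sum of the coefficients of (1 - x)^(-B) up to index m. *)
have sumle m : \sum_(j < m.+1) h j <= nc (y 0%N) * 'C(m + B, m)%:R.
  elim: m => [|m IH].
    by rewrite big_ord1 bin0 /h expr0 !mulr1.
  rewrite big_ord_recr /=.
  have m0 : 0 < m.+1%:R :> R by rewrite ltr0n.
  have binE : 'C(m.+1 + B, m.+1)%:R = 'C(m + B, m)%:R * (1 + B%:R / m.+1%:R) :> R.
    have := mul_bin_diag (m.+1 + B) m; rewrite addSn /= => /(congr1 (fun k => k%:R : R)).
    rewrite !natrM => E; apply: (mulfI (negbT (gt_eqF m0))).
    rewrite -E mulrCA mulrDr mulr1 mulrCA divff ?gt_eqF// mulr1 -natrD addSn.
    by rewrite mulrC.
  rewrite binE; set S := \sum_(_ < _) _ in IH *.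
  have hm : h m.+1 <= B%:R / m.+1%:R * S.
    by rewrite mulrAC ler_pdivlMr// mulrC; exact: step.
  apply: (@le_trans _ _ (S * (1 + B%:R / m.+1%:R))).
    by rewrite mulrDr mulr1 lerD2l [leRHS]mulrC.
  by rewrite mulrA ler_wpM2r// addr_ge0// divr_ge0.
have hn : h n <= nc (y 0%N) * 'C(n + B, n)%:R.
  by apply: le_trans (sumle n); rewrite big_ord_recr /= lerDr sumr_ge0.
(* A single term of the binomial expansion of ((1 - q) + q)^(n + B), whose total is 1. *)
have prob : 'C(n + B, n)%:R * (q ^+ n * (1 - q) ^+ B) <= 1.
  apply: (@le_trans _ _ (((1 - q) + q) ^+ (n + B))); last by rewrite subrK expr1n.
  have nB : (n < (n + B).+1)%N by rewrite ltnS leq_addr.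
  rewrite (exprDn (1 - q) q) (bigD1 (Ordinal nB))//= addKn.
  apply: (@le_trans _ _ ((1 - q) ^+ B * q ^+ n *+ 'C(n + B, n))).
    by rewrite -[leRHS]mulr_natl [q ^+ n * _]mulrC lexx.
  rewrite lerDl.
  apply: sumr_ge0 => i _; rewrite mulrn_wge0// mulr_ge0// exprn_ge0 ?(ltW q0)//.
  by rewrite subr_ge0 ltW.
rewrite exprVn ler_pdivlMr ?exprn_gt0 ?subr_gt0// exprMn.
have -> : nc (y n) * (q ^+ n * rho ^+ n) * (1 - q) ^+ B =
    h n * (q ^+ n * (1 - q) ^+ B).
  by rewrite /h [q ^+ n * rho ^+ n]mulrC !mulrA.
apply: (@le_trans _ _ (nc (y 0%N) * ('C(n + B, n)%:R * (q ^+ n * (1 - q) ^+ B)))).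
  rewrite [leRHS]mulrA; apply: ler_wpM2r => //.
  by rewrite mulr_ge0// exprn_ge0// ?subr_ge0 ltW.
by rewrite ler_piMr// normc_nneg.
Qed.

(** Plays the part of the three circles theorem. Indices below a threshold use [C0]; later ones gain
    the factor (rho / r)^n over the bound on the larger circle. Neither the threshold nor [C2]
    depends on the sequence or on [L], so [L] may later be log t with constants uniform in t. *)
Lemma three_circles (C0 C1 rho r eps : R) : 0 < rho < r -> 0 <= C0 -> 0 <= C1 ->
  0 < eps -> exists2 C2, 0 <= C2 & forall (a : nat -> R) (L : R), 0 <= L ->
  (forall n, 0 <= a n <= C0) -> (forall n, a n * r ^+ n <= C1 * L) ->
  forall n, a n * rho ^+ n.+1 <= eps * L + C2.
Proof.
move=> /andP[rho0 rhor] C00 C10 eps0.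
have r0 := lt_trans rho0 rhor.
have x1 : 1 < r / rho by rewrite ltr_pdivlMr// mul1r.
have [D D0 HD] := poly_le_expn 1 x1.
(* From [m] on, (r / rho)^n, being at least (1 + n) / D, exceeds C1 rho / eps. *)
pose m := Num.bound (C1 * rho * D / eps).
pose S := 1 + rho.
exists (C0 * S ^+ m.+1) => [|a L L0 a0 aL n].
  by rewrite mulr_ge0// exprn_ge0// addr_ge0// ltW.
have /andP[an0 anC] := a0 n.
have [nm|mn] := ltnP n m.
  apply: (@le_trans _ _ (C0 * S ^+ m.+1)); last by rewrite lerDr mulr_ge0// ltW.
  apply: ler_pM => //; first by rewrite exprn_ge0// ltW.
  apply: (@le_trans _ _ (S ^+ n.+1)).
    by rewrite lerXn2r// ?nnegrE ?addr_ge0// ?(ltW rho0)// /S lerDr.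
  by rewrite ler_weXn2l// ?lerDl ?(ltW rho0)// ltnS ltnW.
apply: (@le_trans _ _ (eps * L)); last first.
  by rewrite lerDl mulr_ge0// exprn_ge0// addr_ge0// ltW.
have x0 : 0 < (r / rho) ^+ n by rewrite exprn_gt0// divr_gt0.
have -> : a n * rho ^+ n.+1 = (a n * r ^+ n) * (rho / (r / rho) ^+ n).
  by rewrite expr_div_n exprS; field; rewrite !expf_neq0// gt_eqF.
apply: (@le_trans _ _ (C1 * L * (rho / (r / rho) ^+ n))).
  by rewrite ler_wpM2r// divr_ge0// ltW.
rewrite mulrA ler_pdivrMr//; set X := _ ^+ n in x0 *.
rewrite (_ : C1 * L * rho = L * (C1 * rho)); last by ring.
rewrite (_ : eps * L * X = L * (eps * X)); last by ring.
apply: ler_wpM2l => //.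
have mE : C1 * rho * D / eps <= 1 + n%:R.
  apply: le_trans (ler_norm _) _; apply: ltW.
  apply: (lt_le_trans (archi_boundP _)); first by rewrite normr_ge0.
  rewrite -/m ger0_norm; last by rewrite divr_ge0// ?(ltW eps0)// !mulr_ge0// ltW.
  by rewrite -/m -[leLHS]add0r lerD// ler_nat.
move: mE; rewrite ler_pdivrMr// => mE.
have := HD n; rewrite expr1 => HDn.
rewrite -(ler_pM2r D0); apply: le_trans mE _.
rewrite (_ : eps * X * D = D * X * eps); last by ring.
by rewrite ler_pM2r.
Qed.

End Growth.

(** * Borel-Caratheodory for polynomials *)

Section BorelCaratheodory.
Variable R : realType.
Local Notation nc := (@normc R).
Local Notation Re := (@complex.Re R).
Local Notation Im := (@complex.Im R).
Implicit Types (lam y : fps R) (p : {poly R[i]}).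

Lemma Re_le_normc (z : R[i]) (B : R) : nc z <= B -> `|Re z| <= B.
Proof. by move=> h; apply: le_trans h; exact: abs_Re_le. Qed.

Lemma Im_le_normc (z : R[i]) (B : R) : nc z <= B -> `|Im z| <= B.
Proof. by move=> h; apply: le_trans h; exact: abs_Im_le. Qed.

Lemma conjcM (a b : R[i]) : (a * b)^*%C = a^*%C * b^*%C.
Proof. exact: (rmorphM (@conjc R)). Qed.

Lemma conjc_sum I (r : seq I) (Q : pred I) (F : I -> R[i]) :
  (\sum_(i <- r | Q i) F i)^*%C = \sum_(i <- r | Q i) (F i)^*%C.
Proof. exact: (raddf_sum (@conjc R)). Qed.

(** Fourier analysis on roots of unity instead of integrals over the circle. [H - Re q] is
    nonnegative with mean [H], because [l 0 = 0]; so its n-th Fourier coefficient is at most [H] in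
    modulus, and that coefficient is minus half of l_n r^n. *)
Lemma Re_poly_coef (N : nat) (l : nat -> R[i]) (r H : R) : 0 <= r -> l 0%N = 0 ->
  (forall w, nc w = r -> Re (\sum_(i < N.+1) l i * w ^+ i) <= H) ->
  forall n, (0 < n <= N)%N -> nc (l n) * r ^+ n <= 2 * H.
Proof.
move=> r0 l0 ReH n /andP[n0 nN].
(* With more than 2N points, the frequencies i + n and i - n for i, n <= N are never nonzero
   multiples of [M], so there is no aliasing. *)
set M := (N + N).+1.
pose th : R := 2 * pi / M%:R.
pose q (j : 'I_M) := \sum_(i < N.+1) l i * ((r%:C)%C * cis (th * j%:R)) ^+ i.
have qE j (d : R) : q j * cis (th * d * j%:R) =
    \sum_(i < N.+1) l i * (r%:C)%C ^+ i * cis (th * (i%:R + d) * j%:R).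
  rewrite mulr_suml; apply: eq_bigr => i _; rewrite exprMn cisX -!mulrA -cisD.
  by congr (_ * (_ * cis _)); ring.
have cis_sum m : (0 < m < M)%N -> \sum_(j < M) cis (th * m%:R * j%:R) = 0.
  exact: sum_cis_root.
have cisN_sum m : (0 < m < M)%N -> \sum_(j < M) cis (th * (- m%:R) * j%:R) = 0.
  move=> mM; have := congr1 (@conjc R) (cis_sum m mM).
  rewrite conjc_sum conjc0 => E; rewrite -[RHS]E.
  by apply: eq_bigr => j _; rewrite conjc_cis; congr cis; ring.
have sum_exch (d : R) : \sum_j q j * cis (th * d * j%:R) =
    \sum_(i < N.+1) l i * (r%:C)%C ^+ i * \sum_(j < M) cis (th * (i%:R + d) * j%:R).
  under eq_bigr do rewrite qE.
  by rewrite exchange_big /=; apply: eq_bigr => i _; rewrite mulr_sumr.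
have S2 : \sum_j q j * cis (th * n%:R * j%:R) = 0.
  rewrite sum_exch big1// => i _; rewrite -natrD cis_sum ?mulr0//.
  by rewrite addn_gt0 n0 orbT /= ltnS leq_add// -ltnS.
have S1 : \sum_j q j = 0.
  transitivity (\sum_j q j * cis (th * 0 * j%:R)).
    by apply: eq_bigr => j _; rewrite mulr0 mul0r cis0 mulr1.
  rewrite sum_exch big1// => i _; rewrite addr0.
  have [->|i0] := eqVneq (i : nat) 0%N; first by rewrite l0 !mul0r.
  rewrite cis_sum ?mulr0// lt0n i0 /= ltnS.
  by rewrite (leq_trans _ (leq_addr _ _))// -ltnS.
have S3 : \sum_j q j * cis (th * (- n%:R) * j%:R) = M%:R * (l n * (r%:C)%C ^+ n).
  have nN1 : (n < N.+1)%N by rewrite ltnS.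
  rewrite sum_exch (bigD1 (Ordinal nN1))//= subrr [X in _ + X]big1 ?addr0; last first.
    move=> i ini; have ni : (i : nat) != n by apply: contra ini => /eqP E; apply/eqP/val_inj.
    rewrite (_ : \sum_(_ < _) _ = 0) ?mulr0//.
    have [iln|nli] := ltnP i n.
      have -> : i%:R - n%:R = - (n - i)%:R :> R by rewrite natrB ?opprB// ltnW.
      rewrite cisN_sum// subn_gt0 iln /= ltnS (leq_trans (leq_subr _ _))//.
      by rewrite (leq_trans nN)// leq_addr.
    rewrite -natrB// cis_sum// subn_gt0 ltn_neqAle eq_sym ni nli /=.
    by rewrite ltnS (leq_trans (leq_subr _ _))// (leq_trans _ (leq_addr _ _))// -ltnS.
  under eq_bigr do rewrite mulr0 mul0r cis0.
  by rewrite sumr_const card_ord mulrC.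
pose a (j : 'I_M) := H - Re (q j).
have a0 j : 0 <= a j.
  rewrite subr_ge0; apply: ReH.
  by rewrite normcM normcR normc_cis mulr1 ger0_norm.
have asum : \sum_j a j = M%:R * H.
  rewrite /a big_split /= sumrN -Re_sum S1 /= subr0 sumr_const card_ord.
  by rewrite mulr_natl.
pose z := \sum_j (a j)%:C%C * cis (th * (- n%:R) * j%:R).
have zle : nc z <= M%:R * H.
  rewrite -asum; apply: le_trans (normc_sum _ _ _) _; apply: ler_sum => j _.
  by rewrite normcM normc_cis mulr1 normcR ger0_norm.
have zE : 2 * z = - (M%:R * (l n * (r%:C)%C ^+ n)).
  (* Twice the real part is [q] plus its conjugate; the conjugate part sums to the conjugate of
     [S2], that is to 0. *)
  have E j : 2 * ((a j)%:C%C * cis (th * (- n%:R) * j%:R)) =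
      (2 * H)%:C%C * cis (th * (- n%:R) * j%:R) - q j * cis (th * (- n%:R) * j%:R)
      - (q j * cis (th * n%:R * j%:R))^*%C.
    rewrite conjcM conjc_cis.
    have -> : - (th * n%:R * j%:R) = th * (- n%:R) * j%:R by ring.
    rewrite mulrA -!mulrBl; congr (_ * _).
    rewrite /a rmorphB rmorphM !rmorph_nat -addrA -opprD addcJ; ring.
  rewrite /z mulr_sumr (eq_bigr _ (fun j _ => E j)) !big_split /= !sumrN S3.
  rewrite -conjc_sum S2 conjc0 subr0 -mulr_sumr cisN_sum ?mulr0 ?add0r//.
  by rewrite n0 /= ltnS (leq_trans nN)// leq_addr.
have M0 : 0 < M%:R :> R by rewrite ltr0n.
have := congr1 nc zE; rewrite normcN !normcM !normc_nat normcX normcR ger0_norm// => E.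
rewrite -(ler_pM2l M0) -E mulrCA ler_pM2l//.
Qed.

Lemma is_derive_ReIm_horner p (w : R[i]) (x : R) :
  is_derive x 1 (fun x => Re p.[x%:C%C * w]) (Re (w * p^`().[x%:C%C * w])) /\
  is_derive x 1 (fun x => Im p.[x%:C%C * w]) (Im (w * p^`().[x%:C%C * w])).
Proof.
elim/poly_ind: p => [|p c [IHr IHi]].
  split.
    have -> : (fun x : R => Re (0 : {poly R[i]}).[x%:C%C * w]) = cst 0.
      by apply/funext => t; rewrite horner0.
    by rewrite deriv0 horner0 mulr0; exact: is_derive_cst.
  have -> : (fun x : R => Im (0 : {poly R[i]}).[x%:C%C * w]) = cst 0.
    by apply/funext => t; rewrite horner0.
  by rewrite deriv0 horner0 mulr0; exact: is_derive_cst.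
set fr := fun x : R => Re p.[x%:C%C * w] in IHr.
set fi := fun x : R => Im p.[x%:C%C * w] in IHi.
have Er : (fun x : R => Re (p * 'X + c%:P).[x%:C%C * w]) =
    (fr * (id * cst (Re w)) - fi * (id * cst (Im w)) + cst (Re c)).
  apply/funext => t; rewrite hornerD hornerMX hornerC /fr /fi !fctE /=.
  move: (p.[_]) => A; clear; case: A w c => [a b] [d e] [f g] /=; ring.
have Ei : (fun x : R => Im (p * 'X + c%:P).[x%:C%C * w]) =
    (fr * (id * cst (Im w)) + fi * (id * cst (Re w)) + cst (Im c)).
  apply/funext => t; rewrite hornerD hornerMX hornerC /fr /fi !fctE /=.
  move: (p.[_]) => A; clear; case: A w c => [a b] [d e] [f g] /=; ring.
have dE : (p * 'X + c%:P)^`() = p^`() * 'X + p.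
  by rewrite derivD derivM derivX derivC addr0 mulr1.
rewrite Er Ei dE; split; apply: is_derive_eq.
  rewrite hornerD hornerMX /fr /fi !fctE /=.
  rewrite !scaler0 !add0r !addr0 /GRing.scale /=.
  move: (p.[_]) (p^`().[_]) => A B; clear; case: A B w => [a b] [d e] [f g] /=; ring.
rewrite hornerD hornerMX /fr /fi !fctE /=.
rewrite !scaler0 !add0r !addr0 /GRing.scale /=.
move: (p.[_]) (p^`().[_]) => A B; clear; case: A B w => [a b] [d e] [f g] /=; ring.
Qed.

Lemma MVT_bound (g dg : R -> R) (K : R) :
  (forall x : R, is_derive x 1 g (dg x)) -> (forall x : R, 0 <= x <= 1 -> `|dg x| <= K) ->
  `|g 1 - g 0| <= K.
Proof.
move=> dgP dgK.
have cg : {within `[0, 1], continuous g}.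
  by apply: derivable_within_continuous => t _; have [] := dgP t.
have [x] := MVT_segment ler01 (fun t _ => dgP t) cg.
by rewrite in_itv /= => x01 ->; rewrite subr0 mulr1; exact: dgK.
Qed.

Lemma geo_partial (x : R) N : 0 <= x < 1 -> \sum_(i < N) x ^+ i <= (1 - x)^-1.
Proof.
move=> /andP[x0 x1]; have x10 : 0 < 1 - x by rewrite subr_gt0.
rewrite -(ler_pM2l x10) divff ?gt_eqF// -opprB mulNr -subrX1 opprB.
by rewrite lerBlDr lerDl exprn_ge0.
Qed.

Lemma geo_sum_le (a : nat -> R) (A rr r : R) N : 0 < r < rr -> 0 <= A ->
  (forall n, a n * rr ^+ n <= A) ->
  \sum_(i < N) a i * r ^+ i <= A / (1 - r / rr).
Proof.
move=> /andP[r0 rrr] A0 aA; have rr0 := lt_trans r0 rrr.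
apply: (@le_trans _ _ (\sum_(i < N) A * (r / rr) ^+ i)).
  apply: ler_sum => i _.
  have -> : a i * r ^+ i = a i * rr ^+ i * (r / rr) ^+ i.
    by rewrite expr_div_n; field; rewrite expf_neq0// gt_eqF.
  by apply: ler_wpM2r => //; rewrite exprn_ge0// divr_ge0// ltW.
rewrite -mulr_sumr; apply: ler_wpM2l => //; apply: geo_partial.
by rewrite divr_ge0 ?ltr_pdivrMr ?mul1r// ltW.
Qed.

(** Formally y = y_0 exp(l) with l the primitive of [lam], so Re l = ln |y / y_0| is bounded above
    in terms of [A], and [Re_poly_coef] then bounds the coefficients of l. Since the series are
    formal, both are cut to polynomials; [A'] acts only through the order [N] of the truncation and
    therefore does not occur in the conclusion. *)
Lemma borel_caratheodory lam y (A A' rr r : R) : 0 < r < rr ->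
  fpsD y = lam * y -> (forall n, nc (y n) * rr ^+ n <= A) ->
  (forall n, nc (lam n) * rr ^+ n <= A') -> y 0%N != 0 ->
  forall n, nc (lam n) * r ^+ n.+1 <=
    n.+1%:R * ln (2 * (A / (1 - r / rr)) ^+ 2 / nc (y 0%N) ^+ 2).
Proof.
move=> rP ode yA lamA y00 n; have /andP[r0 rrr] := rP; have rr0 := lt_trans r0 rrr.
set x := r / rr.
have x0 : 0 < x by rewrite divr_gt0.
have x1 : x < 1 by rewrite ltr_pdivrMr// mul1r.
have x10 : 0 < 1 - x by rewrite subr_gt0.
have Y0 : 0 < nc (y 0%N) by rewrite normc_gt0.
have A0 : 0 < A by apply: lt_le_trans Y0 _; have := yA 0%N; rewrite expr0 mulr1.
have A'0 : 0 <= A'.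
  by apply: le_trans (lamA 0%N); rewrite expr0 mulr1 normc_nneg.
set S := A / (1 - x); have S0 : 0 < S by rewrite divr_gt0.
pose SL := rr * (A' / (1 - x)).
have SL0 : 0 <= SL by rewrite !mulr_ge0 ?invr_ge0// ltW.
pose K := expR (2 * SL) * (4 * S * r) * (A' * A) * expR (2 * SL).
have K0 : 0 <= K by rewrite /K; pos.
have ix1 : 1 < x^-1 by rewrite invf_gt1.
have [C C0 HC] := poly_le_expn 3 ix1.
(* Large enough for the truncation error [eta], amplified as in [etaK], to stay below [S ^+ 2]; this
   doubling of [S ^+ 2] is the factor 2 under the logarithm. The summand [n.+1] keeps [lam n] inside
   the truncation. *)
pose N := (n.+1 + Num.bound (4 * C * K / S ^+ 2))%N.
have nN : (n < N)%N by rewrite leq_addr.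
pose eta := (N.*2.+1%:R) ^+ 2 * (A' * A) * x ^+ N.
have etaK : expR (2 * SL) * (4 * S * r) * eta * expR (2 * SL) <= S ^+ 2.
  have -> : expR (2 * SL) * (4 * S * r) * eta * expR (2 * SL) =
      (N.*2.+1%:R) ^+ 2 * x ^+ N * K by rewrite /eta /K; ring.
  have N0 : 0 < 1 + N%:R :> R by rewrite ltr_pwDl.
  have xN0 : 0 < x ^+ N by rewrite exprn_gt0.
  have h1 : (N.*2.+1%:R) ^+ 2 * x ^+ N <= 4 * C / (1 + N%:R).
    rewrite ler_pdivlMr//; have := HC N; rewrite exprVn ler_pdivlMr// => HN.
    apply: (@le_trans _ _ (4 * ((1 + N%:R) ^+ 3 * x ^+ N))); last by rewrite ler_pM2l.
    have -> : 4 * ((1 + N%:R) ^+ 3 * x ^+ N) =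
       (2 * (1 + N%:R)) ^+ 2 * x ^+ N * (1 + N%:R) :> R by ring.
    rewrite ler_pM2r// ler_pM2r// lerXn2r// ?nnegrE// ?mulr_ge0// ?ltW//.
    by rewrite -natr1 -muln2 natrM; have : 0 <= N%:R :> R by []; lra.
  apply: (@le_trans _ _ (4 * C / (1 + N%:R) * K)); first exact: ler_wpM2r.
  rewrite mulrAC ler_pdivrMr// [leRHS]mulrC -ler_pdivrMr ?exprn_gt0//.
  apply: le_trans (ler_norm _) _; apply: ltW.
  apply: lt_le_trans (archi_boundP (normr_ge0 _)) _.
  rewrite ger0_norm; last by pos.
  by rewrite -[leLHS]add0r lerD// ler_nat leq_addl.
pose l k : R[i] := if k is j.+1 then lam j / j.+1%:R else 0.
pose yN := \poly_(i < N.+1) y i.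
pose lN := \poly_(i < N.+1) l i.
pose e := yN^`() - lN^`() * yN.
have lNd k : lN^`()`_k = if (k < N)%N then lam k else 0.
  rewrite coef_deriv coef_poly ltnS; case: ifP => _; last by rewrite mul0rn.
  by rewrite /l -[_ *+ _]mulr_natr divfK// pnatr_eq0.
have yNc k : yN`_k = if (k < N.+1)%N then y k else 0 by rewrite coef_poly.
have lam_le k : nc (lam k) <= A' * rr ^- k.
  by rewrite ler_pdivlMr ?exprn_gt0.
have y_le k : nc (y k) <= A * rr ^- k.
  by rewrite ler_pdivlMr ?exprn_gt0.
(* The coefficients of [e] vanish below [N] by the differential equation and above [2N] by degree;
   in between each is at most (k + 1) A' A / rr^k. *)
have e_le k : nc e`_k * r ^+ k <= N.*2.+1%:R * (A' * A) * x ^+ N.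
  rewrite coefB coef_deriv yNc ltnS coefM.
  have [kN|Nk] := ltnP k N.
    rewrite (_ : \sum_(_ < _) _ = (lam * y) k); last first.
      rewrite fpsME; apply: eq_bigr => j _; rewrite lNd yNc !ifT//.
        by rewrite ltnS (leq_trans (leq_subr _ _))// ltnW.
      by rewrite (leq_ltn_trans _ kN)// -ltnS.
    rewrite -ode /fpsD subrr normc0 mul0r !mulr_ge0// ?exprn_ge0 ?ltW//.
  rewrite mul0rn sub0r normcN.
  have [k2|k2] := leqP k N.*2; last first.
    rewrite big1 ?normc0 ?mul0r; first by rewrite !mulr_ge0// ?exprn_ge0 ?ltW.
    move=> j _; rewrite lNd; case: ifP => jN; last by rewrite mul0r.
    rewrite yNc ifF ?mulr0//; apply/negbTE; rewrite -leqNgt ltn_subRL addnC.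
    by rewrite (leq_trans _ k2)// ltnS -addnn leq_add2l ltnW.
  have xk : x ^+ k <= x ^+ N by rewrite ler_wiXn2l// ltW.
  apply: (@le_trans _ _ (k.+1%:R * (A' * A) * x ^+ k)); last first.
    apply: ler_pM => //; [by pos|by pos|].
    by apply: ler_wpM2r; [pos|rewrite ler_nat ltnS].
  have -> : k.+1%:R * (A' * A) * x ^+ k = k.+1%:R * (A' * A * rr ^- k) * r ^+ k.
    by rewrite /x expr_div_n; ring.
  rewrite ler_pM2r ?exprn_gt0//; apply: le_trans (normc_sum _ _ _) _.
  apply: (@le_trans _ _ (\sum_(j < k.+1) A' * A * rr ^- k)); last first.
    by rewrite sumr_const card_ord mulr_natl.
  apply: ler_sum => j _; rewrite normcM.
  have -> : A' * A * rr ^- k = (A' * rr ^- j) * (A * rr ^- (k - j)).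
    by rewrite mulrACA -invfM -exprD subnKC// -ltnS.
  apply: ler_pM; rewrite ?normc_nneg//.
    rewrite lNd; case: ifP => _ //.
    by rewrite normc0; pos.
  rewrite yNc; case: ifP => _ //.
  by rewrite normc0; pos.
pose H := ln (2 * S ^+ 2 / nc (y 0%N) ^+ 2) / 2.
suff ReH w : nc w = r -> Re (\sum_(i < N.+1) l i * w ^+ i) <= H.
  have := @Re_poly_coef N l r H (ltW r0) erefl ReH n.+1 nN.
  have -> : 2 * H = ln (2 * S ^+ 2 / nc (y 0%N) ^+ 2) by rewrite /H; field.
  rewrite /l normcM normcV normc_nat => h.
  by rewrite [leRHS]mulrC -ler_pdivrMr ?ltr0n// mulrAC.
move=> wr.
have -> : \sum_(i < N.+1) l i * w ^+ i = lN.[w] by rewrite horner_poly.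
have ncxw (t : R) : 0 <= t <= 1 -> nc (t%:C%C * w) <= r.
  by move=> /andP[t0 t1]; rewrite normcM normcR wr ger0_norm// ler_piMl// ltW.
have horner_le (a : nat -> R[i]) (B : R) (t : R) : 0 <= t <= 1 -> 0 <= B ->
    (forall k, nc (a k) * rr ^+ k <= B) ->
    forall M, nc (\sum_(i < M) a i * (t%:C%C * w) ^+ i) <= B / (1 - x).
  move=> t01 B0 aB M; apply: le_trans (normc_sum _ _ _) _.
  apply: le_trans (@geo_sum_le (nc \o a) B rr r M rP B0 aB).
  apply: ler_sum => i _; rewrite normcM normcX /= ler_wpM2l ?normc_nneg//.
  by rewrite lerXn2r ?nnegrE ?normc_nneg ?(ltW r0)// ncxw.
have yN_le (t : R) : 0 <= t <= 1 -> nc yN.[t%:C%C * w] <= S.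
  by move=> t01; rewrite horner_poly; apply: horner_le => //; exact: ltW.
have lN_le (t : R) : 0 <= t <= 1 -> nc lN.[t%:C%C * w] <= SL.
  move=> t01; rewrite horner_poly.
  rewrite /SL mulrA; apply: horner_le => //; first by rewrite mulr_ge0// ltW.
  case=> [|k]; first by rewrite /l normc0 mul0r; pos.
  rewrite /l normcM normcV normc_nat exprS.
  rewrite (_ : nc (lam k) / k.+1%:R * (rr * rr ^+ k) =
    rr * (nc (lam k) * rr ^+ k) / k.+1%:R); last by ring.
  rewrite ler_pdivrMr// -mulrA ler_pM2l//.
  apply: le_trans (lamA k) _.
  by rewrite ler_peMr// ler1n.
have eN_le (t : R) : 0 <= t <= 1 -> nc e.[t%:C%C * w] <= eta.
  move=> t01.
  have sz : (size e <= N.*2.+1)%N.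
    have sy : (size yN^`() <= N)%N.
      by apply/leq_sizeP => j Nj; rewrite coef_deriv yNc ltnS ltnNge Nj mul0rn.
    have sl : (size lN^`() <= N)%N.
      by apply/leq_sizeP => j Nj; rewrite lNd ltnNge Nj.
    rewrite /e; apply: leq_trans (size_polyD _ _) _; rewrite size_polyN geq_max.
    apply/andP; split; first by rewrite (leq_trans sy)// ltnW// ltnS -addnn leq_addr.
    apply: leq_trans (size_polyMleq _ _) _; apply: leq_trans (leq_pred _) _.
    by apply: leq_trans (leq_add sl (size_poly _ _)) _; rewrite addnS addnn.
  rewrite (horner_coef_wide _ sz); apply: le_trans (normc_sum _ _ _) _.
  rewrite /eta (_ : N.*2.+1%:R ^+ 2 * (A' * A) * x ^+ N =
     \sum_(i < N.*2.+1) N.*2.+1%:R * (A' * A) * x ^+ N); last first.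
    by rewrite sumr_const card_ord -mulr_natl; ring.
  apply: ler_sum => i _; apply: le_trans (e_le i).
  rewrite normcM normcX ler_wpM2l ?normc_nneg//.
  by rewrite lerXn2r ?nnegrE ?normc_nneg ?(ltW r0)// ncxw.
pose fr t := Re yN.[t%:C%C * w]; pose fi t := Im yN.[t%:C%C * w].
pose lr t := Re lN.[t%:C%C * w].
(* This is |yN exp(-lN)|^2 along the segment from 0 to [w]: it would be constant if [e] were 0, and
   in general its derivative is controlled by [e]. *)
pose g : R -> R := (fr * fr + fi * fi) * (expR \o (cst (- 2) * lr)).
pose dg t := 2 * expR (- 2 * lr t) * (fr t * Re (w * e.[t%:C%C * w]) + fi t * Im (w * e.[t%:C%C * w])).
have gP (t : R) : is_derive t 1 g (dg t).
  have [dr di] := is_derive_ReIm_horner yN w t.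
  have [dl _] := is_derive_ReIm_horner lN w t.
  have dlr : is_derive t 1 (cst (- 2) * lr) (- 2 * Re (w * lN^`().[t%:C%C * w])).
    by apply: is_derive_eq; rewrite /GRing.scale /= mulr0 addr0.
  have de := is_derive1_comp (is_derive_expR _) dlr.
  have du : is_derive t 1 (fr * fr + fi * fi)
     (2 * (fr t * Re (w * yN^`().[t%:C%C * w]) + fi t * Im (w * yN^`().[t%:C%C * w]))).
    by apply: is_derive_eq; rewrite /GRing.scale /=; ring.
  apply: is_derive_eq; rewrite /dg /e hornerD hornerN hornerM /fr /fi /lr /GRing.scale !fctE /=.
  set E := expR _.
  move: E (yN.[_]) (yN^`().[_]) (lN^`().[_]) => E B1 B2 B3; clear.
  case: B1 B2 B3 w => [a1 a2] [b1 b2] [c1 c2] [d1 d2] /=; ring.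
have dgK (t : R) : 0 <= t <= 1 -> `|dg t| <= expR (2 * SL) * (4 * S * r) * eta.
  move=> t01; rewrite /dg normrM (ger0_norm (_ : 0 <= 2 * expR (- 2 * lr t))); last by pos.
  have we : nc (w * e.[t%:C%C * w]) <= r * eta.
    by rewrite normcM wr; apply: ler_pM (eN_le t t01) => //; pos.
  have ple (u v : R) : `|u| <= S -> `|v| <= r * eta -> `|u * v| <= S * (r * eta).
    by move=> u1 v1; rewrite normrM; apply: ler_pM.
  apply: (@le_trans _ _ (2 * expR (2 * SL) * (S * (r * eta) + S * (r * eta)))).
    apply: ler_pM; [by pos|by pos| |].
      rewrite ler_pM2l// ler_expR.
      have := Re_le_normc (lN_le t t01); rewrite ler_norml -/(lr t) => /andP[h1 _].
      by move: h1; lra.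
    apply: le_trans (ler_normD _ _) _; apply: lerD; apply: ple.
          exact: Re_le_normc (yN_le t t01).
        exact: Re_le_normc we.
      exact: Im_le_normc (yN_le t t01).
    exact: Im_le_normc we.
  by rewrite le_eqVlt; apply/orP; left; apply/eqP; ring.
have := MVT_bound gP dgK.
have gE (t : R) : g t = nc yN.[t%:C%C * w] ^+ 2 * expR (- 2 * lr t).
  by rewrite /g !fctE /= /fr /fi normc2E -!expr2.
have g0E : g 0 = nc (y 0%N) ^+ 2.
  have w0 : (0 : R)%:C%C * w = 0 by rewrite mul0r.
  by rewrite gE /lr w0 !horner_coef0 !coef_poly /l /= mulr0 expR0 mulr1.
have lr1 : lr 1 = Re lN.[w] by rewrite /lr mul1r.
have := lN_le 1; rewrite mul1r lexx ler01 => /(_ isT) lNw.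
have := yN_le 1; rewrite mul1r lexx ler01 => /(_ isT) yNw.
have lrSL : lr 1 <= SL by rewrite lr1; apply: (le_trans (ler_norm _)); exact: Re_le_normc.
rewrite g0E gE mul1r ler_norml => /andP[h _].
have E0 : 0 < expR (2 * lr 1) by exact: expR_gt0.
have h2 : nc (y 0%N) ^+ 2 * expR (2 * lr 1) <= 2 * S ^+ 2.
  set K1 := expR (2 * SL) * (4 * S * r) * eta in etaK h.
  have K10 : 0 <= K1 by rewrite /K1 /eta; pos.
  apply: (@le_trans _ _ ((nc yN.[w] ^+ 2 * expR (- 2 * lr 1) + K1) * expR (2 * lr 1))).
    by rewrite ler_pM2r//; move: h; lra.
  rewrite mulrDl -mulrA -expRD mulNr addNr expR0 mulr1.
  rewrite (_ : 2 * S ^+ 2 = S ^+ 2 + S ^+ 2); last by ring.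
  apply: lerD; first by rewrite lerXn2r// nnegrE; pos.
  apply: le_trans etaK; apply: ler_wpM2l => //.
  by rewrite ler_expR ler_pM2l.
rewrite /H -lr1 ler_pdivlMr// mulrC -[leLHS]expRK.
rewrite ler_ln ?posrE//; last by pos.
by rewrite ler_pdivlMr ?exprn_gt0// [leLHS]mulrC.
Qed.

End BorelCaratheodory.

(** * Families of power series bounded polynomially in t *)

Section Families.
Variable R : realType.
Local Notation nc := (@normc R).
Implicit Types (a b y lam : R -> fps R) (r rr t : R).

(** Stands for analyticity in a disc of radius [rr] about every point of the line, with polynomial
    growth in [t]. Quantifying over all [r < rr] makes the class stable under products and
    derivatives: the factor n + 1 which they cost is absorbed by a slightly larger radius. *)
Definition polybounded rr a := forall r, 0 < r < rr ->
  exists C k, 0 < C /\ forall t n, nc (a t n) * r ^+ n <= C * (1 + `|t|) ^+ k.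

Lemma ge1_1Dnorm t : 1 <= 1 + `|t|.
Proof. by rewrite lerDl. Qed.

Lemma gt0_1Dnorm t : 0 < 1 + `|t|.
Proof. by apply: lt_le_trans (ge1_1Dnorm t). Qed.

Lemma lt_mid (x y : R) : x < y -> exists2 z, x < z & z < y.
Proof. by move=> xy; exists ((x + y) / 2); lra. Qed.

Lemma polyboundedD rr a b : polybounded rr a -> polybounded rr b ->
  polybounded rr (fun t => a t + b t).
Proof.
move=> aP bP r rP; have [C [k [C0 aC]]] := aP r rP; have [D [l [D0 bD]]] := bP r rP.
have /andP[r0 _] := rP.
exists (C + D), (k + l)%N; split => [|t n]; first by pos.
have t0 := gt0_1Dnorm t; have t1 := ge1_1Dnorm t.
apply: (@le_trans _ _ (nc (a t n) * r ^+ n + nc (b t n) * r ^+ n)).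
  by rewrite -mulrDl; apply: ler_wpM2r (normcD _ _); pos.
rewrite mulrDl; apply: lerD.
  apply: le_trans (aC t n) _; rewrite ler_pM2l//.
  by rewrite ler_weXn2l// leq_addr.
apply: le_trans (bD t n) _; rewrite ler_pM2l//.
by rewrite ler_weXn2l// leq_addl.
Qed.

Lemma polyboundedN rr a : polybounded rr a -> polybounded rr (fun t => - a t).
Proof.
move=> aP r rP; have [C [k [C0 aC]]] := aP r rP.
by exists C, k; split => // t n; rewrite fpsNE normcN.
Qed.

Lemma polyboundedM rr a b : polybounded rr a -> polybounded rr b ->
  polybounded rr (fun t => a t * b t).
Proof.
move=> aP bP r /andP[r0 rrr]; have [r1 rr1 r1rr] := lt_mid rrr.
have r10 := lt_trans r0 rr1.
have r1P : 0 < r1 < rr by rewrite r10.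
have [C [k [C0 aC]]] := aP r1 r1P; have [D [l [D0 bD]]] := bP r1 r1P.
have x1 : 1 < r1 / r by rewrite ltr_pdivlMr// mul1r.
have [E E0 HE] := poly_le_expn 1 x1.
exists (C * D * E), (k + l)%N; split => [|t n]; first by pos.
have t0 := gt0_1Dnorm t.
have -> : nc ((a t * b t) n) * r ^+ n =
    nc ((a t * b t) n) * r1 ^+ n / (r1 / r) ^+ n.
  by rewrite expr_div_n; field; apply/andP; split; pos.
have xn0 : 0 < (r1 / r) ^+ n by pos.
rewrite ler_pdivrMr//.
apply: (@le_trans _ _ ((C * (1 + `|t|) ^+ k) * (D * (1 + `|t|) ^+ l) * n.+1%:R)).
  rewrite fpsME; apply: (@le_trans _ _
     (\sum_(i < n.+1) (nc (a t i) * r1 ^+ i) * (nc (b t (n - i)%N) * r1 ^+ (n - i)))).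
    apply: (@le_trans _ _ (\sum_(i < n.+1) nc (a t i * b t (n - i)%N) * r1 ^+ n)).
      by rewrite -mulr_suml; apply: ler_wpM2r (normc_sum _ _ _); pos.
    apply: ler_sum => i _; rewrite mulrACA -exprD subnKC; last by rewrite -ltnS.
    by rewrite normcM.
  rewrite -[n.+1 in leRHS]card_ord mulr_natr -sumr_const.
  by apply: ler_sum => i _; apply: ler_pM; [pos|pos|exact: aC|exact: bD].
have := HE n; rewrite expr1 addrC natr1 => HEn.
rewrite (_ : C * D * E * (1 + `|t|) ^+ (k + l) * (r1 / r) ^+ n =
   C * (1 + `|t|) ^+ k * (D * (1 + `|t|) ^+ l) * (E * (r1 / r) ^+ n)); last first.
  by rewrite exprD; ring.
by apply: ler_wpM2l HEn; pos.
Qed.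

Lemma polybounded_D rr a : polybounded rr a -> polybounded rr (fun t => fpsD (a t)).
Proof.
move=> aP r /andP[r0 rrr]; have [r1 rr1 r1rr] := lt_mid rrr.
have r10 := lt_trans r0 rr1.
have r1P : 0 < r1 < rr by rewrite r10.
have [C [k [C0 aC]]] := aP r1 r1P.
have x1 : 1 < r1 / r by rewrite ltr_pdivlMr// mul1r.
have [E E0 HE] := poly_le_expn 1 x1.
exists (C * E / r1), k; split => [|t n]; first by pos.
have t0 := gt0_1Dnorm t.
have xn0 : 0 < (r1 / r) ^+ n by pos.
have := HE n; rewrite expr1 addrC natr1 => HEn.
rewrite /fpsD -[_ *+ _]mulr_natl normcM normc_nat.
have -> : n.+1%:R * nc (a t n.+1) * r ^+ n =
   (nc (a t n.+1) * r1 ^+ n.+1) * (n.+1%:R / (r1 / r) ^+ n) / r1.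
  rewrite expr_div_n exprS; field.
  by apply/andP; split; [pos|apply/andP; split; pos].
rewrite (_ : C * E / r1 * (1 + `|t|) ^+ k = C * (1 + `|t|) ^+ k * E / r1); last by ring.
rewrite ler_pM2r ?invr_gt0//.
apply: ler_pM; [by pos|by pos|exact: aC|].
by rewrite ler_pdivrMr.
Qed.

Lemma polybounded_const rr z : 0 < rr -> polybounded rr (fun=> fpsC z).
Proof.
move=> rr0 r /andP[r0 _]; exists (nc z + 1), 0%N; split => [|t n]; first by pos.
case: n => [|n] /=; first by rewrite !expr0 !mulr1 lerDl.
by rewrite expr0n /= addr0 sqrtr0 mul0r; pos.
Qed.

Definition cline t : R[i] := (2 +i* t)%C.

Lemma normc_cline_le t : nc (cline t) <= 2 * (1 + `|t|).
Proof.
apply: le_trans (normc_le_ReIm _) _ => /=.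
by rewrite ger0_norm// mulrDr mulr1 lerD2l ler_peMl// ler1n.
Qed.

Lemma polybounded_S rr : polybounded rr (fun t => fpsS (cline t)).
Proof.
move=> r /andP[r0 _]; exists (2 + r), 1%N; split => [|t n]; first by pos.
have t0 := gt0_1Dnorm t; have t1 := ge1_1Dnorm t.
rewrite expr1; case: n => [|[|n]].
- rewrite expr0 mulr1; apply: le_trans (normc_cline_le t) _.
  by rewrite ler_pM2r// lerDl ltW.
- rewrite expr1 /fpsS normcN normc1 mul1r.
  by apply: (@le_trans _ _ (r * (1 + `|t|))); [rewrite ler_peMr// ltW|rewrite ler_pM2r// lerDr].
- by rewrite /fpsS normc0 mul0r; pos.
Qed.

Definition logt t := 1 + ln (1 + `|t|).

Lemma logt_ge1 t : 1 <= logt t.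
Proof. by rewrite lerDl ln_ge0// ge1_1Dnorm. Qed.

Lemma logt_gt0 t : 0 < logt t.
Proof. exact: lt_le_trans (logt_ge1 t). Qed.

Lemma ln_polyt (C : R) k t : 0 < C ->
  ln (C * (1 + `|t|) ^+ k) <= (`|ln C| + k%:R) * logt t.
Proof.
move=> C0; have t0 := gt0_1Dnorm t; have l1 := logt_ge1 t.
rewrite lnM ?posrE ?exprn_gt0// lnXn// mulrDl; apply: lerD.
  by apply: le_trans (ler_norm _) _; rewrite ler_peMr.
by rewrite -[_ *+ k]mulr_natl; apply: ler_wpM2l => //; rewrite lerDr.
Qed.

(** [borel_caratheodory] for each [t] yields the logarithm of a quantity polynomial in [t]. Its
    hypotheses are taken at radius [r2], its conclusion at [r1], and the passage from [r1] to [r]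
    absorbs the factor n + 1. *)
Lemma polybounded_log rr y lam : polybounded rr y -> polybounded rr lam ->
  (forall t, fpsD (y t) = lam t * y t) ->
  (exists c k, 0 < c /\ forall t, c <= nc (y t 0%N) * (1 + `|t|) ^+ k) ->
  forall r, 0 < r < rr ->
    exists2 C, 0 < C & forall t n, nc (lam t n) * r ^+ n <= C * logt t.
Proof.
move=> yP lamP ode [c [m [c0 yc]]] r /andP[r0 rrr].
have [r1 rr1 r1rr] := lt_mid rrr; have r10 := lt_trans r0 rr1.
have [r2 r12 r2rr] := lt_mid r1rr; have r20 := lt_trans r10 r12.
have r2P : 0 < r2 < rr by rewrite r20.
have [A [k [A0 yA]]] := yP r2 r2P; have [A' [k' [A'0 lamA]]] := lamP r2 r2P.
have x1 : 1 < r1 / r by rewrite ltr_pdivlMr// mul1r.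
have [E E0 HE] := poly_le_expn 1 x1.
have d0 : 0 < 1 - r1 / r2 by rewrite subr_gt0 ltr_pdivrMr// mul1r.
pose C1 := 2 * (A / (1 - r1 / r2)) ^+ 2 / c ^+ 2.
pose K := (k * 2 + m * 2)%N.
have C10 : 0 < C1 by rewrite /C1; pos.
exists (E / r1 * (`|ln C1| + K%:R + 1)) => [|t n].
  by apply: mulr_gt0; [pos|apply: ltr_wpDl => //; pos].
have t0 := gt0_1Dnorm t.
have y00 : 0 < nc (y t 0%N).
  by have := lt_le_trans c0 (yc t); rewrite pmulr_lgt0// exprn_gt0.
have yn0 : y t 0%N != 0 by rewrite -normc_gt0.
have r12P : 0 < r1 < r2 by rewrite r10.
have := @borel_caratheodory R (lam t) (y t) (A * (1 + `|t|) ^+ k)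
  (A' * (1 + `|t|) ^+ k') r2 r1 r12P (ode t) (yA t) (lamA t) yn0 n.
set Lh := ln _ => bc.
have LhC : Lh <= (`|ln C1| + K%:R + 1) * logt t.
  apply: (@le_trans _ _ ((`|ln C1| + K%:R) * logt t)); last first.
    by rewrite ler_pM2r ?logt_gt0// lerDl.
  apply: le_trans (ln_polyt K t C10); rewrite /Lh ler_ln ?posrE; [|by pos|by pos].
  rewrite ler_pdivrMr ?exprn_gt0//.
  have : c ^+ 2 <= (nc (y t 0%N) * (1 + `|t|) ^+ m) ^+ 2.
    by rewrite lerXn2r ?nnegrE; pos.
  rewrite -(ler_pM2l (_ : 0 < 2 * (A / (1 - r1 / r2)) ^+ 2 / c ^+ 2 * ((1 + `|t|) ^+ k) ^+ 2)); last by pos.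
  rewrite [X in X <= _](_ : _ = 2 * (A * (1 + `|t|) ^+ k / (1 - r1 / r2)) ^+ 2); last first.
    transitivity (2 * (A / (1 - r1 / r2)) ^+ 2 * ((1 + `|t|) ^+ k) ^+ 2 * (c ^+ 2 / c ^+ 2)).
      by ring.
    by rewrite divff ?expf_neq0 ?gt_eqF//; ring.
  move=> h; apply: le_trans h _; rewrite le_eqVlt; apply/orP; left; apply/eqP.
  by rewrite /C1 /K exprD !exprM; ring.
have xn0 : 0 < (r1 / r) ^+ n by pos.
have := HE n; rewrite expr1 addrC natr1 => HEn.
have -> : nc (lam t n) * r ^+ n = nc (lam t n) * r1 ^+ n.+1 / (r1 / r) ^+ n / r1.
  by rewrite expr_div_n exprS; field; apply/andP; split; [pos|apply/andP; split; pos].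
rewrite ler_pdivrMr// ler_pdivrMr//; apply: le_trans bc _.
rewrite (_ : E / r1 * (`|ln C1| + K%:R + 1) * logt t * r1 * (r1 / r) ^+ n =
  (E * (r1 / r) ^+ n) * ((`|ln C1| + K%:R + 1) * logt t)); last first.
  by rewrite expr_div_n; field; apply/andP; split; pos.
apply: (@le_trans _ _ (n.+1%:R * ((`|ln C1| + K%:R + 1) * logt t))).
  exact: ler_wpM2l.
by apply: ler_wpM2r HEn; have l0 := logt_gt0 t; pos.
Qed.

(** The step to a Lindelof bound: [three_circles] plays the uniform bound [C0] against the
    logarithmic one and makes [lam] at most a small multiple of [logt t] plus a constant;
    [exp_majorant] exponentiates this into a small power of [1 + |t|]. *)
Lemma ode_growth rr y lam (C0 : R) : 0 <= C0 ->
  (forall t, fpsD (y t) = lam t * y t) ->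
  (forall t n, nc (lam t n) <= C0) ->
  (forall r, 0 < r < rr ->
    exists2 C, 0 < C & forall t n, nc (lam t n) * r ^+ n <= C * logt t) ->
  forall r eps, 0 < r < rr -> 0 < eps -> exists2 C, 0 < C &
    forall t n, nc (y t n) * r ^+ n <= C * nc (y t 0%N) * (1 + `|t|) `^ eps.
Proof.
move=> C00 ode lamC lamL r eps /andP[r0 rrr] eps0.
have [rho rrho rhorr] := lt_mid rrr; have rho0 := lt_trans r0 rrho.
have [r2 r12 r2rr] := lt_mid rhorr; have r20 := lt_trans rho0 r12.
have r2P : 0 < r2 < rr by rewrite r20.
have [C1 C10 lamC1] := lamL r2 r2P.
pose q := r / rho.
have q0 : 0 < q by rewrite divr_gt0.
have q1 : q < 1 by rewrite ltr_pdivrMr// mul1r.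
(* [exp_majorant] costs the factor [x ^+ B = expR (kap * B)], so the multiple of [logt] to aim at is
   [eps / kap]. The bound is rounded up to a natural number [B], whence the extra 1 in the
   constant. *)
pose x := (1 - q)^-1; pose kap := ln x.
have x1 : 1 < x by rewrite invf_gt1 ?subr_gt0// gtrBl.
have x0 : 0 < x by exact: lt_trans x1.
have kap0 : 0 < kap by apply: ln_gt0.
have e0 : 0 < eps / kap by rewrite divr_gt0.
have rhoP : 0 < rho < r2 by rewrite rho0.
have [C2 C20 H3] := @three_circles R C0 C1 rho r2 (eps / kap) rhoP C00 (ltW C10) e0.
exists (expR (eps + kap * (C2 + 1))) => [|t n]; first exact: expR_gt0.
have l1 := logt_ge1 t; have t0 := gt0_1Dnorm t.
pose V := eps / kap * logt t + C2.
have V0 : 0 <= V by apply: addr_ge0 => //; apply: mulr_ge0; [pos|exact: le_trans l1].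
pose B := (Num.truncn V).+1.
have VB : V <= B%:R by rewrite /B ltW// truncnS_gt.
have BV : B%:R <= V + 1 by rewrite /B -natr1 lerD2r// truncn_le.
have qP : 0 < q < 1 by rewrite q0.
have := @exp_majorant R (lam t) (y t) rho q B rho0 qP (ode t).
have -> : q * rho = r by rewrite /q divfK// gt_eqF.
move=> /(_ _ n) h; apply: le_trans (h _) _ => [k|].
  apply: le_trans VB; apply: (H3 (fun k => nc (lam t k))) => [|j|j].
  - exact: le_trans l1.
  - by rewrite lamC andbT; pos.
  - exact: lamC1.
rewrite -mulrA mulrCA ler_wpM2l//; first by pos.
rewrite -/x -[x]lnK ?posrE// -/kap -expRM_natl /powR gt_eqF// -expRD ler_expR.
apply: (@le_trans _ _ ((V + 1) * kap)); first by rewrite ler_pM2r.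
by rewrite /V /logt le_eqVlt; apply/orP; left; apply/eqP; field; rewrite gt_eqF.
Qed.

Lemma logt_le_powR eps : 0 < eps -> exists2 C, 0 < C & forall t, logt t <= C * (1 + `|t|) `^ eps.
Proof.
move=> e0; exists (1 + eps^-1) => [|t]; first by pos.
have t0 := gt0_1Dnorm t; have t1 := ge1_1Dnorm t.
have l0 : 0 <= ln (1 + `|t|) by exact: ln_ge0.
have := expR_ge1Dx (eps * ln (1 + `|t|)).
rewrite /powR gt_eqF// /logt => h.
have E1 : 1 <= expR (eps * ln (1 + `|t|)).
  by apply: le_trans h; rewrite lerDl; pos.
rewrite mulrDl mul1r; apply: lerD => //.
by rewrite mulrC ler_pdivlMr// mulrC; apply: le_trans h; rewrite lerDr.
Qed.

End Families.

(** * Integrals against Gamma weights *)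

Section GammaWeights.
Variable R : realType.
Local Notation mu := (@lebesgue_measure R).
Local Notation nc := (@normc R).
Implicit Types (f g h : R -> R) (D : set R) (a b t v x X : R) (n : nat).

Definition halfline : set R := `[0, +oo[%classic.

Lemma measurable_halfline : measurable halfline.
Proof. exact: measurable_itv. Qed.

Lemma integrable_dominated D f g : measurable D -> measurable_fun setT f ->
  mu.-integrable D (EFin \o g) -> (forall x, D x -> `|f x| <= g x) ->
  mu.-integrable D (EFin \o f).
Proof.
move=> mD mf ig fg; apply: le_integrable ig => //.
  by apply/measurable_EFinP; apply: measurable_funS mf.
by move=> x Dx /=; rewrite lee_fin (le_trans (fg x Dx))// ler_norm.
Qed.

Lemma Rintegral_le_dominated D f g : measurable D -> measurable_fun setT f ->
  mu.-integrable D (EFin \o g) -> (forall x, D x -> `|f x| <= g x) ->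
  `|\int[mu]_(x in D) f x| <= \int[mu]_(x in D) g x.
Proof.
move=> mD mf ig fg; have fi := integrable_dominated mD mf ig fg.
apply: (@le_trans _ _ (\int[mu]_(x in D) `|f x|)); first exact: le_normr_Rintegral.
apply: le_Rintegral => //.
apply: (@integrable_dominated D (fun x => `|f x|) g) => //.
  exact: measurableT_comp.
by move=> x Dx; rewrite normr_id fg.
Qed.

(** The coefficient of w^n in exp(-(a - w) v); up to normalization a Gamma density. *)
Definition gammaw a n v : R := v ^+ n / n`!%:R * expR (- (a * v)).

Lemma gammaw_ge0 a n v : 0 <= v -> 0 <= gammaw a n v.
Proof. by move=> v0; rewrite /gammaw; pos. Qed.

Definition gammaw_pred a n v := if n is m.+1 then gammaw a m v else 0.

Lemma is_derive_gammaw a n v :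
  is_derive v 1 (gammaw a n) (gammaw_pred a n v - a * gammaw a n v).
Proof.
have dE : is_derive v 1 (fun v => expR (- (a * v))) (- a * expR (- (a * v))).
  have d1 : is_derive v 1 (fun v : R => - (a * v)) (- a).
    have -> : (fun v : R => - (a * v)) = (cst (- a) * id).
      by apply/funext => x; rewrite !fctE mulNr.
    by apply: is_derive_eq; rewrite /GRing.scale /= mulr0 addr0 mulr1.
  have := is_derive1_comp (is_derive_expR _) d1.
  by rewrite mulrC.
have dX : is_derive v 1 (fun v => v ^+ n / n`!%:R)
    (if n is m.+1 then v ^+ m / m`!%:R else 0).
  have -> : (fun v : R => v ^+ n / n`!%:R) = (id ^+ n) * cst (n`!%:R^-1).
    by apply/funext => x; rewrite !fctE.
  apply: is_derive_eq; rewrite /GRing.scale /= !fctE mulr0 add0r mulr1.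
  case: n => [|m] /=; first by rewrite mul0r mulr0.
  rewrite factS natrM; field.
  by rewrite nat1r !pnatr_eq0 -!lt0n fact_gt0.
have -> : gammaw a n = (fun v => v ^+ n / n`!%:R) * (fun v => expR (- (a * v))).
  by apply/funext => x; rewrite !fctE.
apply: is_derive_eq; rewrite /GRing.scale /= /gammaw_pred /gammaw !fctE.
by case: n {dX} => [|m] /=; ring.
Qed.

Lemma continuous_derivable f (df : R -> R) :
  (forall v : R, is_derive v 1 f (df v)) -> continuous f.
Proof.
move=> dP v; apply: differentiable_continuous; apply/derivable1_diffP.
by have [] := dP v.
Qed.

Lemma continuous_gammaw a n : continuous (gammaw a n).
Proof. exact: continuous_derivable (is_derive_gammaw a n). Qed.

Lemma measurable_gammaw a n : measurable_fun setT (gammaw a n).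
Proof. exact: continuous_measurable_fun (@continuous_gammaw a n). Qed.

(** The primitive of [gammaw a n] that vanishes at infinity, obtained by repeated integration by
    parts; its value at 0 yields the total mass. *)
Fixpoint gammaW a n v : R :=
  if n is m.+1 then (gammaW a m v - gammaw a m.+1 v) / a
  else - gammaw a 0 v / a.

Lemma is_derive_gammaW a n v : 0 < a -> is_derive v 1 (gammaW a n) (gammaw a n v).
Proof.
move=> a0; elim: n => [|n IH].
  have -> : gammaW a 0 = - gammaw a 0 * cst a^-1.
    by apply/funext => x; rewrite !fctE.
  have dw := is_derive_gammaw a 0 v.
  apply: is_derive_eq; rewrite /GRing.scale /= mulr0 add0r.
  by field; rewrite gt_eqF.
have -> : gammaW a n.+1 = (gammaW a n - gammaw a n.+1) * cst a^-1.
  by apply/funext => x; rewrite !fctE.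
have dw := is_derive_gammaw a n.+1 v.
apply: is_derive_eq; rewrite /GRing.scale /= mulr0 add0r.
by field; rewrite gt_eqF.
Qed.

Lemma gammaW0 a n : 0 < a -> gammaW a n 0 = - a^-1 ^+ n.+1.
Proof.
move=> a0; elim: n => [|n IH] /=.
  by rewrite /gammaw expr0 fact0 mulr0 oppr0 expR0 divr1 mulr1 expr1 mulNr mul1r.
by rewrite IH /gammaw expr0n /= !mul0r subr0 [in RHS]exprSr mulNr.
Qed.

(** Half of the exponential decay absorbs the power of [v]. *)
Lemma gammaw_half a n : 0 < a -> exists2 C, 0 < C & forall v, 0 <= v ->
  gammaw a n v <= C * expR (- (a / 2 * v)).
Proof.
move=> a0; have a2 : 0 < a / 2 by pos.
have [C C0 HC] := poly_le_expR n a2.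
exists C => // v v0; rewrite /gammaw [in - (a * v)](splitr a) mulrDl opprD expRD mulrA.
rewrite ler_pM2r ?expR_gt0// expRN ler_pdivrMr ?expR_gt0//.
apply: le_trans (HC v v0); apply: (@le_trans _ _ (v ^+ n)).
  by rewrite ler_pdivrMr ?ltr0n ?fact_gt0// ler_peMr ?exprn_ge0// ler1n fact_gt0.
by apply: lerXn2r; rewrite ?nnegrE ?lerDr//; pos.
Qed.

Lemma cvg_expRN a : 0 < a -> expR (- (a * v)) @[v --> +oo] --> (0 : R).
Proof.
move=> a0; apply: (cvg_comp (fun v => a * v) (fun x => expR (- x)) _ (@cvgr_expR R)).
apply/cvgryPge => A; exists (A / a); split; first exact: num_real.
by move=> v /ltW; rewrite ler_pdivrMr// mulrC.
Qed.

Lemma cvg_gammaw a n : 0 < a -> gammaw a n v @[v --> +oo] --> (0 : R).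
Proof.
move=> a0; have [C C0 HC] := gammaw_half n a0.
have a2 : 0 < a / 2 by pos.
apply: (@squeeze_cvgr _ _ _ _ (cst 0) (fun v => C * expR (- (a / 2 * v)))).
- near=> v; have v0 : 0 <= v by near: v; apply: nbhs_pinfty_ge; rewrite num_real.
  by rewrite gammaw_ge0//= HC.
- exact: cvg_cst.
- by rewrite -[X in _ --> X](mulr0 C); apply: cvgMr; exact: cvg_expRN.
Unshelve. all: by end_near. Qed.

Lemma cvg_gammaW a n : 0 < a -> gammaW a n v @[v --> +oo] --> (0 : R).
Proof.
move=> a0; elim: n => [|n IH].
  rewrite -[X in _ --> X](mul0r a^-1) -[X in X * _]oppr0.
  by apply: cvgMl; apply: cvgN; exact: cvg_gammaw.
rewrite -[X in _ --> X](mul0r a^-1) -[X in X * _](subr0 0).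
by apply: cvgMl; apply: cvgB => //; exact: cvg_gammaw.
Qed.

Lemma integral_gammaw a n : 0 < a ->
  (\int[mu]_(v in halfline) (gammaw a n v)%:E = (a^-1 ^+ n.+1)%:E)%E.
Proof.
move=> a0.
have dW v := is_derive_gammaW n v a0.
rewrite (@ge0_continuous_FTC2y R (gammaw a n) (gammaW a n) 0 0).
- by rewrite sub0e gammaW0// EFinN oppeK.
- by move=> v v0; exact: gammaw_ge0.
- exact: continuous_subspaceT (@continuous_gammaw a n).
- exact: cvg_gammaW.
- by move=> v _; have [] := dW v.
- by apply: cvg_at_right_filter; exact: (continuous_derivable dW).
- by move=> v _; rewrite derive1E; apply: derive_val.
Qed.

Lemma integrable_gammaw a n : 0 < a -> mu.-integrable halfline (EFin \o gammaw a n).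
Proof.
move=> a0; apply/integrableP; split.
  by apply/measurable_EFinP; apply: measurable_funS (measurable_gammaw a n).
rewrite (_ : (\int[mu]_(x in halfline) `|(EFin \o gammaw a n) x|)%E =
  (\int[mu]_(v in halfline) (gammaw a n v)%:E)%E); first by rewrite integral_gammaw ?ltry.
apply: eq_integral => v /=; rewrite inE /halfline /= in_itv /= andbT => v0.
by rewrite ger0_norm// gammaw_ge0.
Qed.

Lemma Rintegral_gammaw a n : 0 < a -> \int[mu]_(v in halfline) gammaw a n v = a^-1 ^+ n.+1.
Proof. by move=> a0; rewrite /Rintegral integral_gammaw. Qed.

(* The functions to be transformed; the constant and the exponent are those of
   the pointwise bound on the half line. *)
Definition expdom C b f :=
  measurable_fun setT f /\ forall v, 0 <= v -> `|f v| <= C * expR (b * v).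

Lemma expdom_ge0 C b f : expdom C b f -> 0 <= C.
Proof. by move=> [_ /(_ 0 (lexx _))]; rewrite mulr0 expR0 mulr1; exact: le_trans. Qed.

Lemma expdom_gammaw C b f h n v : expdom C b f -> `|h v| <= 1 -> 0 <= v ->
  `|f v * gammaw 2 n v * h v| <= C * gammaw (2 - b) n v.
Proof.
move=> [mf fC] h1 v0; rewrite normrM [X in X * _]normrM (ger0_norm (gammaw_ge0 2 n v0)).
have w0 := gammaw_ge0 2 n v0.
apply: (@le_trans _ _ (`|f v| * gammaw 2 n v)); first by rewrite ler_piMr//; pos.
apply: (@le_trans _ _ (C * expR (b * v) * gammaw 2 n v)); first by rewrite ler_wpM2r ?fC.
have E : expR (- ((2 - b) * v)) = expR (b * v) * expR (- (2 * v)).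
  by rewrite -expRD; congr expR; ring.
by rewrite /gammaw E le_eqVlt; apply/orP; left; apply/eqP; ring.
Qed.

Lemma measurable_gammaw_mul C b f h n : expdom C b f -> measurable_fun setT h ->
  measurable_fun setT (fun v => f v * gammaw 2 n v * h v).
Proof.
move=> [mf _] mh; apply: measurable_funM => //; apply: measurable_funM => //.
exact: measurable_gammaw.
Qed.

Lemma integrable_gammaw_cst C a n : 0 < a ->
  mu.-integrable halfline (EFin \o (fun v => C * gammaw a n v)).
Proof.
move=> a0; rewrite (_ : EFin \o _ = (fun v => C%:E * (EFin \o gammaw a n) v)%E).
  by apply: integrableZl; [exact: measurable_halfline|exact: integrable_gammaw].
by apply/funext => v /=; rewrite EFinM.
Qed.

Lemma integrable_expdom C b f h n : expdom C b f -> b < 2 ->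
  measurable_fun setT h -> (forall v, `|h v| <= 1) ->
  mu.-integrable halfline (EFin \o (fun v => f v * gammaw 2 n v * h v)).
Proof.
move=> fC b2 mh h1.
apply: (integrable_dominated measurable_halfline (measurable_gammaw_mul n fC mh)
  (integrable_gammaw_cst C n (_ : 0 < 2 - b))); first by rewrite subr_gt0.
move=> v; rewrite /halfline /= in_itv /= andbT => v0.
by apply: expdom_gammaw.
Qed.

Lemma Rintegral_expdom_le C b f h n : expdom C b f -> b < 2 ->
  measurable_fun setT h -> (forall v, `|h v| <= 1) ->
  `|\int[mu]_(v in halfline) (f v * gammaw 2 n v * h v)| <= C * (2 - b)^-1 ^+ n.+1.
Proof.
move=> fC b2 mh h1; have b20 : 0 < 2 - b by rewrite subr_gt0.
rewrite -Rintegral_gammaw// -RintegralZl//; [|exact: measurable_halfline|exact: integrable_gammaw].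
apply: (Rintegral_le_dominated measurable_halfline (measurable_gammaw_mul n fC mh)
  (integrable_gammaw_cst C n b20)).
move=> v; rewrite /halfline /= in_itv /= andbT => v0.
by apply: expdom_gammaw.
Qed.

Definition decays (Q : R -> R) := measurable_fun setT Q /\
  exists K c, 0 < c /\ forall v, 0 <= v -> `|Q v| <= K * expR (- (c * v)).

Lemma decaysW (Q : R -> R) K c : measurable_fun setT Q -> 0 < c ->
  (forall v, 0 <= v -> `|Q v| <= K * expR (- (c * v))) -> decays Q.
Proof. by move=> mQ c0 QK; split => //; exists K, c. Qed.

Lemma decaysD f g : decays f -> decays g -> decays (fun v => f v + g v).
Proof.
move=> [mf [K [c [c0 fK]]]] [mg [L [d [d0 gL]]]]; split; first exact: measurable_funD.
exists (K + L), (Num.min c d); split; first by rewrite lt_min c0.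
move=> v v0; apply: le_trans (ler_normD _ _) _; rewrite mulrDl.
have K0 : 0 <= K by have := fK 0 (lexx _); rewrite mulr0 oppr0 expR0 mulr1; apply: le_trans.
have L0 : 0 <= L by have := gL 0 (lexx _); rewrite mulr0 oppr0 expR0 mulr1; apply: le_trans.
apply: lerD.
  apply: le_trans (fK v v0) _; rewrite ler_wpM2l// ler_expR lerN2 ler_wpM2r//.
  by rewrite ge_min lexx.
apply: le_trans (gL v v0) _; rewrite ler_wpM2l// ler_expR lerN2 ler_wpM2r//.
by rewrite ge_min lexx orbT.
Qed.

Lemma decaysZ f b : decays f -> decays (fun v => b * f v).
Proof.
move=> [mf [K [c [c0 fK]]]]; split; first by apply: measurable_funM.
exists (`|b| * K), c; split => // v v0; rewrite normrM -mulrA ler_wpM2l//.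
exact: fK.
Qed.

Lemma decays_kernel C b f h n : expdom C b f -> b < 2 -> measurable_fun setT h ->
  (forall v, `|h v| <= 1) -> decays (fun v => f v * gammaw 2 n v * h v).
Proof.
move=> fC b2 mh h1; have b20 : 0 < 2 - b by rewrite subr_gt0.
have [K K0 HK] := gammaw_half n b20; have C0 := expdom_ge0 fC.
apply: (@decaysW _ (C * K) ((2 - b) / 2)); [exact: measurable_gammaw_mul fC mh|by pos|].
move=> v v0; apply: le_trans (expdom_gammaw n fC (h1 v) v0) _.
by rewrite -mulrA ler_wpM2l// HK.
Qed.

Lemma decays_integrable f : decays f -> mu.-integrable halfline (EFin \o f).
Proof.
move=> [mf [K [c [c0 fK]]]].
apply: (integrable_dominated measurable_halfline mf (integrable_gammaw_cst K 0 c0)).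
move=> v; rewrite /halfline /= in_itv /= andbT => v0.
by rewrite /gammaw expr0 fact0 divr1 mul1r fK.
Qed.

Lemma halfline_split X : 0 <= X -> halfline = `[0, X]%classic `|` `]X, +oo[%classic.
Proof.
move=> X0; apply/seteqP; split => v; rewrite /halfline /= !in_itv /= !andbT.
  by move=> v0; have [vX|Xv] := leP v X; [left; rewrite v0|right].
by move=> [/andP[]//|/ltW]; exact: le_trans.
Qed.

Lemma Rintegral_halfline_split f X : 0 <= X -> mu.-integrable halfline (EFin \o f) ->
  \int[mu]_(v in halfline) f v =
  \int[mu]_(v in `[0, X]) f v + \int[mu]_(v in `]X, +oo[) f v.
Proof.
move=> X0 fi; have E := halfline_split X0; rewrite {1}E in fi; rewrite E.
apply: Rintegral_setU => //; try exact: measurable_itv.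
apply/disj_setPRL => v /=; rewrite !in_itv /= andbT => Xv /andP[_ vX].
by have := lt_le_trans Xv vX; rewrite ltxx.
Qed.

(** Both facts are needed at the same [X]: one for the tail of an integral, the other for the
    boundary term of an integration by parts. *)
Lemma decays_lim f : decays f -> forall e, 0 < e -> exists2 X0, 0 <= X0 & forall X, X0 <= X ->
  `|\int[mu]_(v in `[0, X]) f v - \int[mu]_(v in halfline) f v| <= e /\ `|f X| <= e.
Proof.
move=> df e e0; have fi := decays_integrable df; have [mf [K [c [c0 fK]]]] := df.
have K0 : 0 <= K by have := fK 0 (lexx _); rewrite mulr0 oppr0 expR0 mulr1; apply: le_trans.
have c2 : 0 < c / 2 by pos.
pose L := K * (1 + (c / 2)^-1).
have L0 : 0 <= L by rewrite /L; pos.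
exists (L / e / (c / 2)) => [|X XL]; first by pos.
have X0 : 0 <= X by apply: le_trans XL; pos.
have small : L * expR (- (c / 2 * X)) <= e.
  rewrite expRN ler_pdivrMr ?expR_gt0// mulrC -ler_pdivrMr//.
  apply: le_trans (expR_ge1Dx _); apply: (@le_trans _ _ (c / 2 * X)); last by rewrite lerDr.
  by rewrite [leRHS]mulrC -ler_pdivrMr.
split; last first.
  apply: le_trans (fK X X0) _; apply: le_trans small.
  apply: (@le_trans _ _ (K * expR (- (c / 2 * X)))).
    rewrite ler_wpM2l// ler_expR lerN2 ler_wpM2r//; lra.
  by rewrite ler_pM2r ?expR_gt0// ler_peMr// lerDl; pos.
rewrite (Rintegral_halfline_split X0 fi) opprD addrA subrr sub0r normrN.
pose g v := K * expR (- (c / 2 * X)) * gammaw (c / 2) 0 v.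
have gi : mu.-integrable halfline (EFin \o g) by exact: integrable_gammaw_cst.
have sub : `]X, +oo[%classic `<=` halfline.
  by move=> v; rewrite /halfline /= !in_itv /= !andbT => /ltW; exact: le_trans.
apply: (@le_trans _ _ (\int[mu]_(v in `]X, +oo[) g v)).
  apply: Rintegral_le_dominated => //; first by apply: integrableS gi => //; exact: measurable_halfline.
  move=> v; rewrite /= in_itv /= andbT => Xv.
  apply: le_trans (fK v (ltW (le_lt_trans X0 Xv))) _.
  rewrite /g /gammaw expr0 fact0 divr1 mul1r -mulrA -expRD ler_wpM2l// ler_expR.
  have : c / 2 * X <= c / 2 * v by rewrite ler_wpM2l// ltW.
  lra.
apply: (@le_trans _ _ (\int[mu]_(v in halfline) g v)).
  rewrite (Rintegral_halfline_split X0 gi) lerDr; apply: Rintegral_ge0 => v.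
  by rewrite /= in_itv /= => /andP[v0 _]; rewrite /g mulr_ge0 ?gammaw_ge0//; pos.
rewrite /g RintegralZl//; [|exact: measurable_halfline|exact: integrable_gammaw].
rewrite Rintegral_gammaw// expr1; apply: le_trans small.
rewrite /L mulrAC ler_pM2r ?expR_gt0// ler_wpM2l// lerDr//.
Qed.

Lemma Rintegral_sum (I : Type) (s : seq I) D (F : I -> R -> R) : measurable D ->
  (forall i, mu.-integrable D (EFin \o F i)) ->
  \int[mu]_(v in D) (\sum_(i <- s) F i v) = \sum_(i <- s) \int[mu]_(v in D) F i v.
Proof.
move=> mD Fi; elim: s => [|i s IH].
  by rewrite big_nil; under eq_Rintegral do rewrite big_nil; rewrite Rintegral_cst// mul0r.
rewrite big_cons -IH; under eq_Rintegral do rewrite big_cons.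
rewrite RintegralD//.
rewrite (_ : EFin \o _ = (fun v => \sum_(i <- s) (EFin \o F i) v)%E).
  exact: integrable_sum.
by apply/funext => v /=; rewrite sumEFin.
Qed.

End GammaWeights.

(** * Integration by parts with jumps, against Gamma weights *)

Section Abel.
Variable R : realType.
Local Notation mu := (@lebesgue_measure R).
Local Notation nc := (@normc R).
Implicit Types (F f g h k : R -> R) (a b t v x X lam : R) (n : nat).

(** The derivative of -(F w h), w being [gammaw 2 n], when F' = f and h' = t k. *)
Let q F f h k t n v := F v * (2 * gammaw 2 n v - gammaw_pred 2 n v) * h v
  - t * (F v * gammaw 2 n v * k v) - f v * gammaw 2 n v * h v.

Lemma FTC_kernel F f h k t n lam X : lam <= X ->
  (forall v, is_derive v 1 F (f v)) -> continuous f ->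
  (forall v, is_derive v 1 h (t * k v)) -> continuous k ->
  continuous (q F f h k t n) /\
  \int[mu]_(v in `[lam, X]) q F f h k t n v =
    F lam * gammaw 2 n lam * h lam - F X * gammaw 2 n X * h X.
Proof.
move=> lX dF cf dh ck.
have cF := continuous_derivable dF; have ch := continuous_derivable dh.
have cw m := @continuous_gammaw R 2 m.
have cp : continuous (gammaw_pred 2 n : R -> R).
  by case: n => [|m]; [exact: cst_continuous|exact: cw].
have cq : continuous (q F f h k t n).
  move=> v; rewrite /q; apply: cvgB; [apply: cvgB|].
  - apply: cvgM; [apply: cvgM; [exact: cF|]|exact: ch].
    by apply: cvgB; [apply: cvgMr; exact: cw|exact: cp].
  - by apply: cvgMr; apply: cvgM; [apply: cvgM; [exact: cF|exact: cw]|exact: ck].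
  - by apply: cvgM; [apply: cvgM; [exact: cf|exact: cw]|exact: ch].
split => //.
pose Q := - (F * gammaw 2 n * h).
have dQ v : is_derive v 1 Q (q F f h k t n v).
  have dw := is_derive_gammaw 2 n v; have dFv := dF v; have dhv := dh v.
  by rewrite /Q; apply: is_derive_eq; rewrite /GRing.scale /= /q !fctE; ring.
move: lX; rewrite le_eqVlt => /orP[/eqP ->|lX].
  by rewrite set_itv1 Rintegral_set1 subrr.
rewrite /Rintegral (@continuous_FTC2 R _ Q)//.
- by rewrite -EFinB /= /Q !fctE; ring.
- exact: continuous_subspaceT.
- split; first by move=> v _; have [] := dQ v.
    by apply: cvg_at_right_filter; exact: (continuous_derivable dQ).
  by apply: cvg_at_left_filter; exact: (continuous_derivable dQ).
- by move=> v _; rewrite derive1E; have dQv := dQ v; apply: derive_val.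
Qed.

Variables (I : Type) (lam : I -> R) (F_ f_ : I -> R -> R).

(** A superposition of smooth pieces, the piece [i] being switched on at [lam i] with jump
    [F_ i (lam i)]. Constant pieces give counting functions; pieces vanishing at their start give
    the primitives of these. *)
Definition assembled X (s : seq I) F f :=
  (forall i, List.In i s -> 0 <= lam i <= X) /\
  forall v, 0 <= v <= X ->
  F v = \sum_(i <- s) (lam i <= v)%R%:R * F_ i v /\
  f v = \sum_(i <- s) (lam i <= v)%R%:R * f_ i v.

Hypothesis dF : forall i v, is_derive v 1 (F_ i) (f_ i v).
Hypothesis cf : forall i, continuous (f_ i).

(** Each piece is integrated from [lam i] to [X]: the lower ends produce the sum over the jumps, the
    upper ends the boundary term at [X]. *)
Lemma abel_finite h k t n X s F f : 0 <= X -> assembled X s F f ->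
  (forall v, is_derive v 1 h (t * k v)) -> continuous k ->
  \int[mu]_(v in `[0, X]) q F f h k t n v =
    \sum_(i <- s) F_ i (lam i) * gammaw 2 n (lam i) * h (lam i)
    - F X * gammaw 2 n X * h X.
Proof.
move=> X0 [lamX FE] dh ck.
have [FX _] : F X = \sum_(i <- s) (lam i <= X)%R%:R * F_ i X /\
  f X = \sum_(i <- s) (lam i <= X)%R%:R * f_ i X by apply: FE; rewrite X0 lexx.
pose qi i v := (lam i <= v)%R%:R * q (F_ i) (f_ i) h k t n v.
have cq i : continuous (q (F_ i) (f_ i) h k t n).
  by have [] := FTC_kernel n (lexx X) (dF i) (@cf i) dh ck.
have mq i : measurable_fun setT (qi i).
  apply: measurable_funM; last exact: continuous_measurable_fun.
  apply: nondecreasing_measurable => // x y xy; rewrite ler_nat.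
  by case: (leP (lam i) x) => // lx; rewrite (le_trans lx xy).
have iq i : mu.-integrable `[0, X]%classic (EFin \o qi i).
  apply: (@integrable_dominated R _ _ (fun v => `|q (F_ i) (f_ i) h k t n v|)) => //.
    apply: continuous_compact_integrable; first exact: segment_compact.
    apply: continuous_subspaceT => v; apply: cvg_norm; exact: cq.
  move=> v _; rewrite /qi; by case: (lam i <= v); rewrite ?mul1r ?mul0r ?normr0.
transitivity (\int[mu]_(v in `[0, X]) (\sum_(i <- s) qi i v)).
  apply: eq_Rintegral => v; rewrite inE /= in_itv /= => vX.
  have [E1 E2] := FE v vX; rewrite /q E1 E2 /qi !mulr_suml mulr_sumr -!sumrB.
  by apply: eq_bigr => i _; rewrite /q; ring.
rewrite Rintegral_sum// FX !mulr_suml -sumrB.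
elim: s lamX {FE FX} => [|i s IH] lamX; first by rewrite !big_nil.
have /andP[l0 lX] : 0 <= lam i <= X by apply: lamX; left.
rewrite !big_cons IH; last by move=> j js; apply: lamX; right.
congr (_ + _); rewrite lX mul1r.
have [_ <-] := FTC_kernel n lX (dF i) (@cf i) dh ck.
rewrite [RHS](_ : _ = \int[mu]_(v in `[0, X] `&` `[lam i, X]) q (F_ i) (f_ i) h k t n v); last first.
  congr Rintegral; apply/seteqP; split => v /=; rewrite !in_itv /=.
    by move=> /andP[lv vX]; rewrite lv vX (le_trans l0 lv).
  by move=> [].
rewrite Rintegral_mkcondr; apply: eq_Rintegral => v; rewrite inE /= in_itv /= => /andP[v0 vX].
rewrite /qi patchE; case: ifPn; rewrite ?inE ?notin_setE /= in_itv /= vX andbT.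
  by move=> ->; rewrite mul1r.
by move=> /negP/negbTE ->; rewrite mul0r.
Qed.

Definition kint f n h := \int[mu]_(v in @halfline R) (f v * gammaw 2 n v * h v).
Definition kint_pred f n h := if n is m.+1 then kint f m h else 0.

(** The boundary term at [X] disappears because growth of exponent [b < 2] loses against the weight.
    Used with (h, k) = (cos, -sin) and (-sin, -cos) of t v, the bracket is the real, then the
    imaginary part of the n-th coefficient of s G(F) - G(f). *)
Lemma abel_lim h k t n C C' b F f : expdom C b F -> expdom C' b f -> b < 2 ->
  (forall v, is_derive v 1 h (t * k v)) -> continuous k ->
  (forall v, `|h v| <= 1) -> (forall v, `|k v| <= 1) ->
  forall e, 0 < e -> exists2 X0, 0 <= X0 & forall X s, X0 <= X -> assembled X s F f ->
  `|\sum_(i <- s) F_ i (lam i) * gammaw 2 n (lam i) * h (lam i) -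
    (2 * kint F n h - kint_pred F n h - t * kint F n k - kint f n h)| <= e.
Proof.
move=> FC fC b2 dh ck h1 k1 e e0.
have ch := continuous_derivable dh.
have mh := continuous_measurable_fun ch; have mk := continuous_measurable_fun ck.
have d1 := decays_kernel n FC b2 mh h1.
have d2 := decays_kernel n FC b2 mk k1.
have d3 := decays_kernel n fC b2 mh h1.
have d4 : decays (fun v => F v * gammaw_pred 2 n v * h v) /\
    \int[mu]_(v in @halfline R) (F v * gammaw_pred 2 n v * h v) = kint_pred F n h.
  case: n {d1 d2 d3} => [|m]; last by split => //; exact: decays_kernel FC b2 mh h1.
  have E : (fun v => F v * gammaw_pred 2 0 v * h v) = cst 0.
    by apply/funext => v /=; rewrite mulr0 mul0r.
  rewrite E; split; last by rewrite /= Rintegral_cst ?mul0r//; exact: measurable_halfline.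
  by apply: (@decaysW _ _ 0 1) => // v _; rewrite normr0 mul0r.
have [d4' I4] := d4.
have qE : q F f h k t n = (fun v => 2 * (F v * gammaw 2 n v * h v) +
    ((-1) * (F v * gammaw_pred 2 n v * h v) + ((- t) * (F v * gammaw 2 n v * k v) +
     (-1) * (f v * gammaw 2 n v * h v)))).
  by apply/funext => v; rewrite /q; ring.
have dq : decays (q F f h k t n).
  by rewrite qE; apply: decaysD; [exact: decaysZ|apply: decaysD; [exact: decaysZ|
    apply: decaysD; exact: decaysZ]].
have Iq : \int[mu]_(v in @halfline R) q F f h k t n v =
    2 * kint F n h - kint_pred F n h - t * kint F n k - kint f n h.
  have mH := @measurable_halfline R.
  have Z c g : decays g -> mu.-integrable (@halfline R) (EFin \o (fun v => c * g v)).
    by move=> dg; apply: decays_integrable; exact: decaysZ.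
  rewrite qE RintegralD//; [|exact: Z|]; last first.
    by apply: decays_integrable; apply: decaysD; [|apply: decaysD]; exact: decaysZ.
  rewrite RintegralD//; [|exact: Z|]; last first.
    by apply: decays_integrable; apply: decaysD; exact: decaysZ.
  rewrite RintegralD//; [|exact: Z|exact: Z].
  rewrite !RintegralZl//; try exact: decays_integrable.
  by rewrite I4 /kint; ring.
have e2 : 0 < e / 2 by pos.
have [X1 X10 H1] := decays_lim dq e2; have [X2 X20 H2] := decays_lim d1 e2.
exists (Num.max X1 X2) => [|X s]; first by rewrite le_max X10.
rewrite ge_max => /andP[X1X X2X] sX.
have X0 : 0 <= X by exact: le_trans X1X.
have [h3 _] := H1 X X1X; have [_ h4] := H2 X X2X.
rewrite -Iq.
have := @abel_finite h k t n X s F f X0 sX dh ck.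
move: h3 h4; set A := \int[mu]_(v in `[0, X]) _; set B := \int[mu]_(v in @halfline R) _.
set S := \sum_(i <- s) _; set V := F X * _ * _ => h3 h4 AE.
rewrite (_ : S - B = (A - B) + V); last by rewrite AE; ring.
by apply: le_trans (ler_normD _ _) _; rewrite [e]splitr lerD.
Qed.

End Abel.

(** * Laplace coefficients and Dirichlet series *)

Section LaplaceCoefficients.
Variable R : realType.
Local Notation mu := (@lebesgue_measure R).
Local Notation nc := (@normc R).
Implicit Types (F f g h k : R -> R) (a b t u v x X : R) (n : nat).

(** With the sign chosen in [ksin], [kcos t + i ksin t] is exp(-i t v), and the derivatives have the
    shape t k required for [abel_lim]. *)
Definition kcos t v : R := cos (t * v).
Definition ksin t v : R := - sin (t * v).

Lemma is_derive_kcos t v : is_derive v 1 (kcos t) (t * ksin t v).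
Proof.
have d1 : is_derive v 1 (fun v : R => t * v) t.
  have -> : (fun v : R => t * v) = (cst t * id) by apply/funext => x; rewrite !fctE.
  by apply: is_derive_eq; rewrite /GRing.scale /= mulr0 addr0 mulr1.
by have := is_derive1_comp (is_derive_cos _) d1; rewrite mulrC.
Qed.

Lemma is_derive_ksin t v : is_derive v 1 (ksin t) (t * (- kcos t v)).
Proof.
have d1 : is_derive v 1 (fun v : R => t * v) t.
  have -> : (fun v : R => t * v) = (cst t * id) by apply/funext => x; rewrite !fctE.
  by apply: is_derive_eq; rewrite /GRing.scale /= mulr0 addr0 mulr1.
have d2 := is_derive1_comp (is_derive_sin _) d1.
have -> : ksin t = - (sin \o (fun v : R => t * v)) by apply/funext => x; rewrite !fctE.
by apply: is_derive_eq; rewrite mulrN mulrC.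
Qed.

Lemma kcos_le1 t v : `|kcos t v| <= 1.
Proof. by rewrite ler_norml cos_geN1 cos_le1. Qed.

Lemma ksin_le1 t v : `|ksin t v| <= 1.
Proof. by rewrite normrN ler_norml sin_geN1 sin_le1. Qed.

Lemma continuous_kcos t : continuous (kcos t).
Proof. exact: continuous_derivable (is_derive_kcos t). Qed.

Lemma continuous_ksin t : continuous (ksin t).
Proof. exact: continuous_derivable (is_derive_ksin t). Qed.

Lemma measurable_kcos t : measurable_fun setT (kcos t).
Proof. exact: continuous_measurable_fun (@continuous_kcos t). Qed.

Lemma measurable_ksin t : measurable_fun setT (ksin t).
Proof. exact: continuous_measurable_fun (@continuous_ksin t). Qed.

(* The Taylor coefficients in [w] of the Laplace transform of [f] at
   [cline t - w]. *)
Definition Gcoef t f : fps R :=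
  fun n => (kint f n (kcos t) +i* kint f n (ksin t))%C.

(** The expansion of exp(-s v) at s = [cline t] - w; [fexpD], which is the binomial theorem, turns
    products of integers into products of series. *)
Definition fexp t v : fps R := fun n => (gammaw 2 n v)%:C%C * cis (- (t * v)).

Lemma fexp0 t : fexp t 0 = 1.
Proof.
apply/funext => n; rewrite /fexp mulr0 oppr0 cis0 mulr1 fps1E /gammaw mulr0 oppr0 expR0 mulr1.
by case: n => [|n]; rewrite ?expr0 ?fact0 ?divr1 // expr0n /= mul0r.
Qed.

Lemma fexpD t u v : fexp t (u + v) = fexp t u * fexp t v.
Proof.
apply/funext => n; rewrite fpsME /fexp.
have -> : cis (- (t * (u + v))) = cis (- (t * u)) * cis (- (t * v)) :> R[i].
  by rewrite -cisD; congr cis; ring.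
have -> : gammaw 2 n (u + v) = \sum_(i < n.+1) gammaw 2 i u * gammaw 2 (n - i) v.
  rewrite /gammaw addrC exprDn !mulr_suml; apply: eq_bigr => i _.
  have iln : (i <= n)%N by rewrite -ltnS.
  have -> : expR (- (2 * (v + u))) = expR (- (2 * u)) * expR (- (2 * v)) :> R.
    by rewrite -expRD; congr expR; ring.
  have := bin_fact iln => /(congr1 (fun m => m%:R : R)); rewrite !natrM => <-.
  rewrite -[_ *+ 'C(n, i)]mulr_natl; field.
  by rewrite !pnatr_eq0 -!lt0n !fact_gt0 bin_gt0 iln.
rewrite (rmorph_sum (real_complex R)) mulr_suml; apply: eq_bigr => i _.
by rewrite rmorphM /=; ring.
Qed.

Lemma fpsD_fexp t v : fpsD (fexp t v) = fpsC v%:C%C * fexp t v.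
Proof.
apply/funext => n; rewrite fpsCM /fpsD /fexp mulrA -rmorphM /=.
rewrite -[_ *+ n.+1]mulr_natr mulrAC; congr (_ * _).
rewrite -(rmorph_nat (real_complex R)) -rmorphM; congr (_ %:C)%C.
rewrite /gammaw factS natrM exprS; field.
by rewrite nat1r !pnatr_eq0 -!lt0n fact_gt0.
Qed.

Lemma normc_fexp t v n : 0 <= v -> nc (fexp t v n) = gammaw 2 n v.
Proof. by move=> v0; rewrite /fexp normcM normc_cis mulr1 normcR ger0_norm// gammaw_ge0. Qed.

Lemma normc_Gcoef_le t C b f n : expdom C b f -> b < 2 ->
  nc (Gcoef t f n) <= 2 * C * (2 - b)^-1 ^+ n.+1.
Proof.
move=> fC b2; apply: le_trans (normc_le_ReIm _) _.
rewrite -mulrA mulr_natl mulr2n /=; apply: lerD; apply: Rintegral_expdom_le fC b2 _ _.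
- exact: measurable_kcos.
- exact: kcos_le1.
- exact: measurable_ksin.
- exact: ksin_le1.
Qed.

Lemma kintD C1 C2 b f g n h : expdom C1 b f -> expdom C2 b g -> b < 2 ->
  measurable_fun setT h -> (forall v, `|h v| <= 1) ->
  kint (fun v => f v + g v) n h = kint f n h + kint g n h.
Proof.
move=> fC gC b2 mh h1; rewrite /kint -RintegralD//.
- by apply: eq_Rintegral => v _; ring.
- exact: measurable_halfline.
- exact: integrable_expdom fC b2 mh h1.
- exact: integrable_expdom gC b2 mh h1.
Qed.

Lemma kintZ C b f n h a : expdom C b f -> b < 2 ->
  measurable_fun setT h -> (forall v, `|h v| <= 1) ->
  kint (fun v => a * f v) n h = a * kint f n h.
Proof.
move=> fC b2 mh h1; rewrite /kint -RintegralZl//.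
- by apply: eq_Rintegral => v _; ring.
- exact: measurable_halfline.
- exact: integrable_expdom fC b2 mh h1.
Qed.

Lemma GcoefD t C1 C2 b f g : expdom C1 b f -> expdom C2 b g -> b < 2 ->
  Gcoef t (fun v => f v + g v) = Gcoef t f + Gcoef t g.
Proof.
move=> fC gC b2; apply/funext => n; rewrite fpsDE /Gcoef.
rewrite (kintD n fC gC b2 (measurable_kcos t) (kcos_le1 t)).
by rewrite (kintD n fC gC b2 (measurable_ksin t) (ksin_le1 t)).
Qed.

Lemma GcoefZ t C b f a : expdom C b f -> b < 2 ->
  Gcoef t (fun v => a * f v) = fpsC a%:C%C * Gcoef t f.
Proof.
move=> fC b2; apply/funext => n; rewrite fpsCM /Gcoef.
rewrite (kintZ n a fC b2 (measurable_kcos t) (kcos_le1 t)).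
rewrite (kintZ n a fC b2 (measurable_ksin t) (ksin_le1 t)).
by apply/eqP; rewrite eq_complex /=; apply/andP; split; apply/eqP; ring.
Qed.

Lemma expdomW C C' b b' f : expdom C b f -> C <= C' -> b <= b' -> expdom C' b' f.
Proof.
move=> fE CC' bb'; have C0 := expdom_ge0 fE; have [mf fC] := fE.
split => // v v0; apply: le_trans (fC v v0) _.
by apply: ler_pM; rewrite ?expR_ge0//; rewrite ler_expR ler_wpM2r.
Qed.

Lemma expdomD C1 C2 b f g : expdom C1 b f -> expdom C2 b g ->
  expdom (C1 + C2) b (fun v => f v + g v).
Proof.
move=> [mf fC] [mg gC]; split; first exact: measurable_funD.
move=> v v0; apply: le_trans (ler_normD _ _) _; rewrite mulrDl.
by apply: lerD; [exact: fC|exact: gC].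
Qed.

Lemma expdomZ C b f a : expdom C b f -> expdom (`|a| * C) b (fun v => a * f v).
Proof.
move=> [mf fC]; split; first by apply: measurable_funM.
by move=> v v0; rewrite normrM -mulrA ler_wpM2l// fC.
Qed.

Lemma expdom_cst a b : 0 <= b -> expdom `|a| b (cst a).
Proof.
move=> b0; split=> [|v v0]; first exact: measurable_cst.
by rewrite ler_peMr// -expR0 ler_expR mulr_ge0.
Qed.

Lemma expdom_expR : expdom 1 1 (@expR R).
Proof.
split=> [|v v0]; first exact: measurable_expR.
by rewrite !mul1r ger0_norm// expR_ge0.
Qed.

Lemma normc_le_eps (z : R[i]) : (forall e, 0 < e -> nc z <= e) -> z = 0.
Proof.
move=> h; apply/eq0_normc/eqP; rewrite eq_le normc_nneg andbT.
by apply/ler_addgt0Pl => e e0; rewrite addr0 h.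
Qed.

Section AbelComplex.
Variables (I : Type) (lam : I -> R) (F_ f_ : I -> R -> R).
Hypothesis dF : forall i v, is_derive v 1 (F_ i) (f_ i v).
Hypothesis cf : forall i, continuous (f_ i).

Lemma abel_fps t n C C' b F f : expdom C b F -> expdom C' b f -> b < 2 ->
  forall e, 0 < e -> exists2 X0, 0 <= X0 & forall X s, X0 <= X ->
  assembled lam F_ f_ X s F f ->
  nc (\sum_(i <- s) (F_ i (lam i))%:C%C * fexp t (lam i) n -
     (fpsS (cline t) * Gcoef t F - Gcoef t f) n) <= e.
Proof.
move=> FC fC b2 e e0; have e2 : 0 < e / 2 by pos.
have cmk : continuous (fun v => - kcos t v).
  by move=> v; apply: cvgN; exact: continuous_kcos.
have mk1 v : `|- kcos t v| <= 1 by rewrite normrN kcos_le1.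
have [X1 X10 H1] := abel_lim lam dF cf n FC fC b2 (is_derive_kcos t) (@continuous_ksin t)
  (kcos_le1 t) (ksin_le1 t) e2.
have [X2 X20 H2] := abel_lim lam dF cf n FC fC b2 (is_derive_ksin t) cmk (ksin_le1 t) mk1 e2.
exists (Num.max X1 X2) => [|X s]; first by rewrite le_max X10.
rewrite ge_max => /andP[X1X X2X] sX.
apply: le_trans (normc_le_ReIm _) _; rewrite [e]splitr.
have Nk : kint F n (fun v => - kcos t v) = - kint F n (kcos t).
  rewrite -mulN1r -(kintZ n (-1) FC b2 (measurable_kcos t) (kcos_le1 t)) /kint.
  by apply: eq_Rintegral => v _; ring.
apply: lerD.
  rewrite (_ : complex.Re _ = \sum_(i <- s) F_ i (lam i) * gammaw 2 n (lam i) * kcos t (lam i) -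
    (2 * kint F n (kcos t) - kint_pred F n (kcos t) - t * kint F n (ksin t) - kint f n (kcos t))).
    exact: (H1 X s X1X sX).
  rewrite ReD Re_sum; congr (_ + _).
    by apply: eq_bigr => i _; rewrite /fexp /= /kcos cosN; ring.
  by case: n {H1 H2 Nk} => [|m]; rewrite fpsDE fpsNE ?fpsSM0 ?fpsSMS /=; ring.
rewrite (_ : complex.Im _ = \sum_(i <- s) F_ i (lam i) * gammaw 2 n (lam i) * ksin t (lam i) -
    (2 * kint F n (ksin t) - kint_pred F n (ksin t) - t * kint F n (fun v => - kcos t v)
      - kint f n (ksin t))).
  exact: (H2 X s X2X sX).
rewrite ImD Im_sum Nk; congr (_ + _).
  by apply: eq_bigr => i _; rewrite /fexp /= /ksin sinN; ring.
by case: n {H1 H2 Nk} => [|m]; rewrite fpsDE fpsNE ?fpsSM0 ?fpsSMS /=; ring.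
Qed.

End AbelComplex.

(** The Laplace transform of a derivative, as the case of one single piece switched on at 0. *)
Lemma Gcoef_primitive t C C' b F f : expdom C b F -> expdom C' b f -> b < 2 ->
  (forall v, is_derive v 1 F (f v)) -> continuous f ->
  fpsS (cline t) * Gcoef t F = fpsC (F 0)%:C%C + Gcoef t f.
Proof.
move=> FC fC b2 dF cf.
suff : fpsS (cline t) * Gcoef t F - Gcoef t f = fpsC (F 0)%:C%C by move=> <-; ring.
apply/funext => n; apply/eqP; rewrite -subr_eq0 -oppr_eq0 opprB; apply/eqP.
apply: normc_le_eps => e e0.
have [X0 X00 H] := @abel_fps unit (fun=> 0) (fun=> F) (fun=> f) (fun=> dF) (fun=> cf)
  t n C C' b F f FC fC b2 e e0.
have := H X0 [:: tt] (lexx _); rewrite big_seq1 fexp0.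
have -> : (F 0)%:C%C * (1 : fps R) n = fpsC (F 0)%:C%C n.
  by rewrite fps1E; case: n {H} => [|n] /=; rewrite ?mulr1 ?mulr0.
apply; split; first by move=> i _; rewrite lexx.
by move=> v /andP[v0 _]; rewrite !big_seq1 v0 !mul1r.
Qed.

Lemma Gcoef1 t : fpsS (cline t) * Gcoef t (cst 1) = 1.
Proof.
have c0 : expdom `|0 : R| 0 (cst 0) by exact: expdom_cst.
have c1 : expdom `|1 : R| 0 (cst 1) by exact: expdom_cst.
have := @Gcoef_primitive t _ _ 0 (cst 1) (cst 0) c1 c0 (ltr0n _ 2).
have -> : Gcoef t (cst 0) = 0.
  apply/funext => n; apply: normc_le_eps => e e0.
  apply: le_trans (normc_Gcoef_le t n c0 (ltr0n _ 2)) _.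
  by rewrite normr0 mulr0 mul0r ltW.
by rewrite addr0 fpsC1; apply; exact: cst_continuous.
Qed.

Lemma Gcoef_expR t : (fpsS (cline t) - 1) * Gcoef t (@expR R) = 1.
Proof.
have b2 : (1 : R) < 2 by rewrite ltr1n.
have := @Gcoef_primitive t _ _ 1 (@expR R) (@expR R) expdom_expR expdom_expR b2.
rewrite expR0 fpsC1 mulrBl mul1r => ->.
- by rewrite addrK.
- exact: continuous_expR.
Qed.

End LaplaceCoefficients.

(** * Coefficientwise limits of power series *)

Section Limits.
Variable R : realType.
Local Notation nc := (@normc R).
Implicit Types (u w : R -> fps R) (l m : fps R).

(** No uniformity in the index is asked for: each coefficient of a sum, product or derivative
    involves finitely many coefficients, so formal identities pass to the limit. *)
Definition lims u l := forall n e, 0 < e ->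
  exists X0, forall X, X0 <= X -> nc (u X n - l n) <= e.

Lemma lims_unique u l m : lims u l -> lims u m -> l = m.
Proof.
move=> ul um; apply/funext => n; apply/eqP; rewrite -subr_eq0; apply/eqP.
apply: normc_le_eps => e e0; have e2 : 0 < e / 2 by pos.
have [X1 H1] := ul n _ e2; have [X2 H2] := um n _ e2.
set X := Num.max X1 X2.
have h1 : nc (u X n - l n) <= e / 2 by apply: H1; rewrite le_max lexx.
have h2 : nc (u X n - m n) <= e / 2 by apply: H2; rewrite le_max lexx orbT.
rewrite (_ : l n - m n = (u X n - m n) - (u X n - l n)); last by ring.
by apply: le_trans (normcB _ _) _; rewrite [e]splitr lerD.
Qed.

Lemma eq_lims u w l : (forall X, u X = w X) -> lims u l -> lims w l.
Proof. by move=> uw ul n e e0; have [X H] := ul n e e0; exists X => Y; rewrite -uw; exact: H. Qed.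

Lemma limsD u w l m : lims u l -> lims w m -> lims (fun X => u X + w X) (l + m).
Proof.
move=> ul wm n e e0; have e2 : 0 < e / 2 by pos.
have [X1 H1] := ul n _ e2; have [X2 H2] := wm n _ e2.
exists (Num.max X1 X2) => X; rewrite ge_max => /andP[X1X X2X].
rewrite !fpsDE (_ : _ - _ = (u X n - l n) + (w X n - m n)); last by ring.
by apply: le_trans (normcD _ _) _; rewrite [e]splitr lerD// ?H1 ?H2.
Qed.

Lemma lims_shift u l (d : R) : lims u l -> lims (fun X => u (X - d)) l.
Proof.
move=> ul n e e0; have [X1 H1] := ul n _ e0.
by exists (X1 + d) => X; rewrite -lerBrDr; exact: H1.
Qed.

Lemma lims_D u l : lims u l -> lims (fun X => fpsD (u X)) (fpsD l).
Proof.
move=> ul n e e0; have e1 : 0 < e / n.+1%:R by rewrite divr_gt0.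
have [X H] := ul n.+1 _ e1; exists X => Y XY.
rewrite /fpsD -mulrnBl -[_ *+ n.+1]mulr_natl normcM normc_nat mulrC.
by rewrite -ler_pdivlMr ?ltr0n//; exact: H.
Qed.

Lemma lims_cst l : lims (fun=> l) l.
Proof. by move=> n e e0; exists 0 => X _; rewrite subrr normc0 ltW. Qed.

Lemma lims_nat (u : nat -> fps R) l : (forall n e, 0 < e ->
    exists K0, forall K, (K0 <= K)%N -> nc (u K n - l n) <= e) ->
  lims (fun X => u (Num.truncn X)) l.
Proof.
move=> ul n e e0; have [K0 H] := ul n e e0; exists K0%:R => X X0.
by apply: H; rewrite truncn_ge_nat// (le_trans _ X0).
Qed.

Lemma limsM (k : fps R) u l : lims u l -> lims (fun X => k * u X) (k * l).
Proof.
move=> ul n e e0.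
pose S := 1 + \sum_(i < n.+1) nc (k i).
have S0 : 0 < S by rewrite ltr_pwDl// sumr_ge0// => i _; pos.
have eS : 0 < e / S by pos.
have [X0 HX0] : exists X0, forall X, X0 <= X -> forall j : nat, (j <= n)%N ->
    nc (u X j - l j) <= e / S.
  move: (e / S) eS => d {S S0} eS; elim: n => [|m [X1 H1]].
    by have [X0 H] := ul 0%N _ eS; exists X0 => X h [|//] _; exact: H.
  have [X2 H2] := ul m.+1 _ eS.
  exists (Num.max X1 X2) => X; rewrite ge_max => /andP[X1X X2X] j.
  by rewrite leq_eqVlt => /orP[/eqP -> |jm]; [exact: H2|exact: H1].
exists X0 => X XX0; rewrite !fpsME -sumrB.
apply: le_trans (normc_sum _ _ _) _.
apply: (@le_trans _ _ (\sum_(i < n.+1) nc (k i) * (e / S))).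
  apply: ler_sum => i _; rewrite -mulrBr normcM; apply: ler_wpM2l; first by pos.
  by apply: HX0 => //; rewrite leq_subr.
rewrite -mulr_suml mulrCA ler_piMr ?(ltW e0)// ler_pdivrMr// mul1r /S lerDr//.
Qed.

Lemma climM (x y : R -> R[i]) (z1 z2 : R[i]) :
  (forall e, 0 < e -> exists X0, forall X, X0 <= X -> nc (x X - z1) <= e) ->
  (forall e, 0 < e -> exists X0, forall X, X0 <= X -> nc (y X - z2) <= e) ->
  forall e, 0 < e -> exists X0, forall X, X0 <= X -> nc (x X * y X - z1 * z2) <= e.
Proof.
move=> xz yz e e0.
pose S := 2 + nc z1 + nc z2; have S0 : 0 < S by rewrite /S -addrA ltr_pwDl// addr_ge0// normc_nneg.
pose d := Num.min 1 (e / S).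
have d0 : 0 < d by rewrite lt_min ltr01 divr_gt0.
have d1 : d <= 1 by rewrite ge_min lexx.
have dS : d * S <= e by rewrite -ler_pdivlMr// ge_min lexx orbT.
have [X1 H1] := xz d d0; have [X2 H2] := yz d d0.
exists (Num.max X1 X2) => X; rewrite ge_max => /andP[/H1 h1 /H2 h2].
rewrite (_ : _ - _ = (x X - z1) * (y X - z2) + z1 * (y X - z2) + (x X - z1) * z2); last by ring.
apply: le_trans dS; apply: le_trans (normcD _ _) _.
apply: le_trans (lerD (normcD _ _) (lexx _)) _; rewrite !normcM.
have h3 : nc (x X - z1) * nc (y X - z2) <= d * 1.
  by apply: ler_pM; [pos|pos| |exact: le_trans d1].
have h4 : nc z1 * nc (y X - z2) <= d * nc z1 by rewrite mulrC ler_wpM2r//; pos.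
have h5 : nc (x X - z1) * nc z2 <= d * nc z2 by rewrite ler_wpM2r//; pos.
rewrite /S; move: h3 h4 h5 d0; lra.
Qed.

Lemma limsMM u w l m : lims u l -> lims w m -> lims (fun X => u X * w X) (l * m).
Proof.
move=> ul wm n; rewrite fpsME.
suff H N : (N <= n.+1)%N -> forall e, 0 < e -> exists X0, forall X, X0 <= X ->
    nc (\sum_(i < N) u X i * w X (n - i)%N - \sum_(i < N) l i * m (n - i)%N) <= e.
  exact: H.
elim: N => [_ e e0|N IH Nn e e0].
  by exists 0 => X _; rewrite !big_ord0 subrr normc0 ltW.
have e2 : 0 < e / 2 by pos.
have [X1 H1] := IH (ltnW Nn) _ e2.
have [X2 H2] := climM (ul N) (wm (n - N)%N) e2.
exists (Num.max X1 X2) => X; rewrite ge_max => /andP[/H1 h1 /H2 h2].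
rewrite !big_ord_recr /= opprD addrACA; apply: le_trans (normcD _ _) _.
by rewrite [e]splitr lerD.
Qed.

End Limits.

(** * Dirichlet series dominated by a positive weight *)

Section Counting.
Variables (R : realType) (T : choiceType) (D : pred T) (lam b : T -> R) (Cb : R).
Local Notation nc := (@normc R).
Implicit Types (a : T -> R) (t v X : R) (x : T) (n : nat).
Hypothesis lam_ge0 : forall x, D x -> 0 <= lam x.
Hypothesis lev_finite : forall X, finite_set [set x | D x /\ lam x <= X].

Definition lev X : {fset T} := fset_set [set x | D x /\ lam x <= X].

Lemma mem_lev x X : (x \in lev X) = D x && (lam x <= X).
Proof.
rewrite in_fset_set//; apply/idP/idP; rewrite inE /=; last by move=> /andP[].
by case=> -> ->.
Qed.

Lemma sum_lev_le (V : nmodType) (g : T -> V) v X : v <= X ->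
  \sum_(x <- lev X | lam x <= v) g x = \sum_(x <- lev v) g x.
Proof.
move=> vX; rewrite -big_filter; apply: perm_big; apply: uniq_perm.
- by rewrite filter_uniq// fset_uniq.
- exact: fset_uniq.
move=> x; rewrite mem_filter !mem_lev andbCA; congr (_ && _).
by case: (leP (lam x) v) => //= h; rewrite (le_trans h vX).
Qed.

Definition countle a v := \sum_(x <- lev v) a x.

Lemma countle_nondecreasing a : (forall x, 0 <= a x) -> {homo countle a : v X / v <= X}.
Proof.
move=> a0 v X vX; rewrite /countle -(sum_lev_le a vX) [leRHS](bigID (fun x => lam x <= v)) /=.
by rewrite lerDl sumr_ge0.
Qed.

Hypothesis b_ge0 : forall x, 0 <= b x.
Hypothesis bC : forall v, 0 <= v -> countle b v <= Cb * expR v.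

(** One weight [b], whose counting function is O(exp v), dominates all series over the same index
    set, so the bounds below are uniform both in [a] and in [t]. *)
Definition bdd a := forall x, `|a x| <= b x.

Lemma bdd_b : bdd b.
Proof. by move=> x; rewrite ger0_norm. Qed.

Lemma expdom_countle a : bdd a -> expdom Cb 1 (countle a).
Proof.
move=> ab; split.
  have -> : countle a = (fun v => countle (fun x => a x + b x) v - countle b v).
    by apply/funext => v; rewrite /countle -sumrB; apply: eq_bigr => x _; rewrite addrK.
  apply: measurable_funB; apply: nondecreasing_measurable => //;
    apply: countle_nondecreasing => // x.
  by have := ab x; rewrite ler_norml => /andP[h _]; rewrite -lerBlDr sub0r.
move=> v v0; rewrite mul1r; apply: le_trans (bC v0).
by apply: le_trans (ler_norm_sum _ _ _) _; exact: ler_sum.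
Qed.

Definition psum t a X : fps R := \sum_(x <- lev X) fpsC (a x)%:C%C * fexp t (lam x).
(** Encoded as s times the transform of the counting function, for which coefficient bounds are
    immediate; [Dser_lim] identifies it with the limit of the partial sums [psum]. *)
Definition Dser t a : fps R := fpsS (cline t) * Gcoef t (countle a).

Lemma psumE t a X n : psum t a X n = \sum_(x <- lev X) (a x)%:C%C * fexp t (lam x) n.
Proof. by rewrite /psum fps_sumE; apply: eq_bigr => x _; rewrite fpsCM. Qed.

Lemma In_mem_seq (s : seq T) x : List.In x s -> x \in s.
Proof.
elim: s => //= y s IH [->|/IH h]; rewrite inE ?eqxx//.
by rewrite h orbT.
Qed.

Lemma Dser_lim t a : bdd a -> lims (psum t a) (Dser t a).
Proof.
move=> ab n e e0.
have c0 : expdom `|0 : R| 0 (cst 0) by exact: expdom_cst.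
have c01 : expdom 0 1 (cst 0 : R -> R) by apply: expdomW c0 _ _; rewrite ?normr0.
have b2 : (1 : R) < 2 by rewrite ltr1n.
have [X0 X00 H] := @abel_fps R T lam (fun x => cst (a x)) (fun=> cst 0)
  (fun x v => is_derive_cst (a x) v 1) (fun x => @cst_continuous _ _ 0)
  t n Cb 0 1 (countle a) (cst 0) (expdom_countle ab) c01 b2 e e0.
exists X0 => X X0X; rewrite psumE.
have G0 : Gcoef t (cst 0) = 0.
  apply/funext => m; apply: normc_le_eps => d d0.
  apply: le_trans (normc_Gcoef_le t m c0 (ltr0n _ 2)) _.
  by rewrite normr0 mulr0 mul0r ltW.
have := H X (lev X) X0X; rewrite G0 subr0 /=; apply; split.
  by move=> x /In_mem_seq; rewrite mem_lev => /andP[Dx ->]; rewrite lam_ge0.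
move=> v /andP[v0 vX]; split.
  rewrite /countle -(sum_lev_le a vX) big_mkcond /=; apply: eq_bigr => x _.
  by case: (lam x <= v); rewrite ?mul1r ?mul0r.
by rewrite big1// => x _; rewrite mulr0.
Qed.

Definition bsum n X := \sum_(x <- lev X) b x * gammaw 2 n (lam x).

Lemma mem_lev_ge0 x X : x \in lev X -> 0 <= lam x.
Proof. by rewrite mem_lev => /andP[/lam_ge0]. Qed.

Lemma bsum_homo n : {homo bsum n : X Y / X <= Y}.
Proof.
move=> X Y XY; rewrite /bsum -(sum_lev_le _ XY) [leRHS](bigID (fun x => lam x <= X)) /=.
rewrite lerDl big_seq_cond sumr_ge0// => x /andP[/mem_lev_ge0 x0 _].
by rewrite mulr_ge0// gammaw_ge0.
Qed.

Lemma psum_b0 n X : psum 0 b X n = (bsum n X)%:C%C.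
Proof.
rewrite psumE /bsum (rmorph_sum (real_complex R)); apply: eq_bigr => x _.
by rewrite (rmorphM (real_complex R)) /fexp mul0r oppr0 cis0 mulr1.
Qed.

Lemma Cb_ge0 : 0 <= Cb.
Proof. exact: expdom_ge0 (expdom_countle bdd_b). Qed.

(** At t = 0 there are no phases and the partial sums increase to [Dser 0 b]. The constant comes
    from c g(n+1) - g(n) with |c| = 2 and |g| <= 2 Cb. *)
Lemma bsum_le n X : bsum n X <= 6 * Cb.
Proof.
apply/ler_addgt0Pl => e e0; have [X0 H] := Dser_lim 0 bdd_b n e0.
set Y := Num.max X X0.
apply: le_trans (bsum_homo n (_ : X <= Y)) _; first by rewrite le_max lexx.
have h : nc (psum 0 b Y n - Dser 0 b n) <= e by apply: H; rewrite le_max lexx orbT.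
apply: (@le_trans _ _ (nc (psum 0 b Y n))).
  by rewrite psum_b0 normcR ler_norm.
rewrite -[psum 0 b Y n](subrK (Dser 0 b n)); apply: le_trans (normcD _ _) _.
apply: lerD => //.
have gle m : nc (Gcoef 0 (countle b) m) <= 2 * Cb.
  have b2 : (1 : R) < 2 by rewrite ltr1n.
  apply: le_trans (normc_Gcoef_le 0 m (expdom_countle bdd_b) b2) _.
  by rewrite (_ : 2 - 1 = 1 :> R) ?invr1 ?expr1n ?mulr1//; ring.
have c2 : nc (cline (0 : R)) = 2 by rewrite (normcR 2) ger0_norm.
have C0 := Cb_ge0.
rewrite /Dser; case: n {H h} => [|n].
  rewrite fpsSM0 normcM c2; have := gle 0%N; lra.
rewrite fpsSMS; apply: le_trans (normcB _ _) _; rewrite normcM c2.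
have := gle n.+1; have := gle n; lra.
Qed.

Lemma normc_psum_le t a X n :
  nc (psum t a X n) <= \sum_(x <- lev X) `|a x| * gammaw 2 n (lam x).
Proof.
rewrite psumE; apply: le_trans (normc_sum _ _ _) _.
rewrite big_seq [leRHS]big_seq; apply: ler_sum => x /mem_lev_ge0 x0.
by rewrite normcM normcR normc_fexp.
Qed.

Lemma lims_le u (l : fps R) n (B : R) : lims u l ->
  (exists X0, forall X, X0 <= X -> nc (u X n) <= B) -> nc (l n) <= B.
Proof.
move=> ul [X1 uB]; apply/ler_addgt0Pl => e e0; have [X0 H] := ul n e e0.
set Y := Num.max X1 X0.
have h : nc (u Y n - l n) <= e by apply: H; rewrite le_max lexx orbT.
rewrite -[l n](subKr (u Y n)); apply: le_trans (normcB _ _) _.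
by rewrite addrC lerD//; apply: uB; rewrite le_max lexx.
Qed.

Lemma Dser_le t a n : bdd a -> nc (Dser t a n) <= 6 * Cb.
Proof.
move=> ab; apply: lims_le (Dser_lim t ab) _; exists 0 => X _.
apply: le_trans (normc_psum_le t a X n) _; apply: le_trans (bsum_le n X).
rewrite /bsum big_seq [leRHS]big_seq; apply: ler_sum => x /mem_lev_ge0 x0.
by rewrite ler_wpM2r// gammaw_ge0.
Qed.

Lemma bsum_tail n e : 0 < e ->
  exists X0, forall X, X0 <= X -> bsum n X - bsum n X0 <= e.
Proof.
move=> e0; have e2 : 0 < e / 2 by pos.
have [X0 H] := Dser_lim 0 bdd_b n e2; exists X0 => X XX0.
have h1 := H X XX0; have h0 := H X0 (lexx _).
have -> : bsum n X - bsum n X0 = complex.Re ((psum 0 b X n - Dser 0 b n) - (psum 0 b X0 n - Dser 0 b n)).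
  by rewrite !psum_b0; case: (Dser _ _ _) => x y /=; ring.
apply: le_trans (ler_norm _) _; apply: Re_le_normc.
by apply: le_trans (normcB _ _) _; rewrite [e]splitr lerD.
Qed.

(** A single [X0] serves all [t] and all dominated [a], since the terms are compared with the tail
    of the positive series at t = 0. The uniformity in [a] matters when g-primes are removed one
    after the other and the coefficients change with [K]. *)
Lemma Dser_tail n e : 0 < e -> exists X0, forall t a, bdd a ->
  (forall x, D x -> lam x <= X0 -> a x = 0) -> nc (Dser t a n) <= e.
Proof.
move=> e0; have [X0 H] := bsum_tail n e0; exists X0 => t a ab a0.
apply: lims_le (Dser_lim t ab) _; exists X0 => X XX0.
apply: le_trans (normc_psum_le t a X n) _; apply: le_trans (H X XX0).
have -> : bsum n X - bsum n X0 =
    \sum_(x <- lev X | ~~ (lam x <= X0)) b x * gammaw 2 n (lam x).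
  rewrite /bsum -(sum_lev_le _ XX0) [X in X - _ = _](bigID (fun x => lam x <= X0)) /=.
  by rewrite addrAC subrr add0r.
rewrite (bigID (fun x => lam x <= X0)) /= [X in X + _]big1_seq ?add0r; last first.
  by move=> x /andP[xX0]; rewrite mem_lev => /andP[Dx _]; rewrite a0// normr0 mul0r.
rewrite big_seq_cond [leRHS]big_seq_cond; apply: ler_sum => x /andP[/mem_lev_ge0 x0 _].
by rewrite ler_wpM2r// gammaw_ge0.
Qed.

Lemma DserN t a : bdd a -> Dser t (fun x => - a x) = - Dser t a.
Proof.
move=> ab; have Nab : bdd (fun x => - a x) by move=> x; rewrite normrN.
apply: (lims_unique (Dser_lim t Nab)); rewrite -mulN1r.
apply: eq_lims (limsM (-1) (Dser_lim t ab)) => X.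
apply/funext => n; rewrite mulN1r fpsNE !psumE -sumrN; apply: eq_bigr => x _.
by rewrite rmorphN mulNr.
Qed.

Lemma DserD t a1 a2 : bdd a1 -> bdd a2 -> bdd (fun x => a1 x + a2 x) ->
  Dser t (fun x => a1 x + a2 x) = Dser t a1 + Dser t a2.
Proof.
move=> a1b a2b ab; apply: (lims_unique (Dser_lim t ab)).
apply: eq_lims (limsD (Dser_lim t a1b) (Dser_lim t a2b)) => X.
apply/funext => n; rewrite fpsDE !psumE -big_split; apply: eq_bigr => x _.
by rewrite rmorphD mulrDl.
Qed.

Lemma Dser_single t x0 (y : R) : D x0 -> bdd (fun x => if x == x0 then y else 0) ->
  Dser t (fun x => if x == x0 then y else 0) = fpsC y%:C%C * fexp t (lam x0).
Proof.
move=> Dx0 ab; apply: (lims_unique (Dser_lim t ab)) => n e e0.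
exists (lam x0) => X xX; rewrite psumE fpsCM.
rewrite (big_fsetD1 x0) ?mem_lev ?Dx0//= eqxx big1_seq ?addr0 ?subrr ?normc0 ?ltW//.
by move=> x /=; rewrite in_fsetD1 => /andP[/negbTE -> _]; rewrite mul0r.
Qed.

(* [sig] multiplies by a fixed integer of logarithm [l]; [a] exceeds [a1] by the
   image of [a2]. *)
Lemma Dser_shift t a a1 a2 (sig : T -> T) (l : R) : bdd a -> bdd a1 -> bdd a2 ->
  injective sig ->
  (forall x, D x -> a2 x != 0 -> D (sig x) && (lam (sig x) == lam x + l)) ->
  (forall x, D x -> a2 x != 0 -> a (sig x) - a1 (sig x) = a2 x) ->
  (forall y, D y -> a y - a1 y != 0 -> exists2 x, D x /\ a2 x != 0 & y = sig x) ->
  Dser t a = Dser t a1 + fexp t l * Dser t a2.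
Proof.
move=> ab a1b a2b sinj slam sa2 onto.
apply: (lims_unique (Dser_lim t ab)).
have L2 := limsM (fexp t l) (lims_shift l (Dser_lim t a2b)).
apply: eq_lims (limsD (Dser_lim t a1b) L2) => X.
rewrite addrC; apply/esym/eqP; rewrite -subr_eq; apply/eqP.
rewrite /psum -sumrB mulr_sumr.
transitivity (\sum_(x <- lev X | a x - a1 x != 0) fpsC (a x - a1 x)%:C%C * fexp t (lam x)).
  rewrite [RHS]big_mkcond /=; apply: eq_bigr => x _; rewrite -mulrBl.
  have -> : fpsC (a x)%:C%C - fpsC (a1 x)%:C%C = fpsC (a x - a1 x)%:C%C.
    by apply/funext => -[|n]; rewrite fpsDE fpsNE /= ?rmorphB// subr0.
  case: eqVneq => [->|//]; apply/funext => n; rewrite fpsCM.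
  by rewrite mul0r.
transitivity (\sum_(x <- lev (X - l) | a2 x != 0) fexp t l * (fpsC (a2 x)%:C%C * fexp t (lam x))).
  rewrite -big_filter -[RHS]big_filter.
  rewrite (perm_big [seq sig x | x <- lev (X - l) & a2 x != 0]); last first.
    apply: uniq_perm.
    - by rewrite filter_uniq// fset_uniq.
    - by rewrite map_inj_uniq// filter_uniq// fset_uniq.
    move=> y; apply/idP/mapP.
      rewrite mem_filter mem_lev => /and3P[ay Dy yX].
      have [x [Dx ax] yE] := onto y Dy ay; exists x => //.
      rewrite mem_filter ax mem_lev Dx /= lerBrDr.
      by have /andP[_ /eqP <-] := slam x Dx ax; rewrite -yE.
    move=> [x]; rewrite mem_filter mem_lev => /and3P[ax Dx xX] ->.
    have /andP[Ds /eqP sE] := slam x Dx ax.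
    by rewrite mem_filter mem_lev sa2// ax Ds sE -lerBrDr xX.
  rewrite big_map !big_filter big_seq_cond [RHS]big_seq_cond.
  apply: eq_bigr => x; rewrite mem_lev => /andP[/andP[Dx _] ax].
  have /andP[_ /eqP ->] := slam x Dx ax; rewrite sa2// fexpD; ring.
rewrite big_mkcond /=; apply: eq_bigr => x _.
case: eqVneq => [->|//]; apply/funext => n.
by rewrite mulrCA fpsCM mul0r.
Qed.

End Counting.

(** * Beurling systems *)

Section GeneralizedIntegers.
Variables (R : realType) (P : gprimes R).
Implicit Types (n : gint) (i K : nat) (x v X t : R) (ik : nat * nat).

Definition ell i := ln (P i).

Lemma ell_gt0 i : 0 < ell i.
Proof. exact: ln_gt0 (gprime_gt1 P i). Qed.

Lemma expR_ell i : expR (ell i) = P i.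
Proof. by rewrite lnK// posrE gprime_gt0. Qed.

Lemma gval_ge1 n : 1 <= gval P n.
Proof.
rewrite /gval; elim/big_rec: _ => // j y _ y1.
by rewrite mulr_ege1// exprn_ege1// ltW// gprime_gt1.
Qed.

Lemma gval_gt0 n : 0 < gval P n.
Proof. exact: lt_le_trans (gval_ge1 n). Qed.

Definition gln n := ln (gval P n).

Lemma gln_ge0 n : 0 <= gln n.
Proof. exact: ln_ge0 (gval_ge1 n). Qed.

Lemma gln_le n X : (gln n <= X) = (gval P n <= expR X).
Proof. by rewrite -[X in LHS]expRK ler_ln ?posrE ?gval_gt0 ?expR_gt0. Qed.

Lemma gvalE (S : {fset nat}) n : (finsupp n `<=` S)%fset ->
  gval P n = \prod_(i <- S) P i ^+ n i.
Proof.
move=> nS; rewrite /gval (big_fset_incl _ nS)// => i iS ni.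
by rewrite fsfun_dflt// expr0.
Qed.

Definition gmul K n : gint := [fsfun n with K |-> (n K).+1].

Lemma gmulE K n i : gmul K n i = if i == K then (n K).+1 else n i.
Proof. by rewrite fsfun_withE. Qed.

Lemma finsupp_gmul K n : finsupp (gmul K n) = (K |` finsupp n)%fset.
Proof.
apply/fsetP => i; rewrite mem_finsupp gmulE !inE mem_finsupp.
by have [->|/negPf iK] := eqVneq i K; rewrite ?eqxx// !iK.
Qed.

Lemma gmul_inj K : injective (gmul K).
Proof.
move=> m n /fsfunP mn; apply/fsfunP => i; have := mn i; rewrite !gmulE.
by case: eqVneq => [->[]|].
Qed.

Lemma gval_gmul K n : gval P (gmul K n) = P K * gval P n.
Proof.
have s1 : (finsupp (gmul K n) `<=` K |` finsupp n)%fset by rewrite finsupp_gmul.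
have s2 : (finsupp n `<=` K |` finsupp n)%fset by apply/fsubsetP => i; rewrite !inE orbC => ->.
rewrite (gvalE s1) (gvalE s2).
rewrite (big_fsetD1 K) ?inE ?eqxx//= [in RHS](big_fsetD1 K) ?inE ?eqxx//=.
rewrite gmulE eqxx exprS -mulrA; congr (_ * (_ * _)).
rewrite big_seq [RHS]big_seq; apply: eq_bigr => i; rewrite !inE => /andP[/negbTE iK _].
by rewrite gmulE iK.
Qed.

Lemma gln_gmul K n : gln (gmul K n) = gln n + ell K.
Proof.
by rewrite /gln gval_gmul lnM ?posrE ?gprime_gt0 ?gval_gt0// addrC.
Qed.

Lemma gmu_gmul K n : gmu R (gmul K n) = if n K == 0%N then - gmu R n else 0.
Proof.
rewrite /gmu finsupp_gmul; case: eqVneq => nK.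
  have Kn : K \notin finsupp n by rewrite memNfinsupp nK.
  rewrite cardfsU1 Kn add1n exprS mulN1r.
  have -> : all (fun i => gmul K n i == 1%N) (K |` finsupp n)%fset =
      all (fun i => n i == 1%N) (finsupp n).
    apply/allP/allP => h i.
      move=> ni; have := h i; rewrite !inE ni orbT => /(_ isT).
      have iK : (i == K) = false by apply/negP => /eqP iK; rewrite iK (negbTE Kn) in ni.
      by rewrite gmulE iK.
    move=> ii; have [->|E] := pselect (i = K); first by rewrite gmulE eqxx nK.
    have iK : (i == K :> nat) = false by apply/eqP.
    by rewrite gmulE iK; apply: h; move: ii; rewrite in_fset1U => /orP[/eqP|].
  by case: ifP => //; rewrite oppr0.
rewrite ifF//; apply/negbTE/allPn; exists K; first by rewrite !inE eqxx.
by rewrite gmulE eqxx.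
Qed.

(** Sifting goes by index and not by size: equal g-primes are distinct and have to be removed one at
    a time. *)
Definition rough K n := [forall i : 'I_K, n i == 0%N].

Lemma rough0 n : rough 0 n.
Proof. by apply/forallP => -[]. Qed.

Lemma roughP K n : reflect (forall i, (i < K)%N -> n i = 0%N) (rough K n).
Proof.
apply: (iffP forallP) => [h i iK|h i]; first by have /eqP := h (Ordinal iK).
by rewrite h.
Qed.

Lemma roughS K n : rough K.+1 n = rough K n && (n K == 0%N).
Proof.
apply/roughP/andP => [h|[/roughP h /eqP nK] i].
  by split; [apply/roughP => i iK; apply: h; exact: ltnW|rewrite h].
by rewrite ltnS leq_eqVlt => /orP[/eqP->//|]; exact: h.
Qed.

Lemma rough_gmul K n : rough K (gmul K n) = rough K n.
Proof.
by apply/roughP/roughP => h i iK; have := h i iK; rewrite gmulE (ltn_eqF iK).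
Qed.

Lemma gmul_surj K (m : gint) : m K != 0%N -> exists2 n, m = gmul K n & n K = (m K).-1.
Proof.
move=> mK; exists [fsfun m with K |-> (m K).-1]; last by rewrite fsfun_withE eqxx.
apply/fsfunP => i; rewrite gmulE !fsfun_withE eqxx.
by case: eqVneq => // ->; rewrite prednK// lt0n.
Qed.

Lemma gval0 : gval P [fsfun] = 1.
Proof. by rewrite /gval finsupp0 big_seq_fset0. Qed.

Lemma gln0 : gln [fsfun] = 0.
Proof. by rewrite /gln gval0 ln1. Qed.

Lemma gmu0 : gmu R [fsfun] = 1.
Proof. rewrite /gmu finsupp0 ?cardfs0 ?expr0.
by first [by []|by case: allP => // -[] i; rewrite inE]. Qed.

Lemma gmu_le1 n : `|gmu R n| <= 1.
Proof.
by rewrite /gmu; case: ifP => _; rewrite ?normr0// normrX normrN1 expr1n.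
Qed.

Lemma rough_gln K n : rough K n -> n != [fsfun] -> ell K <= gln n.
Proof.
move=> /roughP nK n0.
have [i ni] : exists i, n i != 0%N.
  apply: contrapT => h; move/eqP: n0; apply; apply/fsfunP => i.
  rewrite fsfun0E; apply/eqP/negPn/negP => ni; by apply: h; exists i.
have Ki : (K <= i)%N by rewrite leqNgt; apply/negP => /nK /eqP; exact/negP.
rewrite /gln ler_ln ?posrE ?gprime_gt0 ?gval_gt0//.
apply: le_trans (gprimeX_le_gval P n i).
apply: (@le_trans _ _ (P i)); first exact: gprime_nondecreasing.
by rewrite -[leLHS]expr1 ler_weXn2l ?lt0n// ltW// gprime_gt1.
Qed.

Lemma ell_unbounded X : exists K0, forall K, (K0 <= K)%N -> X < ell K.
Proof.
have [K0 h] := gprime_unbounded P (expR X); exists K0 => K KK.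
rewrite -ltr_expR expR_ell; apply: lt_le_trans h _.
exact: gprime_nondecreasing.
Qed.

Definition gone n : R := 1.

Lemma gln_finite X : finite_set [set n : gint | predT n /\ gln n <= X].
Proof.
apply: sub_finite_set (finite_gint_le P (expR X)) => n [_].
by rewrite gln_le.
Qed.

Lemma sum_gint_leE (F : gint -> R) X :
  \sum_(n \in gint_le P (expR X)) F n = \sum_(n <- lev predT gln X) F n.
Proof.
rewrite fsbig_finite; last exact: finite_gint_le.
rewrite /lev; congr (\big[_/_]_(_ <- _) _); congr (enum_fset (fset_set _)).
by apply/seteqP; split => n; rewrite /gint_le /= -gln_le //; case.
Qed.

Definition ppow ik := (0 < ik.2)%N.
Definition pln ik := ik.2%:R * ell ik.1.
Definition plog ik := ell ik.1.

Lemma pln_le ik X : (pln ik <= X) = (P ik.1 ^+ ik.2 <= expR X).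
Proof.
rewrite -[X in LHS]expRK /pln /ell mulr_natl -lnXn ?gprime_gt0//.
by rewrite ler_ln ?posrE ?exprn_gt0 ?gprime_gt0 ?expR_gt0.
Qed.

Lemma pln_finite X : finite_set [set ik | ppow ik /\ pln ik <= X].
Proof.
apply: sub_finite_set (finite_gprimepow_le P (expR X)) => ik [? ].
by rewrite pln_le.
Qed.

Lemma gpsiE X : gpsi P (expR X) = countle ppow pln plog X.
Proof.
rewrite /gpsi fsbig_finite; last exact: finite_gprimepow_le.
rewrite /countle /lev; congr (\big[_/_]_(_ <- _) _); congr (enum_fset (fset_set _)).
by apply/seteqP; split => ik; rewrite /gprimepow_le /= -pln_le.
Qed.

Lemma gNE X : gN P (expR X) = countle predT gln gone X.
Proof. exact: sum_gint_leE. Qed.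

Lemma gME X : gM P (expR X) = countle predT gln (gmu R) X.
Proof. exact: sum_gint_leE. Qed.

Variables C1 C2 : R.
Hypothesis NC : forall v, 0 <= v -> gN P (expR v) <= C1 * expR v.
Hypothesis psiC : forall v, 0 <= v -> gpsi P (expR v) <= C2 * expR v.

Lemma gone_ge0 n : 0 <= gone n. Proof. exact: ler01. Qed.

Lemma count_gone v : 0 <= v -> countle predT gln gone v <= C1 * expR v.
Proof. by rewrite -gNE; exact: NC. Qed.

Lemma count_plog v : 0 <= v -> countle ppow pln plog v <= C2 * expR v.
Proof. by rewrite -gpsiE; exact: psiC. Qed.

Lemma plog_ge0 ik : 0 <= plog ik. Proof. exact: ltW (ell_gt0 _). Qed.

Lemma pln_ge0 ik : ppow ik -> 0 <= pln ik.
Proof. by move=> _; rewrite mulr_ge0// ltW// ell_gt0. Qed.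

Let gln_ge0' n : predT n -> 0 <= gln n. Proof. by move=> _; exact: gln_ge0. Qed.

Definition ind (b : bool) : R := b%:R.

Lemma bdd_ind (p : gint -> bool) : bdd gone (fun n => ind (p n)).
Proof. by move=> n; rewrite /ind; case: (p n); rewrite ?normr1 ?normr0. Qed.

Lemma bdd_gmu (p : gint -> bool) : bdd gone (fun n => gmu R n * ind (p n)).
Proof.
move=> n; rewrite /ind; case: (p n); rewrite ?mulr0 ?normr0// mulr1.
exact: gmu_le1.
Qed.

Definition Zrough K t := Dser predT gln t (fun n => ind (rough K n)).
Definition Irough K t := Dser predT gln t (fun n => gmu R n * ind (rough K n)).

(** One Euler factor: a [K]-rough integer either avoids the g-prime of index [K] or is that g-prime
    times a [K]-rough integer. *)
Lemma ZroughS K t : Zrough K t = Zrough K.+1 t + fexp t (ell K) * Zrough K t.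
Proof.
apply: (Dser_shift gln_ge0' gln_finite gone_ge0 count_gone) (@gmul_inj K) _ _ _;
  try exact: bdd_ind.
- by move=> n _ _; rewrite gln_gmul eqxx.
- move=> n _ _; rewrite rough_gmul roughS gmulE eqxx andbF.
  by rewrite /ind subr0.
- move=> m _; rewrite roughS /ind; case: (boolP (rough K m)) => rm; rewrite ?subrr ?eqxx//=.
  case mK: (_ == 0%N); rewrite ?subrr ?eqxx// => _.
  have [n mE _] := gmul_surj (negbT mK); exists n => //; split => //.
  by rewrite -(rough_gmul K) -mE rm oner_eq0.
Qed.

(** As for [Zrough], except that the cofactor must itself avoid the g-prime for [gmu] not to vanish,
    and that [gmu] changes sign. *)
Lemma IroughS K t : Irough K t = Irough K.+1 t - fexp t (ell K) * Irough K.+1 t.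
Proof.
rewrite -mulrN -(DserN gln_ge0' gln_finite gone_ge0 count_gone); last exact: bdd_gmu.
have Nb : bdd gone (fun n => - (gmu R n * ind (rough K.+1 n))).
  by move=> n; rewrite normrN; exact: bdd_gmu.
apply: (Dser_shift gln_ge0' gln_finite gone_ge0 count_gone t _ _ Nb (@gmul_inj K));
  try exact: bdd_gmu.
- by move=> n _ _; rewrite gln_gmul eqxx.
- move=> n _ _; rewrite rough_gmul !roughS rough_gmul gmulE eqxx andbF.
  rewrite /ind mulr0 subr0 gmu_gmul; case: (_ == 0%N); rewrite ?andbT ?andbF.
    by rewrite mulNr.
  by rewrite mul0r mulr0 oppr0.
- move=> m _; rewrite roughS /ind; case: (boolP (rough K m)) => rm; rewrite ?subrr ?eqxx//=.
  case mK: (_ == 0%N); rewrite ?subrr ?eqxx// mulr1 mulr0 subr0 => m0.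
  have [n mE _] := gmul_surj (negbT mK); exists n => //; split => //.
  rewrite roughS -(rough_gmul K) -mE rm /=; move: m0; rewrite mE gmu_gmul.
  by case: (_ == 0%N); rewrite ?eqxx//= mulr1.
Qed.

(** For large [K] every rough integer other than 1 lies beyond the [X0] of [Dser_tail], so that only
    the term of the empty product survives. *)
Lemma Dser_rough_tail t (a : nat -> gint -> R) : (forall K, bdd gone (a K)) ->
  (forall K, a K [fsfun] = 1) -> (forall K n, ~~ rough K n -> a K n = 0) ->
  lims (fun X => Dser predT gln t (a (Num.truncn X))) 1.
Proof.
move=> ab a1 a0; apply: (@lims_nat _ (fun K => Dser predT gln t (a K))) => n e e0.
have [X0 H] := Dser_tail gln_ge0' gln_finite gone_ge0 count_gone n e0.
have [K0 HK] := ell_unbounded X0; exists K0 => K KK.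
pose s (m : gint) : R := if m == [fsfun] then 1 else 0.
pose r (m : gint) : R := if m == [fsfun] then 0 else a K m.
have sb : bdd gone s by move=> m; rewrite /s; case: ifP => _; rewrite ?normr1 ?normr0.
have rb : bdd gone r by move=> m; rewrite /r; case: ifP => _; [rewrite normr0|exact: ab].
have E : a K = (fun m => s m + r m).
  by apply/funext => m; rewrite /s /r; case: eqVneq => [->|_]; rewrite ?a1 ?addr0 ?add0r.
have srb : bdd gone (fun m => s m + r m) by rewrite -E.
rewrite E (DserD gln_ge0' gln_finite gone_ge0 count_gone t sb rb srb).
rewrite /s (Dser_single gln_ge0' gln_finite gone_ge0 count_gone)// gln0 fexp0 mulr1.
rewrite (rmorph1 (real_complex R)) fpsC1 fpsDE addrAC subrr add0r.
apply: H => // m _ mX; rewrite /r; case: eqVneq => // m0.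
apply: a0; apply/negP => mr; have := rough_gln mr m0.
by move=> /(lt_le_trans (HK K KK)) /(le_lt_trans mX); rewrite ltxx.
Qed.

Lemma Zrough_lim t : lims (fun X => Zrough (Num.truncn X) t) 1.
Proof.
apply: (@Dser_rough_tail t (fun K n => ind (rough K n))).
- by move=> K; exact: bdd_ind.
- move=> K; rewrite /ind (_ : rough K _ = true)//.
  by apply/roughP => i _; rewrite fsfun0E.
- by move=> K n /negbTE ->.
Qed.

Lemma Irough_lim t : lims (fun X => Irough (Num.truncn X) t) 1.
Proof.
apply: (@Dser_rough_tail t (fun K n => gmu R n * ind (rough K n))).
- by move=> K; exact: bdd_gmu.
- move=> K; rewrite gmu0 mul1r /ind (_ : rough K _ = true)//.
  by apply/roughP => i _; rewrite fsfun0E.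
- by move=> K n /negbTE ->; rewrite mulr0.
Qed.

Definition Zser t := Dser predT gln t gone.
Definition Iser t := Dser predT gln t (gmu R).
Definition Lser t := Dser ppow pln t plog.

Lemma Zrough0 t : Zrough 0 t = Zser t.
Proof. by rewrite /Zrough /Zser; congr Dser; apply/funext => n; rewrite rough0. Qed.

Lemma Irough0 t : Irough 0 t = Iser t.
Proof. by rewrite /Irough /Iser; congr Dser; apply/funext => n; rewrite rough0 mulr1. Qed.

(** The product [Zrough K t * Irough K t] does not depend on [K], because the Euler factors cancel,
    and both of its factors tend to 1. *)
Lemma Zser_Iser t : Zser t * Iser t = 1.
Proof.
have ZI K : Zrough K t * Irough K t = Zser t * Iser t.
  elim: K => [|K <-]; first by rewrite Zrough0 Irough0.
  rewrite (IroughS K); have ZS := ZroughS K t.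
  have -> : Zrough K.+1 t = Zrough K t - fexp t (ell K) * Zrough K t.
    by rewrite [in X in _ = X - _]ZS; ring.
  ring.
have := limsMM (Zrough_lim t) (Irough_lim t); rewrite mulr1 => h.
apply: lims_unique h; apply: eq_lims (lims_cst _) => X.
by rewrite ZI.
Qed.

Definition Lsmooth K t := Dser ppow pln t (fun ik => plog ik * ind (ik.1 < K)%N).

Lemma bdd_plog (p : nat * nat -> bool) : bdd plog (fun ik => plog ik * ind (p ik)).
Proof.
move=> ik; rewrite /ind; case: (p ik); rewrite ?mulr0 ?normr0 ?plog_ge0// mulr1.
by rewrite ger0_norm// plog_ge0.
Qed.

Definition Lprime K t := Dser ppow pln t (fun ik => plog ik * ind (ik.1 == K)).

Lemma LsmoothS K t : Lsmooth K.+1 t = Lsmooth K t + Lprime K t.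
Proof.
have E : (fun ik => plog ik * ind (ik.1 < K.+1)%N) =
    (fun ik => plog ik * ind (ik.1 < K)%N + plog ik * ind (ik.1 == K)).
  apply/funext => ik; rewrite ltnS leq_eqVlt /ind.
  by case: ltngtP; rewrite ?mulr0 ?mulr1 ?addr0 ?add0r.
rewrite /Lsmooth /Lprime E.
rewrite (DserD pln_ge0 pln_finite plog_ge0 count_plog)//; try exact: bdd_plog.
by rewrite -E; exact: bdd_plog.
Qed.

(** The shift of exponents k to k + 1 maps the powers of one g-prime onto those with exponent at
    least 2: a geometric series, written as a fixed point equation. *)
Lemma LprimeE K t : Lprime K t =
  fpsC (ell K)%:C%C * fexp t (ell K) + fexp t (ell K) * Lprime K t.
Proof.
have sb : bdd plog (fun ik => if ik == (K, 1%N) then ell K else 0).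
  move=> ik; case: eqVneq => [->|_]; last by rewrite normr0 plog_ge0.
  by rewrite ger0_norm// ltW// ell_gt0.
have := Dser_single pln_ge0 pln_finite plog_ge0 count_plog t (isT : ppow (K, 1%N)) sb.
rewrite {2}/pln /= mul1r => <-.
have sinj : injective (fun ik : nat * nat => (ik.1, ik.2.+1)).
  by move=> [i k] [j l] [-> ->].
apply: (Dser_shift pln_ge0 pln_finite plog_ge0 count_plog t _ sb _ sinj).
- exact: bdd_plog.
- exact: bdd_plog.
- move=> [i k] /= _; rewrite /ind; case E : (i == K); rewrite ?mulr0 ?eqxx// => _.
  by move/eqP: E => ->; rewrite /pln /= -natr1 mulrDl mul1r.
- move=> [i k]; rewrite /ppow /= => k0 _; rewrite [X in _ - X](_ : _ = 0) ?subr0//.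
  by case: eqVneq => // -[_ kE]; rewrite kE in k0.
- move=> [i [//|[|k]]] _ /=; rewrite /plog /ind /=.
    rewrite xpair_eqE eqxx andbT; case E : (i == K); rewrite ?mulr0 ?subrr ?eqxx//.
    by move/eqP: E => ->; rewrite mulr1 subrr eqxx.
  rewrite (_ : ((i, k.+2) == (K, 1%N)) = false); last by apply/eqP => -[].
  rewrite subr0 => h; exists (i, k.+1) => //.
Qed.

Lemma Lsmooth_lim t : lims (fun X => Lsmooth (Num.truncn X) t) (Lser t).
Proof.
apply: (@lims_nat _ (Lsmooth^~ t)) => n e e0.
have [X0 H] := Dser_tail pln_ge0 pln_finite plog_ge0 count_plog n e0.
have [K0 HK] := ell_unbounded X0; exists K0 => K KK.
have E : plog = (fun ik => plog ik * ind (ik.1 < K)%N + plog ik * ind (K <= ik.1)%N).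
  apply/funext => ik; rewrite /ind; case: ltnP => _; rewrite ?mulr0 ?mulr1 ?addr0 ?add0r//.
have b1 := bdd_plog (fun ik => ik.1 < K)%N; have b2 := bdd_plog (fun ik => K <= ik.1)%N.
have b3 : bdd plog (fun ik => plog ik * ind (ik.1 < K)%N + plog ik * ind (K <= ik.1)%N).
  by rewrite -E => ik; rewrite ger0_norm// plog_ge0.
have -> : Lser t = Lsmooth K t + Dser ppow pln t (fun ik => plog ik * ind (K <= ik.1)%N).
  by rewrite /Lser {1}E (DserD pln_ge0 pln_finite plog_ge0 count_plog).
rewrite fpsDE opprD addrA subrr sub0r normcN; apply: H => // -[i k] /= k0 kX.
rewrite /ind; case: leqP => Ki; rewrite ?mulr0//; exfalso.
have : X0 < pln (i, k).
  apply: lt_le_trans (HK i (leq_trans KK Ki)) _; rewrite /pln /= ler_peMl ?ler1n//.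
  exact: ltW (ell_gt0 _).
by move=> /(le_lt_trans kX); rewrite ltxx.
Qed.

(** Logarithmic differentiation of the Euler product. [star] is the statement for the factors of
    index below [K], multiplied by [Zrough K t] and [Zser t] so that nothing is divided; in the
    limit [Zrough] tends to 1 and its derivative to 0. *)
Lemma fpsD_Zser t : fpsD (Zser t) = Lser t * Zser t.
Proof.
have star K : fpsD (Zser t) * Zrough K t =
    (Lsmooth K t * Zrough K t + fpsD (Zrough K t)) * Zser t.
  elim: K => [|K IH].
    have -> : Lsmooth 0 t = 0.
      have := LsmoothS 0 t; rewrite /Lsmooth => _.
      have E : (fun ik : nat * nat => plog ik * ind (ik.1 < 0)%N) = (fun=> 0).
        by apply/funext => ik; rewrite /ind /= mulr0.
      rewrite E; have b0 : bdd plog (fun=> 0) by move=> ik; rewrite normr0 plog_ge0.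
      apply: (lims_unique (Dser_lim pln_ge0 pln_finite plog_ge0 count_plog t b0)).
      apply: eq_lims (lims_cst _) => X; rewrite /psum big1// => x _.
      by apply/funext => n; rewrite fpsCM mul0r.
    by rewrite Zrough0; ring.
  have ZS := ZroughS K t; have LE := LprimeE K t; rewrite LsmoothS.
  set f := fexp t (ell K) in ZS LE; set l := fpsC (ell K)%:C%C in LE.
  have {}ZS : Zrough K.+1 t = (1 - f) * Zrough K t.
    by rewrite mulrBl mul1r [in X in _ = X - _]ZS; ring.
  have df : fpsD f = l * f by rewrite fpsD_fexp.
  have dZ : fpsD (Zrough K.+1 t) = (1 - f) * fpsD (Zrough K t) - l * f * Zrough K t.
    by rewrite ZS fpsDM fpsDD fpsDN fpsD1 df; ring.
  have LE' : Lprime K t * (1 - f) = l * f by rewrite mulrBr mulr1 {1}LE; ring.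
  rewrite dZ ZS.
  transitivity ((1 - f) * (fpsD (Zser t) * Zrough K t)); first by ring.
  rewrite IH.
  transitivity ((1 - f) * ((Lsmooth K t * Zrough K t + fpsD (Zrough K t)) * Zser t) +
    (Lprime K t * (1 - f) - l * f) * Zrough K t * Zser t); first by rewrite LE'; ring.
  ring.
have L1 := limsM (fpsD (Zser t)) (Zrough_lim t).
have L2 := limsMM (limsD (limsMM (Lsmooth_lim t) (Zrough_lim t)) (lims_D (Zrough_lim t)))
  (lims_cst (Zser t)).
rewrite !mulr1 fpsD1 addr0 in L1 L2.
by apply: lims_unique L1 _; apply: eq_lims L2 => X; rewrite star.
Qed.

Lemma normc_Zser_le t (k : nat) : normc (Zser t k) <= 6 * C1.
Proof.
apply: (Dser_le gln_ge0' gln_finite gone_ge0 count_gone) => m.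
by rewrite normr1.
Qed.

Lemma normc_Iser_le t (k : nat) : normc (Iser t k) <= 6 * C1.
Proof.
apply: (Dser_le gln_ge0' gln_finite gone_ge0 count_gone) => m.
exact: gmu_le1.
Qed.

Lemma normc_Lser_le t (k : nat) : normc (Lser t k) <= 6 * C2.
Proof.
apply: (Dser_le pln_ge0 pln_finite plog_ge0 count_plog) => ik.
by rewrite ger0_norm// plog_ge0.
Qed.

End GeneralizedIntegers.

(** * A Tauberian theorem with a Fejer kernel *)

Section Estimates.
Variable R : realType.
Implicit Types (x y u v t : R) (n M : nat).

Lemma inv_le_ln n : (n.+2%:R)^-1 <= ln (n.+2%:R) - ln (n.+1%:R) :> R.
Proof.
have n0 : 0 < n.+1%:R :> R by rewrite ltr0n.
have n1 : 0 < n.+2%:R :> R by rewrite ltr0n.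
have h : -1 < - (n.+2%:R)^-1 :> R by rewrite ltrN2 invf_lt1// ltr1n.
have := le_ln1Dx h.
have -> : 1 + - (n.+2%:R)^-1 = n.+1%:R / n.+2%:R :> R.
  rewrite -[X in X - _](@divff _ n.+2%:R) ?gt_eqF// -[_^-1 in X in _ - X]mul1r -mulrBl.
  by congr (_ / _); rewrite -(natr1 n.+1) addrK.
by rewrite ln_div ?posrE// => h'; rewrite -lerN2 opprB.
Qed.

Lemma harmonic_le M : \sum_(l < M.+1) (l.+1%:R)^-1 <= 1 + ln M.+1%:R :> R.
Proof.
elim: M => [|M IH]; first by rewrite big_ord1 invr1 ln1 addr0.
rewrite big_ord_recr /=; apply: le_trans (lerD IH (inv_le_ln M)) _.
by rewrite -addrA [ln _ + (_ - _)]addrC subrK.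
Qed.

(** The inequality N! <= e N (N / e)^N, by induction from (1 + 1/N)^(N+1) >= e. *)
Lemma fact_le_expn n : (n.+1)`!%:R <=
  expR 1 * n.+1%:R * n.+1%:R ^+ n.+1 * expR (- n.+1%:R) :> R.
Proof.
elim: n => [|n IH].
  by rewrite expr1 !mulr1 -expRD subrr expR0.
have n0 : 0 < n.+1%:R :> R by rewrite ltr0n.
have n1 : 0 < n.+2%:R :> R by rewrite ltr0n.
have key : expR 1 * n.+1%:R ^+ n.+2 <= n.+2%:R ^+ n.+2 :> R.
  have e1 (x : R) : 0 < x -> x ^+ n.+2 = expR (n.+2%:R * ln x).
    by move=> x0; rewrite expRM_natl lnK ?posrE.
  rewrite (e1 _ n0) (e1 _ n1) -expRD ler_expR -lerBrDr -mulrBr.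
  by rewrite mulrC -ler_pdivrMr// mul1r inv_le_ln.
rewrite factS natrM.
apply: (@le_trans _ _ (n.+2%:R * (expR 1 * n.+1%:R * n.+1%:R ^+ n.+1 * expR (- n.+1%:R)))).
  by rewrite ler_pM2l.
have -> : expR (- n.+2%:R) = expR (- n.+1%:R) / expR 1 :> R.
  by rewrite -expRN -expRD -(natr1 n.+1) opprD.
have e0 := expR_gt0 (1 : R).
have -> : n.+2%:R * (expR 1 * n.+1%:R * n.+1%:R ^+ n.+1 * expR (- n.+1%:R)) =
   n.+2%:R * expR (- n.+1%:R) * (expR 1 * n.+1%:R ^+ n.+2) :> R by rewrite [_ ^+ n.+2]exprS; ring.
have -> : expR 1 * n.+2%:R * n.+2%:R ^+ n.+2 * (expR (- n.+1%:R) / expR 1) =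
   n.+2%:R * expR (- n.+1%:R) * n.+2%:R ^+ n.+2 :> R by field; rewrite gt_eqF.
by rewrite ler_pM2l// mulr_gt0// expR_gt0.
Qed.

(* Stirling at the index maximizing [y ^+ n / n`!]. *)
Lemma fact_le y n : 1 <= y -> y <= n%:R <= y + 1 ->
  n`!%:R <= expR 3 * n%:R * y ^+ n * expR (- y).
Proof.
move=> y1 /andP[yn ny]; have y0 : 0 < y by exact: lt_le_trans y1.
case: n yn ny => [|n] yn ny; first by have := lt_le_trans y0 yn; rewrite ltxx.
set N := n.+1 in yn ny *; have N0 : 0 < N%:R :> R by rewrite ltr0n.
apply: le_trans (fact_le_expn n) _; rewrite -/N.
have h : N%:R ^+ N <= y ^+ N * expR 2.
  have -> : N%:R ^+ N = y ^+ N * (N%:R / y) ^+ N.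
    by rewrite -exprMn mulrC divfK// gt_eqF.
  rewrite ler_pM2l ?exprn_gt0//.
  apply: (@le_trans _ _ (expR (N%:R / y - 1) ^+ N)).
    apply: lerXn2r; rewrite ?nnegrE ?expR_ge0//; first by pos.
    by have := expR_ge1Dx (N%:R / y - 1); rewrite addrC subrK.
  rewrite -expRM_natl ler_expR.
  have -> : N%:R / y - 1 = (N%:R - y) / y by field; rewrite gt_eqF.
  rewrite mulrA ler_pdivrMr//.
  apply: (@le_trans _ _ (N%:R * 1)); first by rewrite ler_pM2l//; move: ny; lra.
  by move: ny y1; lra.
have e3 : expR 3 = expR 1 * expR 2 :> R by rewrite -expRD; congr expR; ring.
have eN : expR (- N%:R) <= expR (- y) by rewrite ler_expR lerN2.
rewrite e3.
apply: (@le_trans _ _ (expR 1 * N%:R * (y ^+ N * expR 2) * expR (- y))).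
  apply: ler_pM; [by pos| by rewrite expR_ge0| |exact: eN].
  by rewrite ler_pM2l// mulr_gt0// expR_gt0.
by rewrite le_eqVlt; apply/orP; left; apply/eqP; ring.
Qed.

Definition dirichlet_cos M y : R := \sum_(j < M) cos (j%:R * y).
Definition dirichlet_sin M y : R := \sum_(j < M) sin (j%:R * y).
(** The Fejer kernel without normalization, |1 + e^(iy) + ... + e^(i(M-1)y)|^2. As a square it is
    nonnegative; as the double sum of cosines [fejerE] it meets Laplace coefficients at points
    proportional to j - k. *)
Definition fejer M y := dirichlet_cos M y ^+ 2 + dirichlet_sin M y ^+ 2.

Lemma fejer_ge0 M y : 0 <= fejer M y.
Proof. by rewrite addr_ge0 ?sqr_ge0. Qed.

Lemma fejerE M y : fejer M y = \sum_(p : 'I_M * 'I_M) cos ((p.1%:R - p.2%:R) * y).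
Proof.
rewrite -(pair_big xpredT xpredT (fun j k : 'I_M => cos ((j%:R - k%:R) * y))) /=.
rewrite /fejer !expr2 /dirichlet_cos /dirichlet_sin !mulr_suml -big_split /=.
apply: eq_bigr => j _; rewrite !mulr_sumr -big_split /=; apply: eq_bigr => k _.
by rewrite mulrBl cosB.
Qed.

Lemma fejer_normc M y : fejer M y = normc (\sum_(j < M) cis y ^+ j) ^+ 2.
Proof.
rewrite normc2E Re_sum Im_sum /fejer /dirichlet_cos /dirichlet_sin.
by congr (_ ^+ 2 + _ ^+ 2); apply: eq_bigr => j _; rewrite cisX.
Qed.

Lemma fejer_le M y : fejer M y <= M%:R ^+ 2.
Proof.
rewrite fejer_normc lerXn2r ?nnegrE ?normc_nneg//.
apply: le_trans (normc_sum _ _ _) _.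
rewrite (_ : \sum_(i < M) _ = \sum_(i < M) 1); first by rewrite sumr_const card_ord.
by apply: eq_bigr => j _; rewrite normcX normc_cis expr1n.
Qed.

Lemma sin_ge_half y : 0 <= y <= 1 -> (forall x, 0 <= x <= 1 -> 2^-1 <= cos x) ->
  y / 2 <= sin y.
Proof.
move=> /andP[y0 y1] c1.
have cs : {within `[0, y], continuous (@sin R)}.
  by apply: continuous_subspaceT => x; exact: continuous_sin.
have [x] := MVT_segment y0 (fun x _ => is_derive_sin x) cs.
rewrite in_itv /= sin0 !subr0 => /andP[x0 xy] ->.
by rewrite mulrC ler_wpM2r// c1// x0 (le_trans xy).
Qed.

Lemma cos_ge_half y : `|y| <= 1 -> 2^-1 <= cos y.
Proof.
move=> y1.
have [s0 s1] : 0 <= y ^+ 2 /\ y ^+ 2 <= 1.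
  by rewrite sqr_ge0 -(real_normK (num_real y)) exprn_ile1.
have sle x : 0 <= x -> sin x <= x.
  move=> x0; have cs : {within `[0, x], continuous (@sin R)}.
    by apply: continuous_subspaceT => z; exact: continuous_sin.
  have [z] := MVT_segment x0 (fun z _ => is_derive_sin z) cs.
  by rewrite sin0 !subr0 => _ ->; rewrite ler_piMl// cos_le1.
have sq x : 0 <= x -> x <= 1 -> sin x ^+ 2 <= x ^+ 2.
  move=> x0 x1; rewrite lerXn2r ?nnegrE ?sle//.
  by apply: sin_ge0_pi; rewrite x0 (le_trans x1)// (le_trans _ (pi_ge2 R))// ler1n.
have -> : y = y / 2 + y / 2 by field.
rewrite cosD -!expr2 cos2sin2.
have h : sin (y / 2) ^+ 2 <= (y / 2) ^+ 2.
  rewrite -(real_normK (num_real (y / 2))) -(real_normK (num_real (sin (y / 2)))).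
  have -> : `|sin (y / 2)| = sin `|y / 2|.
    have z1 : 0 <= sin `|y / 2|.
      apply: sin_ge0_pi; rewrite normr_ge0 (le_trans _ (pi_ge2 R))//.
      by rewrite normrM; move: y1; rewrite (ger0_norm (_ : 0 <= 2^-1)) ?invr_ge0//; lra.
    have [y0|y0] := leP 0 (y / 2); first by move: z1; rewrite ger0_norm// => z1; rewrite ger0_norm.
    by move: z1; rewrite ltr0_norm// sinN => z1; rewrite ler0_norm// -oppr_ge0.
  by apply: sq => //; rewrite normrM (ger0_norm (_ : 0 <= 2^-1)) ?invr_ge0//; move: y1; lra.
have : (y / 2) ^+ 2 = y ^+ 2 / 4 by field.
by move: h s1; lra.
Qed.

Lemma fejer_near M y : (0 < M)%N -> `|y| <= M%:R^-1 -> M%:R ^+ 2 / 4 <= fejer M y.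
Proof.
move=> M0 yM; have M0' : 0 < M%:R :> R by rewrite ltr0n.
rewrite /fejer -[leLHS]addr0; apply: lerD; last exact: sqr_ge0.
have -> : M%:R ^+ 2 / 4 = (M%:R / 2) ^+ 2 :> R by field.
have h : M%:R / 2 <= dirichlet_cos M y.
  rewrite /dirichlet_cos mulr_natl -[M in _ *+ M]card_ord -sumr_const.
  apply: ler_sum => j _; apply: cos_ge_half.
  rewrite normrM ger0_norm//; apply: (@le_trans _ _ (M%:R * M%:R^-1)).
    by apply: ler_pM => //; rewrite ler_nat ltnW.
  by rewrite divff// gt_eqF.
have h0 : 0 <= M%:R / 2 :> R by pos.
by rewrite lerXn2r ?nnegrE// (le_trans h0).
Qed.

(** The kernel times |cis y - 1|^2 equals |cis (M y) - 1|^2, at most 4, and |cis y - 1| >= |y| / 2.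
    The restriction on [y] is there because the kernel is periodic and peaks again. *)
Lemma fejer_far M y : `|y| <= 1 -> fejer M y * y ^+ 2 <= 16.
Proof.
move=> y1.
have E : (cis y - 1) * \sum_(j < M) cis y ^+ j = cis y ^+ M - 1 by rewrite -subrX1.
have h1 : normc (cis y - 1) ^+ 2 * fejer M y <= 4.
  rewrite fejer_normc -exprMn -normcM E.
  have : normc (cis y ^+ M - 1) <= 2.
    by apply: le_trans (normcB _ _) _; rewrite normcX normc_cis expr1n normc1.
  move=> h; have -> : 4 = 2 ^+ 2 :> R by rewrite expr2; lra.
  by rewrite lerXn2r ?nnegrE ?normc_nneg.
have h2 : normc (cis y - 1) ^+ 2 = 2 - 2 * cos y.
  by rewrite normc2E /=; have := cos2Dsin2 y; lra.
have h3 : y ^+ 2 / 4 <= 2 - 2 * cos y.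
  have -> : cos y = cos (`|y| / 2 + `|y| / 2).
    rewrite -splitr; have [y0|y0] := leP 0 y; first by rewrite ger0_norm.
    by rewrite ltr0_norm// cosN.
  have a0 : 0 <= `|y| / 2 <= 1 by rewrite divr_ge0//=; move: y1; lra.
  have s0 := sin_ge_half a0.
  have c1 x : 0 <= x <= 1 -> `|x| <= 1 by move=> /andP[x0 ?]; rewrite ger0_norm.
  have s1 := s0 (fun x x01 => cos_ge_half (c1 x x01)).
  rewrite cosD -!expr2 cos2sin2.
  have : (`|y| / 2 / 2) ^+ 2 <= sin (`|y| / 2) ^+ 2.
    have h0 : 0 <= `|y| / 2 / 2 by pos.
    by rewrite lerXn2r ?nnegrE// (le_trans h0).
  have -> : (`|y| / 2 / 2) ^+ 2 = y ^+ 2 / 16.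
    by rewrite -(real_normK (num_real y)); field.
  lra.
have F0 := fejer_ge0 M y.
have : y ^+ 2 / 4 * fejer M y <= 4 by apply: le_trans h1; rewrite h2 ler_wpM2r.
lra.
Qed.

Local Notation mu := (@lebesgue_measure R).

(** Integration of the minorant: [gammaw 1 n] has mass 1 and [gammaw 2^-1 n] has mass 2^(n+1). *)
Lemma Rintegral_minorant g (A b1 b2 x1 x2 : R) n : decays g -> 0 <= x1 -> x1 <= x2 ->
  (forall v, 0 <= v ->
    A * \1_(`[x1, x2]%classic) v - (b1 * gammaw 1 n v + b2 * gammaw 2^-1 n v) <= g v) ->
  A * (x2 - x1) - (b1 + b2 * 2 ^+ n.+1) <= \int[mu]_(v in @halfline R) g v.
Proof.
move=> dg x10 x12 gle; pose J := `[x1, x2]%classic : set R.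
have mJ : measurable J by exact: measurable_itv.
have dJ : decays (\1_J : R -> R).
  apply: (@decaysW _ _ (expR x2) 1) => //.
  move=> v v0; rewrite indicE; have [vJ|_] := boolP (v \in J).
    rewrite normr1 -expRD mul1r -[leLHS]expR0 ler_expR subr_ge0.
    by move: vJ; rewrite /J inE /= in_itv /= => /andP[].
  by rewrite normr0 mulr_ge0 ?expR_ge0.
have i0 := decays_integrable dJ.
have i1 := decays_integrable (decaysZ A dJ).
have h0 : 0 < 2^-1 :> R by rewrite invr_gt0.
have j1 := @integrable_gammaw_cst R b1 1 n ltr01.
have j2 := @integrable_gammaw_cst R b2 2^-1 n h0.
have mH := @measurable_halfline R.
have j3 : mu.-integrable (@halfline R)
    (EFin \o (fun v => b1 * gammaw 1 n v + b2 * gammaw 2^-1 n v)).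
  by rewrite (_ : EFin \o _ = (EFin \o (fun v => (b1 * gammaw 1 n v)%R)) \+
    (EFin \o (fun v => (b2 * gammaw 2^-1 n v)%R)))%E//; exact: integrableD.
have -> : A * (x2 - x1) - (b1 + b2 * 2 ^+ n.+1) = \int[mu]_(v in @halfline R)
    (A * \1_J v - (b1 * gammaw 1 n v + b2 * gammaw 2^-1 n v)).
  have ij : \int[mu]_(v in @halfline R) (\1_J : R -> R) v = x2 - x1.
    rewrite /Rintegral integral_indic// setIidl; last first.
      by move=> v; rewrite /J /halfline /= !in_itv /= => /andP[xv _]; rewrite (le_trans x10).
    have jm : mu J = (x2 - x1)%:E.
      rewrite (lebesgue_measure_itv `[x1, x2]) /= lte_fin; have [//|h] := ltP x1 x2.
      by rewrite (le_anti (introT andP (conj x12 h))) subrr.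
    by rewrite [X in fine X](_ : _ = (x2 - x1)%:E)//; exact: jm.
  rewrite RintegralB// RintegralD// !RintegralZl ?ij ?Rintegral_gammaw//.
  - by rewrite invr1 expr1n mulr1 invrK.
  - exact: integrable_gammaw.
  - exact: integrable_gammaw.
apply: le_Rintegral => //.
- by rewrite (_ : EFin \o _ = (EFin \o (fun v => A * \1_J v)%R) \-
    (EFin \o (fun v => b1 * gammaw 1 n v + b2 * gammaw 2^-1 n v)%R))%E//; exact: integrableB.
- exact: decays_integrable.
- by move=> v; rewrite /halfline /= in_itv /= andbT; exact: gle.
Qed.

Lemma measurable_fejer M (del x0 : R) :
  measurable_fun setT (fun v => fejer M (del * (x0 - v))).
Proof.
rewrite (_ : (fun v => _) = (fun v => \sum_(p : 'I_M * 'I_M)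
   cos ((p.1%:R - p.2%:R) * (del * (x0 - v))))); last by apply/funext => v; rewrite fejerE.
apply: measurable_sum => p; apply: continuous_measurable_fun => v.
apply: (continuous_comp (f := fun v => (p.1%:R - p.2%:R) * (del * (x0 - v)))).
  apply: cvgMr; apply: cvgMr; apply: cvgB; [exact: cvg_cst|exact: cvg_id].
exact: continuous_cos.
Qed.

Lemma gammaw_expM a b n v : gammaw (a + b) n v = gammaw a n v * expR (- (b * v)).
Proof. by rewrite /gammaw mulrDl opprD expRD mulrA. Qed.

(** Three ranges. Within [eta / 2] of [x0] the integrand is nonnegative, and at least A / 4 at
    distance up to 1 / (M del); further out, as long as [|del * (x0 - v)| <= 1], the kernel is small
    by [fejer_far]; beyond that it may peak again, and only the decay of the weight helps. *)
Lemma fejer_window f (C0 : R) n M (del x0 eta A : R) :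
  expdom C0 1 f -> (0 < M)%N -> 0 < del -> 0 < eta ->
  (M%:R * del)^-1 <= eta / 2 -> eta / 2 <= x0 -> x0 <= del^-1 -> 0 <= A ->
  (forall v, `|v - x0| <= eta / 2 -> A <= f v * gammaw 2 n v) ->
  A / 4 * (2 * (M%:R * del)^-1) -
    (C0 * (64 / (M%:R * del * eta) ^+ 2) + C0 * expR (- (2^-1 * del^-1)) * 2 ^+ n.+1) <=
  \int[mu]_(v in @halfline R) (f v * gammaw 2 n v * (fejer M (del * (x0 - v)) / M%:R ^+ 2)).
Proof.
move=> fC M0 d0 e0 he ex xd A0 fA; set h := (M%:R * del)^-1 in he *.
have m0 : 0 < M%:R :> R by rewrite ltr0n.
have C00 := expdom_ge0 fC.
have h0 : 0 < h by rewrite invr_gt0 mulr_gt0.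
have x00 : h <= x0 by apply: le_trans ex.
have F0 v : 0 <= fejer M (del * (x0 - v)) / M%:R ^+ 2 by rewrite divr_ge0 ?fejer_ge0 ?exprn_ge0 ?ltW.
have F1 v : fejer M (del * (x0 - v)) / M%:R ^+ 2 <= 1.
  by rewrite ler_pdivrMr ?exprn_gt0// mul1r fejer_le.
have dg : decays (fun v => f v * gammaw 2 n v * (fejer M (del * (x0 - v)) / M%:R ^+ 2)).
  have mF : measurable_fun setT (fun v => fejer M (del * (x0 - v)) / M%:R ^+ 2).
    by apply: measurable_funM => //; exact: measurable_fejer.
  have b2 : 1 < 2 :> R by rewrite ltr1n.
  apply: (decays_kernel n fC b2 mF).
  by move=> v; rewrite ger0_norm.
have -> : 2 * h = (x0 + h) - (x0 - h) by ring.
apply: Rintegral_minorant => //; [by rewrite subr_ge0|by lra|].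
move=> v v0; set F := fejer _ _ / _.
have F0' : 0 <= F by exact: F0.
have F1' : F <= 1 by exact: F1.
have w1 : 0 <= gammaw 1 n v by exact: gammaw_ge0.
have w2 : 0 <= gammaw 2^-1 n v by exact: gammaw_ge0.
have b0 : 0 <= C0 * (64 / (M%:R * del * eta) ^+ 2) * gammaw 1 n v by pos.
have b1 : 0 <= C0 * expR (- (2^-1 * del^-1)) * gammaw 2^-1 n v by pos.
have [near|far] := leP `|v - x0| (eta / 2).
  have g0 := fA v near; rewrite indicE.
  have [vJ|_] := boolP (v \in _); rewrite ?mulr1; last first.
    rewrite mulr0; have : 0 <= f v * gammaw 2 n v * F by rewrite mulr_ge0// (le_trans A0).
    by move=> ?; lra.
  have : 4^-1 <= F.
    rewrite ler_pdivlMr ?exprn_gt0// mulrC; apply: fejer_near => //.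
    move: vJ; rewrite inE /= in_itv /= => /andP[v1 v2].
    rewrite normrM gtr0_norm// -ler_pdivlMl// mulrC -invfM ?unitfE//.
    by rewrite -/h ler_distlC; lra.
  by move=> h4; have : A * 4^-1 <= f v * gammaw 2 n v * F;
    [apply: ler_pM => //; rewrite invr_ge0|move=> ?; lra].
rewrite indicE (_ : v \in _ = false) ?mulr0; last first.
  apply/negbTE/negP; rewrite inE /= in_itv /= => /andP[v1 v2].
  have hh : `|v - x0| <= h by rewrite ler_distlC; apply/andP; split; lra.
  by move: (lt_le_trans far hh); rewrite ltNge he.
have fw : `|f v * gammaw 2 n v| <= C0 * gammaw 1 n v.
  have := @expdom_gammaw R C0 1 f (fun=> 1) n v fC.
  rewrite normr1 mulr1 (_ : 2 - 1 = 1 :> R); last by ring.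
  by apply.
have fF : `|f v * gammaw 2 n v * F| <= C0 * gammaw 1 n v * F.
  by rewrite normrM (ger0_norm F0') ler_wpM2r.
have := lerNnormlW fF.
have [near2|far2] := leP `|del * (x0 - v)| 1.
  have : F <= 64 / (M%:R * del * eta) ^+ 2.
    have y2 : (del * (eta / 2)) ^+ 2 <= (del * (x0 - v)) ^+ 2.
      rewrite -[leRHS](real_normK (num_real _)) lerXn2r ?nnegrE//; first by pos.
      by rewrite normrM gtr0_norm// ler_pM2l// distrC ltW.
    have yp : 0 < (del * (eta / 2)) ^+ 2 by pos.
    rewrite ler_pdivrMr ?exprn_gt0//.
    have -> : 64 / (M%:R * del * eta) ^+ 2 * M%:R ^+ 2 = 16 / (del * (eta / 2)) ^+ 2.
      by field; rewrite !gt_eqF.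
    rewrite ler_pdivlMr//; apply: le_trans (fejer_far M near2).
    by rewrite ler_wpM2l// fejer_ge0.
  move=> FF; have : C0 * gammaw 1 n v * F <= C0 * (64 / (M%:R * del * eta) ^+ 2) * gammaw 1 n v.
    by rewrite mulrAC ler_wpM2r// ler_wpM2l.
  by move=> ?; lra.
(* As [x0 <= del^-1], the remaining points all lie to the right. There half of the decay of
   [gammaw 1 n] is spent on the factor exp(-1 / (2 del)), which leaves [gammaw 2^-1 n]. *)
have vd : del^-1 < v.
  move: far2; rewrite normrM gtr0_norm// -ltr_pdivrMl// mulr1 distrC => far2.
  have [vx|vx] := leP x0 v; first by move: far2; rewrite ger0_norm ?subr_ge0//; lra.
  by move: far2; rewrite ltr0_norm ?subr_lt0//; lra.
have : C0 * gammaw 1 n v * F <= C0 * expR (- (2^-1 * del^-1)) * gammaw 2^-1 n v.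
  apply: (@le_trans _ _ (C0 * gammaw 1 n v)); first exact: (ler_piMr (mulr_ge0 C00 w1) F1').
  rewrite {1}(_ : 1 = 2^-1 + 2^-1 :> R); last by field.
  rewrite gammaw_expM mulrA mulrAC ler_wpM2r// ler_wpM2l// ler_expR lerN2.
  by rewrite ler_pM2l ?invr_gt0// ltW.
by lra.
Qed.

(** By [fejerE] each pair (j, k) contributes the real part of a Laplace coefficient at t = (j - k)
    del, turned by the phase of t x0. *)
Lemma Rintegral_fejer f (C0 : R) n M (del x0 : R) : expdom C0 1 f ->
  \int[mu]_(v in @halfline R) (f v * gammaw 2 n v * (fejer M (del * (x0 - v)) / M%:R ^+ 2)) <=
  (\sum_(p : 'I_M * 'I_M) normc (Gcoef ((p.1%:R - p.2%:R) * del) f n)) / M%:R ^+ 2.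
Proof.
move=> fC; pose t (p : 'I_M * 'I_M) := (p.1%:R - p.2%:R) * del.
pose ke p v := cos (t p * (x0 - v)).
have mk p : measurable_fun setT (ke p).
  apply: continuous_measurable_fun => v.
  apply: (continuous_comp (f := fun v => t p * (x0 - v))); last exact: continuous_cos.
  by apply: cvgMr; apply: cvgB; [exact: cvg_cst|exact: cvg_id].
have k1 p v : `|ke p v| <= 1 by rewrite cos_max.
have b2 : 1 < 2 :> R by rewrite ltr1n.
have dk (h : R -> R) : measurable_fun setT h -> (forall v, `|h v| <= 1) ->
  decays (fun v => f v * gammaw 2 n v * h v) by move=> mh h1; exact: decays_kernel fC b2 mh h1.
have -> : (fun v => f v * gammaw 2 n v * (fejer M (del * (x0 - v)) / M%:R ^+ 2)) =
   (fun v => \sum_(p : 'I_M * 'I_M) (M%:R ^- 2 * (f v * gammaw 2 n v * ke p v))).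
  apply/funext => v; rewrite fejerE [_ / _]mulrC mulrCA mulr_sumr mulr_sumr; apply: eq_bigr => p _.
  by rewrite /ke /t !mulrA.
have mH := @measurable_halfline R.
rewrite Rintegral_sum//; last by move=> p; exact: decays_integrable (decaysZ _ (dk _ (mk p) (k1 p))).
rewrite mulrC mulr_sumr; apply: ler_sum => p _.
rewrite RintegralZl//; last exact: decays_integrable (dk _ (mk p) (k1 p)).
rewrite ler_wpM2l ?invr_ge0 ?exprn_ge0//.
have dc := dk _ (measurable_kcos (t p)) (kcos_le1 (t p)).
have ds := dk _ (measurable_ksin (t p)) (ksin_le1 (t p)).
have -> : \int[mu]_(v in @halfline R) (f v * gammaw 2 n v * ke p v) =
    complex.Re (cis (t p * x0) * Gcoef (t p) f n).
  rewrite /= /kint -!RintegralZl//; [|exact: decays_integrable|exact: decays_integrable].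
  rewrite -RintegralB//; [|exact: decays_integrable (decaysZ _ dc)|exact: decays_integrable (decaysZ _ ds)].
  by apply: eq_Rintegral => v _; rewrite /ke mulrBr cosB /kcos /ksin; ring.
by apply: le_trans (ler_norm _) _; apply: le_trans (abs_Re_le _) _; rewrite normcM normc_cis mul1r.
Qed.

Lemma sum_inv_dist M (j : 'I_M.+1) :
  \sum_(k < M.+1) (1 + `|j%:R - k%:R|)^-1 <= 2 * (1 + ln M.+1%:R) :> R.
Proof.
pose H m : R := \sum_(0 <= l < m) (l.+1%:R)^-1.
have Hle m : (m <= M.+1)%N -> H m <= 1 + ln M.+1%:R.
  move=> mM; apply: le_trans (harmonic_le M); rewrite -(big_mkord xpredT (fun l => (l.+1%:R)^-1)).
  by rewrite (big_cat_nat (leq0n m) mM)/= lerDl sumr_ge0// => l _; rewrite invr_ge0.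
rewrite -(big_mkord xpredT (fun k => (1 + `|j%:R - k%:R|)^-1)).
rewrite (big_cat_nat (leq0n j) (ltnW (ltn_ord j)))/= mulr_natl mulr2n.
apply: lerD.
  apply: le_trans (Hle j (ltnW (ltn_ord j))); rewrite big_nat_rev /= /H !big_nat.
  apply: ler_sum => k /andP[_ kj]; rewrite add0n natrB; last by [].
  rewrite opprB [j%:R + _]addrC subrK ger0_norm ?ler0n//.
  by rewrite lef_pV2 ?posrE ?ltr0n// ?ltr_wpDr// lerDr.
rewrite -{1}[nat_of_ord j]add0n big_addn; apply: le_trans (Hle (M.+1 - j)%N (leq_subr _ _)).
apply: ler_sum => k _; rewrite natrD opprD addrCA subrr addr0 normrN ger0_norm ?ler0n//.
by rewrite -natr1 addrC.
Qed.

Lemma sum_fejer_decay M (del eps : R) : 0 < del -> del <= 1 -> 0 < eps ->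
  \sum_(p : 'I_M.+1 * 'I_M.+1)
    ((1 + `|(p.1%:R - p.2%:R) * del|) `^ eps / (1 + `|(p.1%:R - p.2%:R) * del|)) <=
  (1 + M.+1%:R) `^ eps * del^-1 * (M.+1%:R * (2 * (1 + ln M.+1%:R))).
Proof.
move=> d0 d1 e0.
have -> : M.+1%:R * (2 * (1 + ln M.+1%:R)) = \sum_(j < M.+1) (2 * (1 + ln M.+1%:R)) :> R.
  by rewrite sumr_const card_ord -[RHS]mulr_natl.
apply: (@le_trans _ _ ((1 + M.+1%:R) `^ eps * del^-1 *
    \sum_(j < M.+1) \sum_(k < M.+1) (1 + `|j%:R - k%:R|)^-1)); last first.
  rewrite ler_wpM2l ?mulr_ge0 ?powR_ge0 ?invr_ge0 ?(ltW d0)//.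
  by apply: ler_sum => j _; exact: sum_inv_dist.
rewrite pair_big mulr_sumr /=; apply: ler_sum => p _.
set x := `|p.1%:R - p.2%:R|; have x0 : 0 <= x by exact: normr_ge0.
have xM : x <= M.+1%:R.
  have h1 : p.1%:R <= M.+1%:R :> R by rewrite ler_nat ltnW.
  have h2 : p.2%:R <= M.+1%:R :> R by rewrite ler_nat ltnW.
  have h3 : 0 <= p.1%:R :> R by exact: ler0n.
  have h4 : 0 <= p.2%:R :> R by exact: ler0n.
  by rewrite /x ler_norml; apply/andP; split; lra.
rewrite normrM (gtr0_norm d0) -/x -mulrA; apply: ler_pM; rewrite ?powR_ge0 ?invr_ge0//.
- by rewrite addr_ge0 ?mulr_ge0// ltW.
- apply: ge0_ler_powR; rewrite ?nnegrE ?(ltW e0) ?addr_ge0 ?mulr_ge0 ?(ltW d0) ?ler0n//.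
  by rewrite lerD2l; apply: le_trans xM; rewrite ler_piMr.
- rewrite -invfM lef_pV2 ?posrE; [|by rewrite ltr_pwDl ?mulr_ge0// ltW|by rewrite mulr_gt0// ltr_pwDl].
  by rewrite mulrDr mulr1 [del * x]mulrC lerD2r.
Qed.

(** The factor 1 / (1 + |t|) brings the double sum over the grid from M^2 down to nearly M, which
    matches the width 1 / M of the kernel. *)
Definition saving r f := forall eps, 0 < eps -> exists2 C : R, 0 < C &
  forall t n, normc (Gcoef t f n) * r ^+ n <= C * ((1 + `|t|) `^ eps / (1 + `|t|)).

Lemma savingN r f (C0 : R) : expdom C0 1 f -> saving r f -> saving r (fun v => - f v).
Proof.
move=> fC sf eps e0; have [C C_gt0 h] := sf eps e0; exists C => // t n.
have b2 : 1 < 2 :> R by rewrite ltr1n.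
rewrite (_ : (fun v => - f v) = (fun v => -1 * f v)); last by apply/funext => v; rewrite mulN1r.
rewrite (GcoefZ t (-1) fC b2) fpsCM normcM normcR normrN1 mul1r; exact: h.
Qed.

(** Take [n] just above r u: then n! is about (r u)^n exp(-r u), and the weight at u about r^-n
    exp(-(2 - r) u). The constant exp 5 is exp 3 from [fact_le] times exp 2 from letting [v] go up
    to u + 1. *)
Lemma gammaw_peak r u : 1 < r -> r < 2 -> 10 <= u -> exists n, [/\ n%:R <= 2 * u + 1,
  r ^+ n <= expR (2 * u + 1), 0 < expR 5 * n%:R * r ^+ n * expR ((2 - r) * u) &
  forall v, u <= v -> v <= u + 1 ->
    (expR 5 * n%:R * r ^+ n * expR ((2 - r) * u))^-1 <= gammaw 2 n v].
Proof.
move=> r1 r2 u10; have u0 : 0 < u by lra.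
have r0 : 0 < r by lra.
have [n [n1 n2]] : exists n : nat, r * u <= n%:R /\ n%:R <= r * u + 1.
  have ru0 : 0 <= r * u by rewrite mulr_ge0// ltW.
  have /andP[h1 h2] := truncn_itv ru0; exists (Num.truncn (r * u)).+1.
  by split; [exact: ltW|rewrite -natr1 lerD2r].
have ru2 : r * u <= 2 * u by rewrite ler_pM2r// ltW.
have ru1 : u <= r * u by rewrite ler_peMl// ltW.
have n0 : 0 < n%:R :> R by lra.
have rn0 : 0 < r ^+ n by rewrite exprn_gt0.
have g0 := expR_gt0 ((2 - r) * u).
have p0 := expR_gt0 (5 : R).
exists n; split; [lra| |by rewrite !mulr_gt0|].
  apply: (@le_trans _ _ (expR 1 ^+ n)).
    have h := expR_ge1Dx (1 : R).
    by rewrite lerXn2r ?nnegrE ?expR_ge0 ?(ltW r0)//; lra.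
  by rewrite -expRM_natl ler_expR mulr1; lra.
move=> v uv vu; have f0 : 0 < n`!%:R :> R by rewrite ltr0n fact_gt0.
apply: (@le_trans _ _ (u ^+ n / n`!%:R * expR (- (2 * (u + 1))))); last first.
  apply: ler_pM; rewrite ?divr_ge0 ?exprn_ge0 ?expR_ge0 ?(ltW u0) ?(ltW f0)//.
    by rewrite ler_pM2r ?invr_gt0// lerXn2r ?nnegrE ?(ltW u0)// (le_trans (ltW u0)).
  by rewrite ler_expR lerN2 ler_pM2l.
have nf : n`!%:R <= expR 3 * n%:R * (r * u) ^+ n * expR (- (r * u)).
  by apply: fact_le; [lra|rewrite n1 n2].
rewrite invf_ple ?posrE ?mulr_gt0 ?divr_gt0 ?exprn_gt0 ?expR_gt0//.
rewrite invfM invfM invrK expRN invrK [_^-1 * _]mulrC.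
have -> : expR 5 * n%:R * r ^+ n * expR ((2 - r) * u) =
   expR 3 * n%:R * (r * u) ^+ n * expR (- (r * u)) / u ^+ n * expR (2 * (u + 1)).
  have -> : expR 5 = expR 3 * expR 2 :> R by rewrite -expRD; congr expR; ring.
  have -> : expR ((2 - r) * u) = expR (- (r * u)) * expR (2 * (u + 1)) / expR 2.
    by rewrite -expRN -!expRD; congr expR; ring.
  by rewrite exprMn; field; rewrite !gt_eqF ?exprn_gt0 ?expR_gt0.
by rewrite ler_pM2r ?expR_gt0// ler_pM2r// invr_gt0 exprn_gt0.
Qed.

Lemma expR_grid u : 0 <= u -> exists M : nat, expR u <= M.+1%:R /\ M.+1%:R <= 2 * expR u.
Proof.
move=> u0; have /andP[h1 h2] := truncn_itv (expR_ge0 u); exists (Num.truncn (expR u)).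
split; first exact: ltW.
have h3 : 1 <= expR u by rewrite -[leLHS]expR0 ler_expR.
have -> : 2 * expR u = expR u + expR u by ring.
by rewrite -(natr1 (Num.truncn _)) lerD.
Qed.

Lemma ln_grid a u M : 1 <= a * u -> M.+1%:R <= 2 * expR (a * u) -> 1 + ln M.+1%:R <= 3 * (a * u).
Proof.
move=> u1 M2; have : ln M.+1%:R <= ln (2 * expR (a * u)).
  by rewrite ler_ln ?posrE ?ltr0n// mulr_gt0// expR_gt0.
rewrite lnM ?posrE ?expR_gt0// expRK => h.
have : ln 2 <= 1 :> R.
  by have h1 := expR_ge1Dx (1 : R); rewrite -[leRHS]expRK ler_ln ?posrE ?expR_gt0//; lra.
by lra.
Qed.

Lemma powR_grid a u M eps : 0 <= a * u -> 0 < eps -> M.+1%:R <= 2 * expR (a * u) ->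
  (1 + M.+1%:R) `^ eps <= 3 `^ eps * expR (eps * a * u).
Proof.
move=> u0 e0 M2; have -> : expR (eps * a * u) = expR (a * u) `^ eps.
  by rewrite /powR gt_eqF ?expR_gt0// expRK mulrA.
rewrite -powRM ?expR_ge0//.
apply: ge0_ler_powR; rewrite ?nnegrE ?(ltW e0) ?addr_ge0 ?mulr_ge0 ?expR_ge0 ?ler0n//.
have h1 : 1 <= expR (a * u) by rewrite -[leLHS]expR0 ler_expR.
by move: h1 M2; clear; lra.
Qed.

(** [fejer_window] and [Rintegral_fejer] enclose the localized integral at the index of
    [gammaw_peak]. The lower bound D / W and the upper bound both carry r^-n; after cancellation D
    is at most exp((2 - r) u) up to a small exponent. *)
Lemma window f (C0 r th : R) : expdom C0 1 f -> 1 < r -> r < 2 -> saving r f -> 2 - r < th ->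
  exists2 B, 0 < B & forall u D, 10 <= u -> 0 <= D ->
  (forall v, u <= v -> v <= u + expR (- u) -> D <= f v) -> D <= B * expR (th * u).
Proof.
move=> fC r1 r2 sf rth; have C00 := expdom_ge0 fC.
pose kap := th - (2 - r); have k0 : 0 < kap by rewrite /kap subr_gt0.
(* With [M] near exp(5 u), M^eps is about exp(kap u / 2); the other half of [kap] absorbs the powers
   of [u]. *)
pose eps := kap / 10; have e0 : 0 < eps by rewrite /eps; pos.
have [C C_gt0 hC] := sf eps e0.
have k2 : 0 < kap / 2 by pos.
have [C5 [C5_gt0 h5]] : exists C5 : R, 0 < C5 /\ forall v, 0 <= v -> (1 + v) ^+ 2 <= C5 * expR (kap / 2 * v).
  by have [C5 ? ?] := poly_le_expR 2 k2; exists C5.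
pose K1 := C0 * (64 * 40 + expR 3); pose K2 := 60 * C * 3 `^ eps.
have r0 : 0 < r by lra.
have K10 : 0 <= K1 by rewrite /K1 mulr_ge0// addr_ge0// expR_ge0.
have K20 : 0 < K2 by rewrite /K2; (have p3 : 0 < 3 `^ eps :> R by exact: powR_gt0); pos.
exists (3 * expR 5 * (K1 * expR 1 + K2) * C5).
  have h1 : 0 < K1 * expR 1 + K2 by rewrite ltr_wpDl// mulr_ge0// expR_ge0.
  have h2 : 0 < expR 5 :> R := expR_gt0 _.
  by pos.
move=> u D u10 D0 fD.
have u0 : 0 < u by lra.
have [n [n2u rn]] := gammaw_peak r1 r2 u10; set W := expR 5 * n%:R * r ^+ n * expR ((2 - r) * u) => W0 gW.
have u5 : 0 <= 5 * u by rewrite mulr_ge0// ltW.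
(* For a window of width eta = exp(-u), this resolution makes the error 1 / (M eta^2) at most exp(-3
   u), negligible against r^-n since r^n <= exp(2 u + 1). *)
have [M [M1 M2]] := expR_grid u5.
(* Spacing so small that the far error exp(-10 u) 2^(n+1), even multiplied by [M], is again of order
   exp(-3 u). *)
pose del := (20 * u)^-1; have d0 : 0 < del by rewrite /del; pos.
have d1 : del <= 1 by rewrite /del invf_le1; lra.
pose eta := expR (- u); have eta0 : 0 < eta := expR_gt0 _.
have eta1 : eta <= 1 by rewrite /eta -expR0 ler_expR; lra.
pose x0 := u + eta / 2.
pose w := W^-1; have w0 : 0 < w by rewrite invr_gt0.
have m0 : 0 < M.+1%:R :> R by rewrite ltr0n.
have Mdel : (M.+1%:R * del)^-1 = 20 * u / M.+1%:R by rewrite /del invfM invrK mulrC.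
have expu : expR (5 * u) = expR (2 * u) ^+ 2 * expR u.
  by rewrite expr2 -!expRD; congr expR; ring.
have he : (M.+1%:R * del)^-1 <= eta / 2.
  rewrite Mdel ler_pdivrMr// /eta expRN mulrAC -mulrA ler_pdivlMl ?expR_gt0//.
  apply: (@le_trans _ _ (expR (5 * u) / 2)); last by rewrite ler_pM2r ?invr_gt0.
  rewrite expu mulrAC [leRHS]mulrC ler_pM2l ?expR_gt0//.
  have := expR_ge1Dx (2 * u) => h; have : (2 * u) ^+ 2 <= expR (2 * u) ^+ 2.
    by rewrite lerXn2r ?nnegrE ?expR_ge0//; lra.
  by nra.
have xd : x0 <= del^-1 by rewrite /del invrK /x0; lra.
have A0 : 0 <= D * w by rewrite mulr_ge0// ltW.
have fA v : `|v - x0| <= eta / 2 -> D * w <= f v * gammaw 2 n v.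
  rewrite ler_distlC /x0 => /andP[v1 v2].
  clear -u0 D0 fD gW w0 v1 v2 eta1 eta0.
  apply: ler_pM; rewrite ?(ltW w0)//; first by apply: fD; rewrite -/eta; lra.
  by apply: gW; lra.
have ex : eta / 2 <= x0 by rewrite /x0; lra.
have F := le_trans (fejer_window fC (ltn0Sn M) d0 eta0 he ex xd A0 fA) (Rintegral_fejer n M.+1 del x0 fC).
have rn0 : 0 < r ^+ n by rewrite exprn_gt0.
have S : \sum_(p : 'I_M.+1 * 'I_M.+1) normc (Gcoef ((p.1%:R - p.2%:R) * del) f n) <=
    C / r ^+ n * ((1 + M.+1%:R) `^ eps * del^-1 * (M.+1%:R * (2 * (1 + ln M.+1%:R)))).
  apply: le_trans (ler_wpM2l _ (sum_fejer_decay M d0 d1 e0)); last by rewrite divr_ge0 ?ltW.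
  rewrite mulr_sumr; apply: ler_sum => p _.
  by rewrite mulrAC ler_pdivlMr//; exact: hC.
have P1 : (1 + M.+1%:R) `^ eps <= 3 `^ eps * expR (kap / 2 * u).
  have -> : kap / 2 = eps * 5 by rewrite /eps; field.
  exact: powR_grid.
have u51 : 1 <= 5 * u by clear -u10; lra.
have P2 : 1 + ln M.+1%:R <= 15 * u.
  by apply: le_trans (ln_grid u51 M2) _; rewrite mulrA -natrM.
have Abound : D * w <= K1 * u * expR (- (3 * u)) + K2 * u * expR (kap / 2 * u) / r ^+ n.
  have F2 := le_trans F (ler_wpM2r _ S); have {F2} F2 := F2 (ltac:(by rewrite invr_ge0 exprn_ge0// ltW)).
  have c0 : 0 <= M.+1%:R / (10 * u) by rewrite divr_ge0 ?(ltW m0)// mulr_ge0// ltW.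
  have := ler_wpM2r c0 F2; rewrite Mdel /del !invrK.
  set m := M.+1%:R in m0 M1 M2 P1 P2 *; set P := _ `^ _ in P1 *; set L := 1 + ln m in P2 *.
  have q1 : C0 * (64 / (m / (20 * u) * eta) ^+ 2) * (m / (10 * u)) <= C0 * (64 * 40) * u * expR (- (3 * u)).
    have -> : C0 * (64 / (m / (20 * u) * eta) ^+ 2) * (m / (10 * u)) = C0 * (64 * 40) * u * (m * eta ^+ 2)^-1.
      by field; rewrite !gt_eqF.
    have E5 : expR (3 * u) = expR (5 * u) * eta ^+ 2.
      by rewrite /eta expr2 -!expRD; congr expR; ring.
    rewrite ler_wpM2l//; first by rewrite !mulr_ge0// ltW.
    rewrite expRN lef_pV2 ?posrE ?expR_gt0//; last by rewrite mulr_gt0// exprn_gt0.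
    by rewrite E5 ler_pM2r// exprn_gt0.
  have q2 : C0 * expR (- (2^-1 * (20 * u))) * 2 ^+ n.+1 * (m / (10 * u)) <= C0 * expR 3 * u * expR (- (3 * u)).
    have h1 : 2 ^+ n.+1 <= expR (2 * u + 2).
      apply: (@le_trans _ _ (expR 1 ^+ n.+1)).
        by have h0 := expR_ge1Dx (1 : R); rewrite lerXn2r ?nnegrE ?expR_ge0//; clear -h0; lra.
      by rewrite -expRM_natl ler_expR mulr1 -natr1; clear -n2u; lra.
    have h2 : m / (10 * u) <= expR (5 * u).
      rewrite ler_pdivrMr; last by clear -u0; lra.
      apply: le_trans M2 _; by rewrite mulrC ler_pM2l ?expR_gt0//; clear -u10; lra.
    set T := 2 ^+ n.+1 in h1 *; have T0 : 0 <= T by rewrite exprn_ge0.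
    clearbody T; have h3 : T * (m / (10 * u)) <= expR (2 * u + 2) * expR (5 * u).
      by apply: ler_pM.
    rewrite -!mulrA ler_wpM2l//.
    apply: le_trans (ler_wpM2l (expR_ge0 _) h3) _.
    apply: (@le_trans _ _ (expR 3 * (1 * expR (- (3 * u))))); last first.
      by rewrite ler_pM2l ?expR_gt0// ler_pM2r ?expR_gt0//; clear -u10; lra.
    by rewrite mul1r -!expRD ler_expR; clear -u10; lra.
  have q3 : C / r ^+ n * (P * (20 * u) * (m * (2 * L))) / m ^+ 2 * (m / (10 * u)) <=
      K2 * u * expR (kap / 2 * u) / r ^+ n.
    have -> : C / r ^+ n * (P * (20 * u) * (m * (2 * L))) / m ^+ 2 * (m / (10 * u)) =
        4 * C * (P * L) / r ^+ n by field; rewrite !gt_eqF.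
    rewrite ler_pM2r ?invr_gt0//.
    have L0 : 0 <= L.
      by rewrite addr_ge0// ln_ge0// (le_trans _ M1)// -[leLHS]expR0 ler_expR.
    have h1 : P * L <= 3 `^ eps * expR (kap / 2 * u) * (15 * u).
      by apply: ler_pM => //; exact: powR_ge0.
    have C4 : 0 <= 4 * C by rewrite mulr_ge0// ltW.
    apply: le_trans (ler_wpM2l C4 h1) _.
    by rewrite le_eqVlt; apply/orP; left; apply/eqP; rewrite /K2; ring.
  rewrite mulrBl [(_ + _) * (m / _)]mulrDl.
  have -> : D * w / 4 * (2 * (20 * u / m)) * (m / (10 * u)) = D * w by field; rewrite !gt_eqF.
  have -> : K1 * u * expR (- (3 * u)) = C0 * (64 * 40) * u * expR (- (3 * u)) +
     C0 * expR 3 * u * expR (- (3 * u)) by rewrite /K1; ring.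
  by move=> H; apply: le_trans (lerD (lerD q1 q2) q3); rewrite -lerBlDl.
have {}rn : r ^+ n * expR (- (3 * u)) <= expR 1.
  apply: le_trans (ler_wpM2r (expR_ge0 _) rn) _.
  by rewrite -expRD ler_expR; clear -u10; lra.
have wi : w^-1 <= W by rewrite /w invrK.
have DA : D = D * w * w^-1 by rewrite mulfK// gt_eqF.
rewrite [leLHS]DA.
have n3 : n%:R <= 3 * u by clear -n2u u10; lra.
set E := expR (kap / 2 * u) in Abound *.
have E1 : 1 <= E by rewrite -[leLHS]expR0 ler_expR mulr_ge0 ?(ltW k2) ?(ltW u0).
have E0 : 0 < E := lt_le_trans ltr01 E1.
have g0 := expR_gt0 ((2 - r) * u).
have p0 := expR_gt0 (5 : R).
have u2 : u ^+ 2 <= C5 * E.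
  apply: le_trans (h5 u (ltW u0)); by rewrite lerXn2r ?nnegrE ?addr_ge0 ?(ltW u0)// lerDr.
have w'0 : 0 <= w^-1 by rewrite invr_ge0 ltW.
have R0 : 0 <= K1 * u * expR (- (3 * u)) + K2 * u * E / r ^+ n by apply: le_trans Abound.
apply: le_trans (ler_pM A0 w'0 Abound wi) _; rewrite /W.
have -> : (K1 * u * expR (- (3 * u)) + K2 * u * E / r ^+ n) *
    (expR 5 * n%:R * r ^+ n * expR ((2 - r) * u)) =
    expR 5 * expR ((2 - r) * u) * (n%:R * u * (K1 * (r ^+ n * expR (- (3 * u))) + K2 * E)).
  by field; rewrite gt_eqF.
have -> : expR (th * u) = expR ((2 - r) * u) * (E * E).
  by rewrite /E -!expRD /kap; congr expR; field.
have -> : 3 * expR 5 * (K1 * expR 1 + K2) * C5 * (expR ((2 - r) * u) * (E * E)) =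
   expR 5 * expR ((2 - r) * u) * (3 * (C5 * E) * ((K1 * expR 1 + K2) * E)) by ring.
rewrite ler_pM2l; last by rewrite mulr_gt0.
apply: ler_pM.
- by rewrite mulr_ge0// ltW.
- by rewrite addr_ge0// mulr_ge0 ?(ltW K20) ?(ltW E0)// mulr_ge0 ?expR_ge0// ltW.
- apply: (@le_trans _ _ (3 * u * u)); first by rewrite ler_pM2r.
  by rewrite -mulrA -expr2 ler_pM2l.
- rewrite [leRHS]mulrDl lerD2r -mulrA ler_wpM2l//; apply: le_trans rn _.
  by rewrite ler_peMr// expR_ge0.
Qed.

(** A large f u forces f to be large just to the right of u, a very negative f u forces it to be
    very negative just to the left; [window] applies to f, respectively to -f. Over a length of
    order exp(-u) the function [expR] varies by O(1), so the hypothesis allows a loss of at most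
    [Q * expR (th * u)]. *)
Lemma tauberian f (C0 r th K : R) : expdom C0 1 f -> 1 < r -> r < 2 -> saving r f ->
  2 - r < th -> 0 <= K ->
  (forall u v, 0 <= u -> u <= v -> v <= u + 1 ->
    f u - f v <= K * (expR v - expR u) + K * expR (th * v)) ->
  exists2 B, 0 < B & forall u, 11 <= u -> `|f u| <= B * expR (th * u).
Proof.
move=> fC r1 r2 sf rth K0 mono.
have [B1 B10 h1] := window fC r1 r2 sf rth.
have fN : expdom C0 1 (fun v => - f v).
  by split; [exact: measurableT_comp (fC.1)|move=> v v0; rewrite normrN; exact: fC.2].
have [B2 B20 h2] := window fN r1 r2 (savingN fC sf) rth.
have th0 : 0 < th by lra.
pose Q := K * expR 1 + K * expR th; have Q0 : 0 <= Q by rewrite addr_ge0// mulr_ge0// expR_ge0.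
exists (B1 + B2 + Q); first by lra.
move=> u u11.
have diff x y z : x <= y -> y <= x + z -> 0 <= z -> expR y - expR x <= expR y * z.
  move=> xy yz z0; have -> : expR x = expR y * expR (x - y) by rewrite -expRD addrC subrK.
  rewrite -{1}[expR y]mulr1 -mulrBr ler_pM2l ?expR_gt0//.
  by have := expR_ge1Dx (x - y); lra.
have E1 : expR (- u) <= 1 by rewrite -expR0 ler_expR; lra.
have T1 : 1 <= expR (th * u) by rewrite -[leLHS]expR0 ler_expR mulr_ge0; lra.
have key x : 0 <= x -> x - Q * expR (th * u) <= Num.max B1 B2 * expR (th * u) ->
    x <= (B1 + B2 + Q) * expR (th * u).
  move=> x0 h; have : Num.max B1 B2 <= B1 + B2 by rewrite ge_max; apply/andP; split; lra.
  move=> hm; have := ler_wpM2r (expR_ge0 (th * u)) hm; lra.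
rewrite ler_norml; apply/andP; split.
  rewrite lerNl; have [fu|fu] := leP (- f u) (Q * expR (th * u)).
    apply: le_trans fu _; rewrite ler_wpM2r ?expR_ge0//; lra.
  (* The window must end at [u] or before: [u' >= u - 1], so its length exp(-u') is at most exp(1 -
     u). Starting from [11 <= u] keeps [10 <= u']. *)
  pose u' := u - expR (1 - u).
  have e1 : expR (1 - u) <= 1 by rewrite -[leRHS]expR0 ler_expR; lra.
  have e0 := expR_gt0 (1 - u).
  have e' : expR (- u') <= expR (1 - u) by rewrite ler_expR /u'; lra.
  have := h2 u' (- f u - Q * expR (th * u)).
  have -> : 10 <= u' by rewrite /u'; lra.
  move=> /(_ isT); rewrite subr_ge0 (ltW fu) => /(_ isT).
  have H v : u' <= v -> v <= u' + expR (- u') -> - f u - Q * expR (th * u) <= - f v.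
    move=> v1 v2; have vu : v <= u by move: v2; rewrite /u' in e' *; lra.
    have m := mono v u (ltac:(rewrite /u' in v1; lra)) vu (ltac:(rewrite /u' in v1; lra)).
    have d := diff v u (expR (1 - u)) vu (ltac:(rewrite /u' in v1; lra)) (ltW e0).
    have -> : - f v = - f u - (f v - f u) by ring.
    rewrite lerD2l lerN2; apply: le_trans m _.
    have eu : expR u * expR (1 - u) = expR 1 by rewrite -expRD addrC subrK.
    rewrite eu in d; have := ler_wpM2l K0 d => d'.
    rewrite /Q mulrDl; apply: lerD.
      by apply: le_trans d' _; rewrite -[leLHS]mulr1 ler_wpM2l// mulr_ge0// expR_ge0.
    rewrite ler_wpM2r ?expR_ge0// -[leLHS]mulr1 ler_wpM2l// -[leLHS]expR0 ler_expR; exact: ltW.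
  move=> /(_ H) h; apply: key; first by apply: le_trans (ltW fu); rewrite mulr_ge0// expR_ge0.
  apply: le_trans h _; apply: (@le_trans _ _ (B2 * expR (th * u))).
    by rewrite ler_wpM2l ?(ltW B20)// ler_expR ler_pM2l// /u'; lra.
  by rewrite ler_wpM2r ?expR_ge0// le_max lexx orbT.
have [fu|fu] := leP (f u) (Q * expR (th * u)).
  apply: le_trans fu _; rewrite ler_wpM2r ?expR_ge0//; lra.
have := h1 u (f u - Q * expR (th * u)).
have -> : 10 <= u by lra.
move=> /(_ isT); rewrite subr_ge0 (ltW fu) => /(_ isT).
have H v : u <= v -> v <= u + expR (- u) -> f u - Q * expR (th * u) <= f v.
  move=> v1 v2; have m := mono u v (ltac:(lra)) v1 (ltac:(lra)).
  have d := diff u v (expR (- u)) v1 v2 (expR_ge0 _).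
  have d2 : expR v * expR (- u) <= expR 1 by rewrite -expRD ler_expR; lra.
  have -> : f v = f u - (f u - f v) by ring.
  rewrite lerD2l lerN2; apply: le_trans m _.
  have := ler_wpM2l K0 (le_trans d d2) => d'.
  rewrite /Q mulrDl; apply: lerD.
    by apply: le_trans d' _; rewrite -[leLHS]mulr1 ler_wpM2l// mulr_ge0// expR_ge0.
  rewrite -mulrA ler_wpM2l// -expRD ler_expR.
  by have -> : th + th * u = th * (u + 1); [ring|rewrite ler_pM2l//; lra].
move=> /(_ H) h; apply: key; first by apply: le_trans (ltW fu); rewrite mulr_ge0// expR_ge0.
apply: le_trans h _.
by rewrite ler_wpM2r ?expR_ge0// le_max lexx.
Qed.

End Estimates.

(** * The mean value argument *)

(** Pairs with |j - k| < 2, where the pole at s = 1 is near and only the bound [B] is available, are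
    counted through 3 / (1 + |j - k|) >= 1, at the cost of a logarithm. *)
Lemma grid_energy (R : realType) M (be1 B : R) : 0 < be1 -> 0 < B ->
  \sum_(p : 'I_M.+1 * 'I_M.+1)
    (if 2 <= `|p.1%:R - p.2%:R : R| then be1 else B) ^+ 2 <=
  M.+1%:R ^+ 2 * be1 ^+ 2 + 6 * B ^+ 2 * M.+1%:R * (1 + ln M.+1%:R).
Proof.
move=> be0 B0.
apply: (@le_trans _ _ (\sum_(p : 'I_M.+1 * 'I_M.+1)
    (be1 ^+ 2 + 3 * B ^+ 2 * (1 + `|p.1%:R - p.2%:R|)^-1))).
  apply: ler_sum => p _; set x := `|_|; have x0 : 0 <= x by exact: normr_ge0.
  have q1 : 0 <= be1 ^+ 2 by exact: sqr_ge0.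
  have q2 : 0 <= B ^+ 2 by exact: sqr_ge0.
  case: ifPn => [_|]; first by rewrite lerDl divr_ge0 ?mulr_ge0 ?addr_ge0 ?(ltW B0).
  rewrite -ltNge => x2; rewrite -[leLHS]add0r; apply: lerD => //.
  rewrite [3 * _]mulrC -mulrA ler_peMr// ler_pdivlMr ?mul1r; lra.
rewrite big_split /= sumr_const card_prod card_ord -[X in X + _]mulr_natl natrM -expr2 lerD2l -mulr_sumr.
have -> : 6 * B ^+ 2 * M.+1%:R * (1 + ln M.+1%:R) =
  3 * B ^+ 2 * \sum_(j < M.+1) (2 * (1 + ln M.+1%:R)).
  by rewrite sumr_const card_ord -[X in _ = _ * X]mulr_natl; ring.
rewrite ler_wpM2l ?mulr_ge0 ?(ltW B0)//.
rewrite -(pair_big xpredT xpredT (fun j k : 'I_M.+1 => (1 + `|j%:R - k%:R|)^-1)) /=.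
by apply: ler_sum => j _; exact: sum_inv_dist.
Qed.

Section MeanValue.
Variables (R : realType) (T : choiceType) (D : pred T) (lam b : T -> R) (Cb : R).
Local Notation nc := (@normc R).
Implicit Types (t u v X : R) (x : T) (n M : nat).
Hypothesis lam_ge0 : forall x, D x -> 0 <= lam x.
Hypothesis lev_finite : forall X, finite_set [set x | D x /\ lam x <= X].
Hypothesis b_ge0 : forall x, 0 <= b x.
Hypothesis bC : forall v, 0 <= v -> countle D lam b v <= Cb * expR v.

Local Notation lev := (lev D lam).

(** Summed over the grid, the phases of the pair (x, y) form a Fejer kernel at [lam x - lam y]. All
    off-diagonal terms are therefore nonnegative and are dropped, with no estimate of the gaps. *)
Lemma psum_energy M n X :
  M%:R ^+ 2 * \sum_(x <- lev X) (b x * gammaw 2 n (lam x)) ^+ 2 <=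
  \sum_(p : 'I_M * 'I_M) nc (psum D lam (p.1%:R - p.2%:R) b X n) ^+ 2.
Proof.
pose A x := b x * gammaw 2 n (lam x).
have A0 x : x \in lev X -> 0 <= A x.
  by move=> xX; rewrite mulr_ge0// gammaw_ge0// (mem_lev_ge0 lam_ge0 lev_finite xX).
have E t : nc (psum D lam t b X n) ^+ 2 =
    \sum_(x <- lev X) \sum_(y <- lev X) A x * A y * cos (t * (lam x - lam y)).
  rewrite psumE normc2E Re_sum Im_sum !expr2 !mulr_suml -big_split /=.
  apply: eq_bigr => x _; rewrite !mulr_sumr -big_split /=; apply: eq_bigr => y _.
  by rewrite /A !cosN !sinN [in RHS]mulrBr cosB; ring.
rewrite (eq_bigr _ (fun p _ => E _)) exchange_big /= mulr_sumr big_seq [leRHS]big_seq.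
apply: ler_sum => x xX; rewrite exchange_big /=.
rewrite (bigD1_seq x) ?fset_uniq//= subrr -[leLHS]addr0; apply: lerD.
  rewrite (eq_bigr (fun=> A x * A x)); last by move=> p _; rewrite mulr0 cos0 mulr1.
  by rewrite sumr_const card_prod card_ord -[leRHS]mulr_natl natrM -!expr2.
rewrite big_seq_cond; apply: sumr_ge0 => y /andP[yX _].
by rewrite -mulr_sumr -fejerE; exact: mulr_ge0 (mulr_ge0 (A0 _ xX) (A0 _ yX)) (fejer_ge0 _ _).
Qed.

(** A cut [Y] beyond [X] only adds squares, and can be taken so large that at all the finitely many
    grid points the partial sum is within [bet p] of the series; the 4 is the square of the
    resulting factor 2. *)
Lemma mean_square_le M n X (bet : 'I_M * 'I_M -> R) :
  (forall p, 0 < bet p) ->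
  (forall p : 'I_M * 'I_M, nc (Dser D lam (p.1%:R - p.2%:R) b n) <= bet p) ->
  M%:R ^+ 2 * \sum_(x <- lev X) (b x * gammaw 2 n (lam x)) ^+ 2 <=
  4 * \sum_p bet p ^+ 2.
Proof.
move=> bet0 betP.
have [Y XY] : exists2 Y, X <= Y & forall p : 'I_M * 'I_M,
    nc (psum D lam (p.1%:R - p.2%:R) b Y n) <= 2 * bet p.
  suff [Y0 H] : exists Y0, forall Y, Y0 <= Y -> forall p : 'I_M * 'I_M, p \in enum predT ->
      nc (psum D lam (p.1%:R - p.2%:R) b Y n) <= 2 * bet p.
    exists (Num.max X Y0); first by rewrite le_max lexx.
    by move=> p; apply: H; rewrite ?le_max ?lexx ?orbT// mem_enum.
  elim: (enum _) => [|p s [Y1 IH]]; first by exists 0.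
  have [Y2 H2] := Dser_lim lam_ge0 lev_finite b_ge0 bC (p.1%:R - p.2%:R) (bdd_b b_ge0) n (bet0 p).
  exists (Num.max Y1 Y2) => Y; rewrite ge_max => /andP[h1 h2] q; rewrite inE => /orP[/eqP->|]; last exact: IH.
  rewrite -(subrK (Dser D lam (p.1%:R - p.2%:R) b n) (psum _ _ _ _ _ _)).
  apply: le_trans (normcD _ _) _; rewrite mulr_natl mulr2n; apply: lerD => //; exact: H2.
move=> YP; apply: (@le_trans _ _ (M%:R ^+ 2 * \sum_(x <- lev Y) (b x * gammaw 2 n (lam x)) ^+ 2)).
  rewrite ler_wpM2l ?exprn_ge0// -(sum_lev_le lev_finite _ XY).
  by rewrite [leRHS](bigID (fun x => lam x <= X))/= lerDl sumr_ge0// => x _; exact: sqr_ge0.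
apply: le_trans (psum_energy M n Y) _; rewrite mulr_sumr; apply: ler_sum => p _.
have -> : 4 * bet p ^+ 2 = (2 * bet p) ^+ 2 by ring.
by rewrite lerXn2r ?nnegrE ?normc_nneg ?mulr_ge0 ?(ltW (bet0 p)).
Qed.

Hypothesis b1 : forall x, b x = 1.

Lemma energy_ge n u W : 0 < W -> (forall v, u <= v -> v <= u + 1 -> W^-1 <= gammaw 2 n v) ->
  (countle D lam b (u + 1) - countle D lam b u) / W ^+ 2 <=
  \sum_(x <- lev (u + 1)) (b x * gammaw 2 n (lam x)) ^+ 2.
Proof.
move=> W0 gW; have u1 : u <= u + 1 by rewrite lerDl.
rewrite /countle -(sum_lev_le lev_finite b u1) [X in (X - _) / _](bigID (fun x => lam x <= u))/=.
rewrite addrAC subrr add0r [leRHS](bigID (fun x => lam x <= u))/= -[leLHS]add0r.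
apply: lerD; first by apply: sumr_ge0 => x _; exact: sqr_ge0.
rewrite mulr_suml big_seq_cond [leRHS]big_seq_cond; apply: ler_sum => x /andP[].
rewrite mem_lev// => /andP[_ xu] ux; rewrite b1 !mul1r -exprVn.
by rewrite lerXn2r ?nnegrE ?invr_ge0 ?(ltW W0) ?gW ?(le_trans _ (gW _ _ _))//
  ?invr_ge0 ?(ltW W0)// ltW// ltNge.
Qed.

End MeanValue.

(** At the index of [gammaw_peak] the points between u and u + 1 contribute at least about exp(u)
    W^-2, where W is near r^n exp((2 - r) u), while the mean square is about r^(-2n). Thus exp((2 r
    - 3) u) would be bounded up to small exponents, which is impossible for r > 3/2. *)
Lemma mean_value (R : realType) (T : choiceType) (D : pred T) (lam b : T -> R) (Cb r B c u0 : R) :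
  (forall x, D x -> 0 <= lam x) -> (forall X, finite_set [set x | D x /\ lam x <= X]) ->
  (forall v, 0 <= v -> countle D lam b v <= Cb * expR v) -> (forall x, b x = 1) -> 3 / 2 < r -> r < 2 -> 0 < B -> 0 < c ->
  (forall t n, normc (Dser D lam t b n) <= B) ->
  (forall eps, 0 < eps -> exists2 C : R, 0 < C & forall t n, 2 <= `|t| ->
    normc (Dser D lam t b n) * r ^+ n <= C * n.+1%:R * (1 + `|t|) `^ eps) ->
  (forall u, u0 <= u -> c * expR u <= countle D lam b (u + 1) - countle D lam b u) ->
  False.
Proof.
move=> lam_ge0 lev_finite bC b1 r32 r2 B0 c0 DB Dsav cnt.
have b_ge0 x : 0 <= b x by rewrite b1.
pose kap := 2 * r - 3; have k0 : 0 < kap by rewrite /kap; lra.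
(* Three factors [E] = exp(4 eps u) arise, two from the square of [be1] and one for the powers of
   [u]; together they take half of [kap]. *)
pose eps := kap / 24; have e0 : 0 < eps by rewrite /eps; lra.
have [C C_gt0 hC] := Dsav eps e0.
have e4 : 0 < eps * 4 by rewrite mulr_gt0.
have [C5 C5_gt0 h5] := poly_le_expR 4 e4.
pose K1 := 4 * expR 10 * (C * 3 `^ eps) ^+ 2 * 81; pose K2 := 24 * B ^+ 2 * expR 12 * 108.
have K10 : 0 <= K1 by rewrite /K1 !mulr_ge0 ?expR_ge0 ?powR_ge0 ?(ltW C_gt0).
have K20 : 0 <= K2 by rewrite /K2 !mulr_ge0 ?expR_ge0 ?(ltW B0).
have main u : 10 <= u -> u0 <= u -> c * expR (kap / 2 * u) <= (K1 + K2) * C5.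
  move=> u10 u0u; have u_gt0 : 0 < u by lra.
  have r1 : 1 < r by lra.
  have rp : 0 < r by lra.
  have [n [n2u rn]] := gammaw_peak r1 r2 u10.
  set W := expR 5 * _ * _ * _ => W0 gW.
  have u4 : 0 <= 4 * u by lra.
  have u41 : 1 <= 4 * u by lra.
  (* Near the diagonal the bound [B] loses r^(2n), at most exp(4 u + 2); a grid of about exp(4 u)
     points pays for it. *)
  have [M [M1 M2]] := expR_grid u4.
  have L := ln_grid u41 M2; have P := powR_grid u4 e0 M2.
  have rn0 : 0 < r ^+ n by rewrite exprn_gt0.
  have pM : 0 < (1 + M.+1%:R) `^ eps by rewrite powR_gt0// ltr_wpDr.
  pose be1 := C * n.+1%:R * (1 + M.+1%:R) `^ eps / r ^+ n.
  have be0 : 0 < be1 by rewrite /be1 divr_gt0// !mulr_gt0.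
  have betP (p : 'I_M.+1 * 'I_M.+1) : normc (Dser D lam (p.1%:R - p.2%:R) b n) <=
      (if 2 <= `|p.1%:R - p.2%:R : R| then be1 else B).
    case: ifP => [t2|_]; last exact: DB.
    rewrite /be1 ler_pdivlMr//; apply: le_trans (hC _ _ t2) _.
    rewrite ler_wpM2l ?mulr_ge0 ?(ltW C_gt0)//; apply: ge0_ler_powR; rewrite ?nnegrE ?(ltW e0) ?addr_ge0//.
    rewrite lerD2l.
    have h1 : p.1%:R <= M.+1%:R :> R by rewrite ler_nat ltnW.
    have h2 : p.2%:R <= M.+1%:R :> R by rewrite ler_nat ltnW.
    have h3 : 0 <= p.1%:R :> R by exact: ler0n.
    have h4 : 0 <= p.2%:R :> R by exact: ler0n.
    by rewrite ler_norml; apply/andP; split; lra.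
  have bet0 (p : 'I_M.+1 * 'I_M.+1) : 0 < (if 2 <= `|p.1%:R - p.2%:R : R| then be1 else B) by case: ifP.
  have := mean_square_le lam_ge0 lev_finite b_ge0 bC (u + 1) bet0 betP.
  have E4 := ler_wpM2l (ler0n R 4) (grid_energy M be0 B0).
  move=> /le_trans/(_ E4) {E4}.
  have m0 : 0 < M.+1%:R :> R by rewrite ltr0n.
  set m := M.+1%:R in m0 M1 M2 L P pM be1 be0 betP bet0 *.
  have m20 : 0 < m ^+ 2 by rewrite exprn_gt0.
  have W20 : 0 < W ^+ 2 by rewrite exprn_gt0.
  move=> H; have {H} : c * expR u / W ^+ 2 * m ^+ 2 <= 4 * (m ^+ 2 * be1 ^+ 2 + 6 * B ^+ 2 * m * (1 + ln m)).
    apply: le_trans H; rewrite mulrC ler_pM2l//; apply: le_trans (energy_ge lev_finite b1 W0 gW).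
    by rewrite ler_pM2r ?invr_gt0// cnt.
  rewrite -ler_pdivlMr// ler_pdivrMr//.
  have -> : 4 * (m ^+ 2 * be1 ^+ 2 + 6 * B ^+ 2 * m * (1 + ln m)) / m ^+ 2 * W ^+ 2 =
     4 * (be1 * W) ^+ 2 + 24 * B ^+ 2 * ((1 + ln m) / m) * W ^+ 2 by field; rewrite gt_eqF.
  set G := expR ((2 - r) * u); have G0 : 0 < G := expR_gt0 _.
  set E := expR (eps * 4 * u) in P; have E1 : 1 <= E.
    by rewrite -[leLHS]expR0 ler_expR mulr_ge0 ?(ltW e4) ?(ltW u_gt0).
  have E0 : 0 < E := lt_le_trans ltr01 E1.
  have n3 : n%:R <= 3 * u by clear -n2u u10; lra.
  have n4 : n.+1%:R <= 3 * u by rewrite -natr1; clear -n2u u10; lra.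
  have p5 : 0 < expR 5 :> R := expR_gt0 _.
  have u3 : 0 <= 3 * u by clear -u_gt0; lra.
  have q1 : 4 * (be1 * W) ^+ 2 <= K1 * u ^+ 4 * E ^+ 2 * G ^+ 2.
    have -> : K1 * u ^+ 4 * E ^+ 2 * G ^+ 2 =
        4 * (C * (3 * u) * (3 `^ eps * E) * (expR 5 * (3 * u) * G)) ^+ 2.
      rewrite /K1; have -> : expR 10 = expR 5 ^+ 2 :> R by rewrite expr2 -expRD; congr expR; ring.
      by clear; ring.
    rewrite ler_pM2l// lerXn2r ?nnegrE ?(ltW (mulr_gt0 be0 W0))//.
      by rewrite !mulr_ge0 ?(ltW C_gt0) ?powR_ge0 ?(ltW E0) ?(ltW p5) ?(ltW G0) ?(ltW u_gt0).
    have -> : be1 * W = C * n.+1%:R * (1 + m) `^ eps * (expR 5 * n%:R * G).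
      by rewrite /be1 /W -/G; field; rewrite gt_eqF.
    have Pge := powR_ge0 (1 + m) eps.
    apply: ler_pM; rewrite ?mulr_ge0 ?(ltW C_gt0) ?(ltW p5) ?(ltW G0)//.
      by apply: ler_pM; rewrite ?mulr_ge0 ?(ltW C_gt0)// ler_pM2l.
    by rewrite ler_pM2r// ler_pM2l.
  have q2 : 24 * B ^+ 2 * ((1 + ln m) / m) * W ^+ 2 <= K2 * u ^+ 3 * G ^+ 2.
    have -> : K2 * u ^+ 3 * G ^+ 2 = 24 * B ^+ 2 * (12 * u * (expR 5 * (3 * u) * expR 1 * G) ^+ 2).
      rewrite /K2; have -> : expR 12 = (expR 5 * expR 1) ^+ 2 :> R by rewrite expr2 -!expRD; congr expR; ring.
      by clear; ring.
    rewrite -mulrA ler_wpM2l ?mulr_ge0 ?(ltW B0)//.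
    have rn2 : (r ^+ n) ^+ 2 / m <= expR 1 ^+ 2.
      rewrite ler_pdivrMr//; apply: (@le_trans _ _ (expR (2 * u + 1) ^+ 2)).
        by rewrite lerXn2r ?nnegrE ?expR_ge0 ?(ltW rn0).
      apply: (@le_trans _ _ (expR 1 ^+ 2 * expR (4 * u))); last by rewrite ler_pM2l ?exprn_gt0 ?expR_gt0.
      by rewrite !expr2 -!expRD ler_expR; clear; lra.
    have -> : (1 + ln m) / m * W ^+ 2 = (1 + ln m) * ((expR 5 * n%:R * G) ^+ 2 * ((r ^+ n) ^+ 2 / m)).
      by rewrite /W -/G; field; rewrite gt_eqF.
    have -> : (expR 5 * (3 * u) * expR 1 * G) ^+ 2 = (expR 5 * (3 * u) * G) ^+ 2 * expR 1 ^+ 2.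
      by clear; ring.
    have a0 : 0 <= expR 5 * n%:R * G by rewrite !mulr_ge0 ?(ltW p5) ?(ltW G0).
    have a1 : expR 5 * n%:R * G <= expR 5 * (3 * u) * G by rewrite ler_pM2r// ler_pM2l.
    have L0 : 0 <= 1 + ln m by rewrite addr_ge0// ln_ge0// ler1n.
    have L1 : 1 + ln m <= 12 * u by apply: le_trans L _; rewrite mulrA -natrM.
    have a2 : (expR 5 * n%:R * G) ^+ 2 <= (expR 5 * (3 * u) * G) ^+ 2.
      by rewrite lerXn2r ?nnegrE// (le_trans a0).
    have a3 := divr_ge0 (sqr_ge0 (r ^+ n)) (ltW m0).
    exact: (ler_pM L0 (mulr_ge0 (sqr_ge0 _) a3) L1 (ler_pM (sqr_ge0 _) a3 a2 rn2)).
  move=> /le_trans/(_ (lerD q1 q2)) H; clear q1 q2; clearbody K1 K2.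
  have u4E : (1 + u) ^+ 4 <= C5 * E by apply: h5; exact: ltW.
  have a1 : 1 <= 1 + u by clear -u_gt0; lra.
  have w1 : u ^+ 4 <= (1 + u) ^+ 4 by rewrite lerXn2r ?nnegrE ?(ltW u_gt0)//; clear -u_gt0; lra.
  have w2 : u ^+ 3 <= (1 + u) ^+ 4.
    rewrite [leRHS]exprS -[leLHS]mul1r; apply: ler_pM; rewrite ?exprn_ge0 ?(ltW u_gt0)//.
    by rewrite lerXn2r ?nnegrE ?(ltW u_gt0)//; clear -u_gt0; lra.
  have G20 : 0 < G ^+ 2 by rewrite exprn_gt0.
  have E20 : 0 < E ^+ 2 by rewrite exprn_gt0.
  have E21 : 1 <= E ^+ 2 by rewrite exprn_ege1.
  have {H} : c * expR u <= (K1 + K2) * (C5 * E) * E ^+ 2 * G ^+ 2.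
    apply: le_trans H _; rewrite -mulrDl ler_pM2r// !mulrDl; apply: lerD.
      by rewrite ler_pM2r// ler_wpM2l// (le_trans w1).
    rewrite -[leLHS]mulr1; apply: ler_pM; rewrite ?mulr_ge0 ?exprn_ge0 ?(ltW u_gt0)//.
    by rewrite ler_wpM2l// (le_trans w2).
  have -> : expR u = expR (kap / 2 * u) * (E ^+ 3 * G ^+ 2).
    by rewrite /E /G -!expRM_natl -!expRD /eps; congr expR; rewrite /kap; field.
  have -> : (K1 + K2) * (C5 * E) * E ^+ 2 * G ^+ 2 = (K1 + K2) * C5 * (E ^+ 3 * G ^+ 2).
    by clear; ring.
  by rewrite mulrA ler_pM2r// mulr_gt0// exprn_gt0.
pose Q := (K1 + K2) * C5.
have Q0 : 0 <= Q by rewrite mulr_ge0 ?addr_ge0// ltW.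
pose u := Num.max (Num.max 10 u0) (2 * Q / (c * kap)).
have := main u; rewrite -/Q !le_max !lexx !orbT => /(_ isT isT).
rewrite leNgt => /negP; apply.
have hu : 2 * Q / (c * kap) <= u by rewrite le_max lexx orbT.
have h := expR_ge1Dx (kap / 2 * u).
have : c * (1 + kap / 2 * u) <= c * expR (kap / 2 * u) by rewrite ler_pM2l.
apply: lt_le_trans; move: hu; rewrite ler_pdivrMr ?mulr_gt0// => hu.
rewrite mulrDr mulr1; clear -hu c0; lra.
Qed.

(** * Ramp functions *)

Section Ramp.
Variable R : realType.
Local Notation mu := (@lebesgue_measure R).
Implicit Types (u v X a : R).

Lemma decays_expRN a : 0 < a -> decays (fun v => expR (- (a * v)) : R).
Proof.
move=> a0; have E : (fun v => expR (- (a * v))) = gammaw a 0.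
  by apply/funext => v; rewrite /gammaw expr0 fact0 divr1 mul1r.
apply: (@decaysW _ _ 1 a) => //; first by rewrite E; exact: measurable_gammaw.
by move=> v _; rewrite mul1r ger0_norm// expR_ge0.
Qed.

Lemma integrable_sub_halfline (E : set R) f : measurable E -> E `<=` @halfline R ->
  decays f -> mu.-integrable E (EFin \o f).
Proof. by move=> mE sE df; apply: integrableS (decays_integrable df) => //; exact: measurable_halfline. Qed.

Lemma Rintegral_tail a X : 0 < a -> 0 <= X ->
  \int[mu]_(v in `]X, +oo[) expR (- (a * v)) = expR (- (a * X)) / a.
Proof.
move=> a0 X0; have de := decays_expRN a0.
have := Rintegral_halfline_split X0 (decays_integrable de).
have E0 : (fun v => expR (- (a * v))) = gammaw a 0.
  by apply/funext => v; rewrite /gammaw expr0 fact0 divr1 mul1r.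
rewrite E0 Rintegral_gammaw// expr1.
(* Against the weight [gammaw 2 0], which is exp(-2 v), this function turns [FTC_kernel] into a
   formula for exp(-a v). *)
have dF v : is_derive v 1 (fun v => expR ((2 - a) * v)) ((2 - a) * expR ((2 - a) * v)).
  have d1 : is_derive v 1 (fun v : R => (2 - a) * v) (2 - a).
    have -> : (fun v : R => (2 - a) * v) = (cst (2 - a) * id) by apply/funext => x; rewrite !fctE.
    by apply: is_derive_eq; rewrite /GRing.scale /= mulr0 addr0 mulr1.
  by have := is_derive1_comp (is_derive_expR _) d1; rewrite mulrC.
have cf : continuous (fun v => (2 - a) * expR ((2 - a) * v)).
  by move=> v; apply: cvgMr; exact: (continuous_derivable dF).
have dh (v : R) : is_derive v 1 (cst 1 : R -> R) (0 * (cst 0 : R -> R) v).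
  by rewrite mul0r; exact: is_derive_cst.
have [_] := FTC_kernel 0 X0 dF cf dh (fun v => @cst_continuous _ _ 0 v).
rewrite (_ : (fun v => _) = (fun v => a * gammaw a 0 v)); last first.
  apply/funext => v /=; rewrite mulr0 mul0r mulr1 mulr1 /gammaw !expr0 fact0 divr1 !mul1r subr0 subr0.
  have -> : expR (- (a * v)) = expR ((2 - a) * v) * expR (- (2 * v)) by rewrite -expRD; congr expR; ring.
  by ring.
rewrite RintegralZl//; last first.
  apply: integrable_sub_halfline; first exact: measurable_itv.
    by move=> v; rewrite /halfline /= !in_itv /= => /andP[->].
  by rewrite -E0.
rewrite /= mulr0 expR0 /gammaw !expr0 fact0 divr1 !mul1r mulr0 oppr0 expR0 mulr1.
rewrite -expRD (_ : (2 - a) * X + - (2 * X) = - (a * X)); last by ring.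
set I := Rintegral _ _ _ => aI; set K := Rintegral _ _ _ => E.
have : K = a^-1 - I by rewrite E addrAC subrr add0r.
by move->; apply: (@mulfI _ a); rewrite ?gt_eqF// mulrBr aI divff ?gt_eqF//; field; rewrite gt_eqF.
Qed.

Variables (T : choiceType) (D : pred T) (lam b : T -> R) (Cb : R).
Hypothesis lam_ge0 : forall x, D x -> 0 <= lam x.
Hypothesis lev_finite : forall X, finite_set [set x | D x /\ lam x <= X].
Hypothesis b_ge0 : forall x, 0 <= b x.
Hypothesis bC : forall v, 0 <= v -> countle D lam b v <= Cb * expR v.
Local Notation lev := (lev D lam).
Local Notation cnt := (countle D lam b).

(** The primitive of the counting function, written as a sum of pieces that start from the value
    0. *)
Definition ramp v := \sum_(x <- lev v) b x * (v - lam x).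

Lemma ramp_sub u v : u <= v -> 0 <= ramp v - ramp u <= (v - u) * cnt v.
Proof.
move=> uv; rewrite /ramp -(sum_lev_le lev_finite (fun x => b x * (u - lam x)) uv).
rewrite /countle (bigID (fun x => lam x <= u))/= addrAC -sumrB mulr_sumr.
rewrite [X in _ <= _ <= X](bigID (fun x => lam x <= u))/=.
have H x : b x * (v - lam x) - b x * (u - lam x) = (v - u) * b x by ring.
apply/andP; split.
  apply: addr_ge0; first by apply: sumr_ge0 => x _; rewrite H mulr_ge0// subr_ge0.
  rewrite big_seq_cond; apply: sumr_ge0 => x /andP[]; rewrite mem_lev// => /andP[_ xv] _.
  by rewrite mulr_ge0// subr_ge0.
apply: lerD; first by apply: ler_sum => x _; rewrite H.
apply: ler_sum => x; rewrite -ltNge => ux.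
by rewrite mulrC ler_wpM2r// lerD2l lerN2 ltW.
Qed.

Lemma ramp0_le0 : ramp 0 <= 0.
Proof.
rewrite /ramp big_seq_cond; apply: sumr_le0 => x /andP[]; rewrite mem_lev// => /andP[Dx _] _.
by rewrite mulr_ge0_le0// sub0r oppr_le0 lam_ge0.
Qed.

(** Induction by unit steps from ramp w <= ramp (w - 1) + cnt w; the constant 2 reproduces itself
    because 2 exp(w - 1) <= exp w. *)
Lemma ramp_le v : 0 <= v -> ramp v <= 2 * Cb * expR v.
Proof.
have C0 : 0 <= Cb := Cb_ge0 lev_finite b_ge0 bC.
suff H n w : 0 <= w <= n%:R -> ramp w <= 2 * Cb * expR w.
  by move=> v0; apply: (H (Num.bound v)); rewrite v0 ltW// archi_boundP.
elim: n w => [|n IH] w /andP[w0 wn].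
  have -> : w = 0 by apply/le_anti; rewrite w0 wn.
  by apply: le_trans ramp0_le0 _; rewrite !mulr_ge0 ?expR_ge0.
have c := bC w0; have cw0 := expR_ge0 w.
have [w1|w1] := leP w 1.
  have /andP[_ h] := ramp_sub w0; have r0 := ramp0_le0.
  have : (w - 0) * cnt w <= 1 * (Cb * expR w).
    apply: ler_pM; rewrite ?subr0//; apply: le_trans (countle_nondecreasing lev_finite b_ge0 w0).
    by apply: sumr_ge0 => x _; exact: b_ge0.
  have := mulr_ge0 C0 cw0; move: h r0; lra.
have w10 : 0 <= w - 1 by lra.
have w11 : w - 1 <= w by lra.
have wn1 : w - 1 <= n%:R by rewrite lerBlDr natr1.
have := IH (w - 1); rewrite w10 wn1 => /(_ isT) h1.
have /andP[_ h2] := ramp_sub w11.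
have e2 : 2 * expR (w - 1) <= expR w.
  have -> : expR w = expR (w - 1) * expR 1 by rewrite -expRD subrK.
  rewrite mulrC ler_wpM2l ?expR_ge0//.
  by have := expR_ge1Dx (1 : R); lra.
have := ler_wpM2l C0 e2; move: h1 h2 c; lra.
Qed.

Lemma ramp_ge0 v : 0 <= v -> 0 <= ramp v.
Proof.
move=> v0; rewrite /ramp big_seq_cond; apply: sumr_ge0 => x /andP[].
by rewrite mem_lev// => /andP[_ xv] _; rewrite mulr_ge0// subr_ge0.
Qed.

Lemma expdom_ramp : expdom (2 * Cb) 1 ramp.
Proof.
split; last by move=> v v0; rewrite ger0_norm ?ramp_ge0// mul1r ramp_le.
apply: nondecreasing_measurable => // u v uv.
by have /andP[] := ramp_sub uv; rewrite subr_ge0.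
Qed.

(** The factor [g] is 1 for [Gcoef_ramp], and [expR] for [Rintegral_ramp], where it turns the weight
    exp(-2 v) into exp(-v). *)
Lemma assembled_ramp (g dg : R -> R) X :
  assembled lam (fun x v => b x * ((v - lam x) * g v)) (fun x v => b x * ((v - lam x) * dg v + g v))
    X (lev X) (fun v => ramp v * g v) (fun v => ramp v * dg v + cnt v * g v).
Proof.
split.
  by move=> x /(@In_mem_seq T); rewrite mem_lev// => /andP[Dx ->]; rewrite lam_ge0.
move=> v /andP[v0 vX]; rewrite /ramp /countle.
rewrite -(sum_lev_le lev_finite (fun x => b x * (v - lam x)) vX) -(sum_lev_le lev_finite b vX).
split.
  rewrite mulr_suml big_mkcond; apply: eq_bigr => x _.
  by case: (lam x <= v); rewrite ?mul1r ?mul0r// mulrA.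
rewrite !mulr_suml -big_split big_mkcond /=; apply: eq_bigr => x _.
by case: (lam x <= v); rewrite ?mul1r ?mul0r//; ring.
Qed.

Lemma is_derive_ramp1 (x : T) (g dg : R -> R) : (forall v, is_derive v 1 g (dg v)) -> forall v,
  is_derive v 1 (fun v => b x * ((v - lam x) * g v)) (b x * ((v - lam x) * dg v + g v)).
Proof.
move=> dg' v; have h := dg' v.
have -> : (fun v => b x * ((v - lam x) * g v)) = b x \*: ((id - cst (lam x)) * g).
  by apply/funext => w; rewrite !fctE.
by apply: is_derive_eq; rewrite /GRing.scale /= !fctE; ring.
Qed.

(** Every piece vanishes at its own starting point, so there are no jumps and the sum in [abel_fps]
    is 0. *)
Lemma Gcoef_ramp t : fpsS (cline t) * Gcoef t ramp = Gcoef t cnt.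
Proof.
apply/funext => n; apply/eqP; rewrite -subr_eq0 -fpsNE -fpsDE; apply/eqP.
apply: normc_le_eps => e e0.
have d0 (v : R) : is_derive v 1 (cst (1 : R) : R -> R) ((cst 0 : R -> R) v) by exact: is_derive_cst.
have d1 x := is_derive_ramp1 x d0.
have ec := expdom_countle lev_finite b_ge0 bC (bdd_b b_ge0).
have b2 : (1 : R) < 2 by rewrite ltr1n.
have A X := @assembled_ramp (cst 1) (cst 0) X.
have Er : (fun v => ramp v * (cst 1 : R -> R) v) = ramp by apply/funext => v; rewrite /= mulr1.
have Ec : (fun v => ramp v * (cst 0 : R -> R) v + cnt v * (cst 1 : R -> R) v) = cnt.
  by apply/funext => v; rewrite /= mulr0 add0r mulr1.
rewrite Er Ec in A.
have cf x : continuous (fun v => b x * ((v - lam x) * (cst 0 : R -> R) v + (cst 1 : R -> R) v)).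
  rewrite (_ : (fun v => _) = cst (b x)); first exact: cst_continuous.
  by apply/funext => v; rewrite /= mulr0 add0r mulr1.
have [X0 X00 H] := @abel_fps R T lam _ _ d1 cf t n _ _ 1 ramp cnt expdom_ramp ec b2 e e0.
have := H X0 (lev X0) (lexx _) (A X0).
rewrite big1 ?sub0r ?normcN; last first.
  by move=> x _; rewrite subrr mul0r mulr0 mul0r.
by rewrite fpsDE fpsNE.
Qed.

Lemma Rintegral_ramp X : 0 <= X ->
  \int[mu]_(v in `[0, X]) ((ramp v - cnt v) * expR (- v)) = - (ramp X * expR (- X)).
Proof.
move=> X0; have d1 x := is_derive_ramp1 x (fun v : R => is_derive_expR v).
have dh (v : R) : is_derive v 1 (cst 1 : R -> R) (0 * (cst 0 : R -> R) v).
  by rewrite mul0r; exact: is_derive_cst.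
have cf x : continuous (fun v => b x * ((v - lam x) * expR v + expR v)).
  move=> v; apply: cvgMr; apply: cvgD; last exact: continuous_expR.
  by apply: cvgM; [apply: cvgB; [exact: cvg_id|exact: cvg_cst]|exact: continuous_expR].
have := abel_finite (fun x v => d1 x v) cf 0 X0 (@assembled_ramp expR expR X) dh (fun v => @cst_continuous _ _ 0 v).
rewrite big1 ?sub0r; last by move=> x _; rewrite subrr mul0r mulr0 !mul0r.
rewrite (_ : (fun v => _) = (fun v => (ramp v - cnt v) * expR (- v))); last first.
  apply/funext => v /=; rewrite mulr0 mul0r !mulr1 /gammaw !expr0 fact0 divr1 !mul1r !subr0.
  have -> : expR (- v) = expR v * expR (- (2 * v)) by rewrite -expRD; congr expR; ring.
  by ring.
move=> ->; rewrite /= mulr1 /gammaw expr0 fact0 divr1 mul1r -mulrA -expRD.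
by congr (- (_ * expR _)); ring.
Qed.

(** By [Rintegral_ramp], W exp(-X) is the integral up to X of (N - W) exp(-v), an integrand of size
    exp(-(1 - th) v): its full integral is [L], and the tail beyond X is the error. *)
Lemma ramp_asymptotic (B th : R) : 0 < th -> th < 1 ->
  (forall v, 0 <= v -> `|cnt v - ramp v| <= B * expR (th * v)) ->
  exists L B', forall X, 0 <= X -> `|ramp X - L * expR X| <= B' * expR (th * X).
Proof.
move=> th0 th1 H; pose g v := (ramp v - cnt v) * expR (- v).
have a0 : 0 < 1 - th by rewrite subr_gt0.
have gle v : 0 <= v -> `|g v| <= B * expR (- ((1 - th) * v)).
  move=> v0; rewrite /g normrM distrC (ger0_norm (expR_ge0 _)).
  apply: le_trans (ler_wpM2r (expR_ge0 _) (H v v0)) _.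
  by rewrite -mulrA -expRD (_ : th * v - v = - ((1 - th) * v))//; ring.
have mg : measurable_fun setT g.
  apply: measurable_funM; last by apply: measurableT_comp => //; exact: measurable_funN.
  apply: measurable_funB; first exact: (expdom_ramp).1.
  exact: (expdom_countle lev_finite b_ge0 bC (bdd_b b_ge0)).1.
have dg : decays g by exact: decaysW mg a0 gle.
have ig := decays_integrable dg.
exists (- \int[mu]_(v in @halfline R) g v); exists (B / (1 - th)) => X X0.
have S := Rintegral_halfline_split X0 ig; rewrite Rintegral_ramp// in S.
have mX : measurable (`]X, +oo[%classic : set R) by exact: measurable_itv.
have sub' : `]X, +oo[%classic `<=` @halfline R.
  by move=> v; rewrite /halfline /= !in_itv /= !andbT => /ltW; exact: le_trans.
have ie : mu.-integrable `]X, +oo[%classic (EFin \o (fun v => B * expR (- ((1 - th) * v)))).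
  by apply: integrable_sub_halfline mX sub' _; exact: decaysZ (decays_expRN a0).
have sub v : `]X, +oo[%classic v -> 0 <= v.
  by rewrite /= in_itv /= andbT => /ltW; exact: le_trans.
have := Rintegral_le_dominated mX mg ie (fun v Xv => gle v (sub v Xv)).
rewrite RintegralZl//; last first.
  exact: integrable_sub_halfline mX sub' (decays_expRN a0).
rewrite Rintegral_tail// => h.
have -> : ramp X - (- \int[mu]_(v in halfline (R:=R)) g v) * expR X =
    (\int[mu]_(v in `]X, +oo[) g v) * expR X.
  by rewrite S expRN; field; rewrite gt_eqF ?expR_gt0.
rewrite normrM (ger0_norm (expR_ge0 _)); apply: le_trans (ler_wpM2r (expR_ge0 _) h) _.
have -> : expR (th * X) = expR (- ((1 - th) * X)) * expR X by rewrite -expRD; congr expR; ring.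
by rewrite le_eqVlt; apply/orP; left; apply/eqP; ring.
Qed.

End Ramp.

(** * Transfer of bounds between the series *)

Section Division.
Variable R : realType.
Local Notation nc := (@normc R).
Implicit Types (t r : R) (g h : fps R) (c : R[i]) (n : nat).

(** The recursion c g(n+1) = h(n+1) + g(n) contracts, because r < 2 <= |c|; the constant K = 2 / (2
    - r) solves K = 1 + r K / 2. *)
Lemma fpsS_div c g h r (H : R) : fpsS c * g = h -> 0 < r -> r < 2 -> 2 <= nc c -> 0 <= H ->
  (forall n, nc (h n) * r ^+ n <= H) -> forall n, nc (g n) * r ^+ n <= 2 / (2 - r) * H / nc c.
Proof.
move=> E r0 r2 c2 H0 hH; have c0 : 0 < nc c by exact: lt_le_trans c2.
have d0 : 0 < 2 - r by rewrite subr_gt0.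
have K1 : 1 <= 2 / (2 - r) by rewrite ler_pdivlMr// mul1r; lra.
elim=> [|n IH].
  rewrite ler_pdivlMr//; have h1 := hH 0%N; rewrite -E fpsSM0 normcM in h1.
  rewrite (_ : nc (g 0%N) * r ^+ 0 * nc c = nc c * nc (g 0%N) * r ^+ 0); last by ring.
  by apply: le_trans h1 _; rewrite ler_peMl.
rewrite ler_pdivlMr//.
have h1 := hH n.+1; rewrite -E fpsSMS in h1.
have h2 : nc (c * g n.+1) <= nc (c * g n.+1 - g n) + nc (g n).
  by rewrite -[X in normc X <= _](subrK (g n)) normcD.
have rn : 0 <= r ^+ n.+1 by rewrite exprn_ge0// ltW.
have h3 := ler_wpM2r rn h2; rewrite normcM mulrDl in h3.
have h4 : nc (g n) * r ^+ n.+1 <= r * (2 / (2 - r) * H / 2).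
  rewrite exprSr mulrA mulrC ler_pM2l//; apply: le_trans IH _.
  have K0 : 0 <= 2 / (2 - r) * H by rewrite mulr_ge0 ?divr_ge0 ?(ltW d0).
  by apply: ler_wpM2l => //; rewrite lef_pV2 ?posrE.
have -> : 2 / (2 - r) * H = H + r * (2 / (2 - r) * H / 2) by field; rewrite gt_eqF.
by rewrite mulrAC [_ * nc c]mulrC; apply: le_trans h3 _; exact: lerD.
Qed.

Lemma fpsS_mul_le c g r (A : R) n : 0 < r -> (forall n, nc (g n) * r ^+ n <= A) ->
  nc ((fpsS c * g) n) * r ^+ n <= (nc c + r) * A.
Proof.
move=> r0 gA; have c0 := normc_nneg c.
have A0 : 0 <= A by apply: le_trans (gA 0%N); rewrite mulr_ge0 ?normc_nneg.
case: n => [|n].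
  rewrite fpsSM0 normcM -mulrA mulrDl -[leLHS]addr0; apply: lerD; first exact: ler_wpM2l.
  by rewrite mulr_ge0// ltW.
have rn : 0 <= r ^+ n.+1 by rewrite exprn_ge0// ltW.
rewrite fpsSMS; apply: le_trans (ler_wpM2r rn (normcB _ _)) _.
rewrite mulrDl mulrDl normcM -mulrA; apply: lerD; first exact: ler_wpM2l.
by rewrite exprSr mulrA mulrC ler_pM2l.
Qed.

Lemma normc_cline_ge t : 2 <= nc (cline t) /\ (1 + `|t|) / 2 <= nc (cline t).
Proof.
have h1 : 2 <= nc (cline t) by apply: le_trans (abs_Re_le (cline t)); rewrite ger0_norm.
have h2 : `|t| <= nc (cline t) by exact: (abs_Im_le (cline t)).
by split => //; lra.
Qed.

Lemma normc_cline1 t : [/\ `|t| <= nc (cline t - 1), (1 + `|t|) / 2 <= nc (cline t - 1) &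
  nc (cline t - 1) <= 1 + `|t|].
Proof.
have -> : cline t - 1 = (1 +i* t)%C.
  by apply/eqP; rewrite eq_complex /= oppr0 addr0 eqxx andbT; apply/eqP; ring.
have h1 : 1 <= nc (1 +i* t)%C by apply: le_trans (abs_Re_le _); rewrite normr1.
have h2 : `|t| <= nc (1 +i* t)%C by exact: (abs_Im_le (1 +i* t)%C).
split => //; first by lra.
by apply: le_trans (normc_le_ReIm _) _; rewrite normr1.
Qed.

Definition expO th (f : R -> R) :=
  exists2 C, 0 < C & forall v, 0 <= v -> `|f v| <= C * expR (th * v).

Definition subpoly r (h : R -> fps R) := forall eps, 0 < eps -> exists2 C : R, 0 < C &
  forall t n, nc (h t n) * r ^+ n <= C * (1 + `|t|) `^ eps.

Lemma polybounded_Gcoef th rr f (C0 : R) : expdom C0 1 f -> expO th f -> th < 1 -> rr <= 2 - th ->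
  polybounded rr (fun t => Gcoef t f).
Proof.
move=> [mf _] [C C_gt0 fC] th1 rth r /andP[r0 rr1].
have ef : expdom C th f by [].
have th2 : th < 2 by lra.
have d0 : 0 < 2 - th by lra.
exists (2 * C * (2 - th)^-1), 0%N; split; first by rewrite !mulr_gt0// invr_gt0.
move=> t n; rewrite expr0 mulr1.
have rn : 0 <= r ^+ n by rewrite exprn_ge0// ltW.
apply: le_trans (ler_wpM2r rn (normc_Gcoef_le t n ef th2)) _.
rewrite (_ : 2 * C * (2 - th)^-1 ^+ n.+1 * r ^+ n = 2 * C / (2 - th) * ((2 - th)^-1 * r) ^+ n).
  rewrite ler_piMr ?mulr_ge0 ?invr_ge0 ?(ltW C_gt0) ?(ltW d0)//.
  rewrite exprn_ile1// ?mulr_ge0 ?invr_ge0 ?(ltW d0) ?(ltW r0)//.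
  by rewrite mulrC ler_pdivrMr// mul1r; lra.
by rewrite exprS exprMn; ring.
Qed.

Lemma saving_div r f (h : R -> fps R) : 0 < r -> r < 2 -> (forall t, fpsS (cline t) * Gcoef t f = h t) ->
  subpoly r h -> saving r f.
Proof.
move=> r0 r2 E hS eps e0; have [C C_gt0 hC] := hS eps e0.
have d0 : 0 < 2 - r by lra.
exists (2 / (2 - r) * C * 2); first by rewrite !mulr_gt0// invr_gt0.
move=> t n; have [c2 ct] := normc_cline_ge t.
have P0 : 0 <= C * (1 + `|t|) `^ eps by rewrite mulr_ge0 ?powR_ge0// ltW.
apply: le_trans (fpsS_div (E t) r0 r2 c2 P0 (hC t) n) _.
have c0 : 0 < nc (cline t) by exact: lt_le_trans c2.
have t0 := gt0_1Dnorm t.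
rewrite ler_pdivrMr//.
have -> : 2 / (2 - r) * C * 2 * ((1 + `|t|) `^ eps / (1 + `|t|)) * nc (cline t) =
  2 / (2 - r) * (C * (1 + `|t|) `^ eps) * (nc (cline t) / ((1 + `|t|) / 2)).
  by field; rewrite !gt_eqF.
rewrite ler_peMr// ?mulr_ge0 ?invr_ge0 ?powR_ge0 ?(ltW d0) ?(ltW C_gt0)//.
by rewrite ler_pdivlMr ?mul1r// divr_gt0.
Qed.

End Division.

(** * The series of a Beurling system and the logarithmic bound for Y'/Y *)

Section Series.
Variables (R : realType) (P : gprimes R) (rho C1 C2 : R).
Local Notation nc := (@normc R).
Implicit Types (t r v u : R) (n : nat).
Hypothesis NC : forall v, 0 <= v -> gN P (expR v) <= C1 * expR v.
Hypothesis psiC : forall v, 0 <= v -> gpsi P (expR v) <= C2 * expR v.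
Hypothesis rho_gt0 : 0 < rho.

Definition cN := countle predT (gln P) (@gone R).
Definition cpsi := countle ppow (pln P) (plog P).
Definition cM := countle predT (gln P) (@gmu R).
Definition EN v := cN v - rho * expR v.
Definition Epsi v := cpsi v - expR v.
Definition rampN := ramp predT (gln P) (@gone R).

Let gln_nneg (n : gint) : predT n -> 0 <= gln P n. Proof. by move=> _; exact: gln_ge0. Qed.
Let bone : bdd (@gone R) (@gone R). Proof. exact: bdd_b (@gone_ge0 R). Qed.
Let b2 : (1 : R) < 2. Proof. by rewrite ltr1n. Qed.

Lemma expdom_cN : expdom C1 1 cN.
Proof. exact: (expdom_countle (@gln_finite _ P) (@gone_ge0 R) (count_gone NC) bone). Qed.

Lemma expdom_cM : expdom C1 1 cM.
Proof. exact: (expdom_countle (@gln_finite _ P) (@gone_ge0 R) (count_gone NC) (@gmu_le1 R)). Qed.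

Lemma expdom_cpsi : expdom C2 1 cpsi.
Proof.
exact: (expdom_countle (@pln_finite _ P) (@plog_ge0 _ P) (count_plog psiC) (bdd_b (@plog_ge0 _ P))).
Qed.

Lemma expdom_EN : expdom (C1 + `|- rho| * 1) 1 EN.
Proof.
have -> : EN = (fun v => cN v + - rho * expR v) by apply/funext => v; rewrite /EN mulNr.
exact: expdomD expdom_cN (expdomZ (- rho) (@expdom_expR R)).
Qed.

Lemma expdom_Epsi : expdom (C2 + `|-1| * 1) 1 Epsi.
Proof.
have -> : Epsi = (fun v => cpsi v + -1 * expR v) by apply/funext => v; rewrite /Epsi mulN1r.
exact: expdomD expdom_cpsi (expdomZ (-1) (@expdom_expR R)).
Qed.

Lemma expdom_NR : expdom (C1 + `|-1| * (2 * C1)) 1 (fun v => cN v + -1 * rampN v).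
Proof.
apply: expdomD expdom_cN (expdomZ (-1) _).
exact: (expdom_ramp gln_nneg (@gln_finite _ P) (@gone_ge0 R) (count_gone NC)).
Qed.

Local Notation S t := (fpsS (cline t)).
(** [pser], [qser], [Yser], [Jser] and [laser] expand 1/s, 1/(s-1), Y = (s-1) Z, 1/Y and Y'/Y. The
    first two are defined as transforms, so that inverses appear without dividing series. *)
Definition pser t := Gcoef t (cst (1 : R) : R -> R).
Definition qser t := Gcoef t (@expR R).
Definition Yser t := (S t - 1) * Zser P t.
Definition Jser t := qser t * Iser P t.
Definition laser t := Lser P t - qser t.

Let Sp t : S t * pser t = 1. Proof. exact: Gcoef1. Qed.
Let Sq t : (S t - 1) * qser t = 1. Proof. exact: Gcoef_expR. Qed.
Let ZI t : Zser P t * Iser P t = 1. Proof. exact: (Zser_Iser NC). Qed.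

Lemma Gcoef_cN t : Gcoef t cN = fpsC rho%:C%C * qser t + Gcoef t EN.
Proof.
rewrite -(GcoefZ t rho (@expdom_expR R) b2).
rewrite -(GcoefD t (expdomZ rho (@expdom_expR R)) expdom_EN b2); congr Gcoef.
by apply/funext => v; rewrite /EN addrC subrK.
Qed.

Lemma ZserE t : Zser P t = S t * Gcoef t cN. Proof. by []. Qed.

Lemma YserE t : Yser t = fpsC rho%:C%C * S t + S t * ((S t - 1) * Gcoef t EN).
Proof.
rewrite /Yser ZserE Gcoef_cN.
have -> : (S t - 1) * (S t * (fpsC rho%:C%C * qser t + Gcoef t EN)) =
  fpsC rho%:C%C * S t * ((S t - 1) * qser t) + S t * ((S t - 1) * Gcoef t EN) by ring.
by rewrite Sq mulr1.
Qed.

(** From Z = s (rho / (s-1) + G(EN)) multiplied by I / s: this expresses 1/Y through I and the error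
    of N, without dividing by s - 1. *)
Lemma JserE t : Jser t = fpsC (rho^-1)%:C%C * (pser t - Iser P t * Gcoef t EN).
Proof.
have E : fpsC rho%:C%C * Jser t = pser t - Iser P t * Gcoef t EN.
  have -> : pser t = (S t * pser t) * ((fpsC rho%:C%C * qser t + Gcoef t EN) * Iser P t).
    rewrite -[LHS]mulr1 -(ZI t) ZserE Gcoef_cN; ring.
  by rewrite Sp mul1r /Jser; ring.
rewrite -E mulrA -fpsCMC -(rmorphM (real_complex R)) mulVf ?gt_eqF// fpsC1.
by rewrite mul1r.
Qed.

Lemma YserJser t : Yser t * Jser t = 1.
Proof.
rewrite /Yser /Jser (_ : _ * _ = ((S t - 1) * qser t) * (Zser P t * Iser P t)); last by ring.
by rewrite Sq ZI mul1r.
Qed.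

Lemma IserE t : Iser P t = (S t - 1) * Jser t.
Proof. by rewrite /Jser mulrA Sq mul1r. Qed.

Lemma laserE t : laser t = 1 + S t * Gcoef t Epsi.
Proof.
have -> : laser t = S t * Gcoef t cpsi - qser t by [].
have -> : Gcoef t cpsi = qser t + Gcoef t Epsi.
  rewrite -(GcoefD t (@expdom_expR R) expdom_Epsi b2); congr Gcoef.
  by apply/funext => v; rewrite /Epsi addrC subrK.
rewrite -(Sq t); ring.
Qed.

Lemma fpsD_qser t : fpsD (qser t) = qser t * qser t.
Proof.
have : fpsD ((S t - 1) * qser t) = 0 by rewrite Sq fpsD1.
rewrite fpsDM fpsDD fpsDN fpsD1 fpsDS oppr0 addr0 mulN1r => /eqP.
rewrite addrC subr_eq0 => /eqP E.
have -> : fpsD (qser t) = qser t * ((S t - 1) * fpsD (qser t)).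
  by rewrite mulrCA mulrA Sq mul1r.
by rewrite E.
Qed.

Lemma fpsD_Yser t : fpsD (Yser t) = laser t * Yser t.
Proof.
rewrite /Yser fpsDM fpsDD fpsDN fpsD1 fpsDS oppr0 addr0 (fpsD_Zser NC psiC).
have -> : laser t * ((S t - 1) * Zser P t) =
  Lser P t * ((S t - 1) * Zser P t) - ((S t - 1) * qser t) * Zser P t by rewrite /laser; ring.
by rewrite Sq; ring.
Qed.

Lemma fpsD_Iser t : fpsD (Iser P t) = - (Lser P t * Iser P t).
Proof.
have : fpsD (Zser P t * Iser P t) = 0 by rewrite ZI fpsD1.
rewrite fpsDM (fpsD_Zser NC psiC) => /(congr1 (fun a => Iser P t * a)).
have -> : Iser P t * (Lser P t * Zser P t * Iser P t + Zser P t * fpsD (Iser P t)) =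
  (Zser P t * Iser P t) * (Lser P t * Iser P t + fpsD (Iser P t)) by ring.
by rewrite ZI mul1r mulr0 => /eqP; rewrite addrC addr_eq0 => /eqP.
Qed.

Lemma fpsD_Jser t : fpsD (Jser t) = - laser t * Jser t.
Proof. by rewrite /Jser fpsDM fpsD_qser fpsD_Iser /laser; ring. Qed.

(** N has transform Z / s and W has Z / s^2; in the difference the factor s - 1 appears by itself,
    so the pole is cancelled. *)
Lemma Gcoef_NR t : S t * (S t * Gcoef t (fun v => cN v + -1 * rampN v)) = Yser t.
Proof.
have er := expdom_ramp gln_nneg (@gln_finite _ P) (@gone_ge0 R) (count_gone NC).
rewrite (GcoefD t expdom_cN (expdomZ (-1) er) b2) (GcoefZ t (-1) er b2).
have E : S t * Gcoef t rampN = Gcoef t cN.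
  exact: (Gcoef_ramp gln_nneg (@gln_finite _ P) (@gone_ge0 R) (count_gone NC)).
rewrite (_ : fpsC (-1)%:C%C = -1); last first.
  by apply/funext => -[|n]; rewrite fpsNE fps1E /= ?oppr0 ?(rmorphN1 (real_complex R)).
rewrite (_ : S t * (Gcoef t cN + -1 * Gcoef t rampN) = S t * Gcoef t cN - S t * Gcoef t rampN); last by ring.
by rewrite E /Yser ZserE; ring.
Qed.

Lemma C1_gt0 : 0 < C1.
Proof.
have := YserJser 0 => /(congr1 (fun a : fps R => a 0%N)); rewrite fpsME big_ord1 fps1E /=.
move=> E; have y0 : 0 < nc (Iser P 0 0%N).
  have : nc ((Zser P 0 * Iser P 0) 0%N) = 1 by rewrite ZI fps1E normc1.
  rewrite fpsME big_ord1 normcM => h; rewrite lt_neqAle normc_nneg andbT eq_sym.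
  by apply/eqP => h0; move: h; rewrite h0 mulr0 => /esym/eqP; rewrite oner_eq0.
by have := lt_le_trans y0 (normc_Iser_le NC 0 0%N); rewrite pmulr_rgt0.
Qed.

Lemma normc_YJ0 t : nc (Yser t 0%N) * nc (Jser t 0%N) = 1.
Proof.
have := YserJser t => /(congr1 (fun a : fps R => nc (a 0%N))).
by rewrite fpsME big_ord1 normcM fps1E normc1.
Qed.

Lemma normc_Y0 t : nc (Yser t 0%N) <= 6 * C1 * (1 + `|t|).
Proof.
rewrite /Yser fpsS1 fpsSM0 normcM mulrC; have [_ _ h] := normc_cline1 t.
by apply: ler_pM; rewrite ?normc_nneg ?(normc_Zser_le NC).
Qed.

Lemma normc_J0 t : nc (Jser t 0%N) <= 12 * C1 / (1 + `|t|).
Proof.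
have [_ h _] := normc_cline1 t; have t0 := gt0_1Dnorm t.
have := normc_Iser_le NC t 0%N; rewrite IserE fpsS1 fpsSM0 normcM => h1.
have h2 := ler_wpM2r (normc_nneg (Jser t 0%N)) h.
by rewrite ler_pdivlMr//; have := normc_nneg (Jser t 0%N); lra.
Qed.

(** The hinge of the proof: any two of the three estimates imply it, and all conclusions about
    exponents, including the bound 1/2, start from it. *)
Definition logbd rr := forall r, 0 < r < rr ->
  exists2 C, 0 < C & forall t n, nc (laser t n) * r ^+ n <= C * logt t.

Lemma logbd_Yser rr : polybounded rr Yser -> polybounded rr laser -> logbd rr.
Proof.
move=> pY pl; apply: polybounded_log pY pl fpsD_Yser _.
have c1 := C1_gt0; have c12 : 0 < 12 * C1 by rewrite mulr_gt0.
exists (12 * C1)^-1, 0%N; split; first by rewrite invr_gt0.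
move=> t; rewrite expr0 mulr1.
rewrite -[leLHS]mul1r ler_pdivrMr// -[leLHS](normc_YJ0 t) ler_wpM2l ?normc_nneg//.
apply: le_trans (normc_J0 t) _; rewrite ler_pdivrMr ?gt0_1Dnorm// ler_peMr ?(ltW c12)//.
exact: ge1_1Dnorm.
Qed.

(** The logarithmic derivative of 1/Y is [- laser], so Borel-Caratheodory may start from 1/Y when
    that is the function under control. *)
Lemma logbd_Jser rr : polybounded rr Jser -> polybounded rr laser -> logbd rr.
Proof.
move=> pJ pl r rr1.
have c1 := C1_gt0; have c6 : 0 < 6 * C1 by rewrite mulr_gt0.
have [] := polybounded_log pJ (polyboundedN pl) fpsD_Jser _ rr1.
  exists (6 * C1)^-1, 1%N; split; first by rewrite invr_gt0.
  move=> t; rewrite expr1 -[leLHS]mul1r ler_pdivrMr// -[leLHS](normc_YJ0 t) mulrC -mulrA.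
  by rewrite ler_wpM2l ?normc_nneg// [leRHS]mulrC; exact: normc_Y0.
move=> C C0 H; exists C => // t n; have := H t n.
by rewrite fpsNE normcN.
Qed.

Lemma normc_laser_le t n : nc (laser t n) <= 6 * C2 + 2.
Proof.
rewrite /laser fpsDE fpsNE; apply: le_trans (normcB _ _) _; apply: lerD.
  exact: (normc_Lser_le psiC).
apply: le_trans (normc_Gcoef_le t n (@expdom_expR R) b2) _.
by rewrite (_ : 2 - 1 = 1 :> R) ?invr1 ?expr1n ?mulr1//; ring.
Qed.

Lemma la_bound_ge0 : 0 <= 6 * C2 + 2.
Proof. exact: le_trans (normc_nneg _) (normc_laser_le 0 0%N). Qed.

Lemma Yser_growth rr r : logbd rr -> 0 < r < rr -> forall eps, 0 < eps ->
  exists2 C, 0 < C & forall t n, nc (Yser t n) * r ^+ n <= C * (1 + `|t|) * (1 + `|t|) `^ eps.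
Proof.
move=> lb rr1 eps e0.
have [C C0 H] := ode_growth la_bound_ge0 fpsD_Yser normc_laser_le lb rr1 e0.
exists (C * (6 * C1)); first by rewrite !mulr_gt0// C1_gt0.
move=> t n; apply: le_trans (H t n) _.
rewrite ler_wpM2r ?powR_ge0// -mulrA ler_pM2l//; exact: normc_Y0.
Qed.

Lemma Jser_growth rr r : logbd rr -> 0 < r < rr -> forall eps, 0 < eps ->
  exists2 C, 0 < C & forall t n, nc (Jser t n) * r ^+ n <= C / (1 + `|t|) * (1 + `|t|) `^ eps.
Proof.
move=> lb rr1 eps e0.
have lN t n : nc ((- laser t) n) <= 6 * C2 + 2 by rewrite fpsNE normcN normc_laser_le.
have lbN r' : 0 < r' < rr ->
    exists2 C, 0 < C & forall t n, nc ((- laser t) n) * r' ^+ n <= C * logt t.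
  move=> rr'; have [C C0 H] := lb r' rr'; exists C => // t n.
  by rewrite fpsNE normcN.
have [C C0 H] := ode_growth la_bound_ge0 fpsD_Jser lN lbN rr1 e0.
exists (C * (12 * C1)); first by rewrite !mulr_gt0// C1_gt0.
move=> t n; apply: le_trans (H t n) _.
by rewrite ler_wpM2r ?powR_ge0// -mulrA ler_pM2l//; exact: normc_J0.
Qed.

Lemma saving_Epsi rr r : logbd rr -> 0 < r < rr -> r < 2 -> saving r Epsi.
Proof.
move=> lb rr1 r2; have /andP[r0 _] := rr1; have [C C0 H] := lb r rr1.
apply: (@saving_div _ r Epsi (fun t => laser t - 1) r0 r2).
  by move=> t; rewrite laserE addrC addKr.
move=> eps e0; have [K K0 HK] := logt_le_powR e0.
exists ((C + 1) * K); first by rewrite mulr_gt0// addr_gt0.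
move=> t n; rewrite fpsDE fpsNE -mulrA.
have rn : 0 <= r ^+ n by rewrite exprn_ge0// ltW.
apply: le_trans (ler_wpM2r rn (normcB _ _)) _; rewrite mulrDl.
apply: (@le_trans _ _ ((C + 1) * logt t)); last by rewrite ler_pM2l ?addr_gt0.
rewrite mulrDl mul1r; apply: lerD => //; apply: le_trans (logt_ge1 t).
by rewrite fps1E normc_nat; case: n {rn} => [|n]; rewrite ?expr0 ?mulr1 ?mul0r.
Qed.

Lemma saving_cM rr r : logbd rr -> 0 < r < rr -> r < 2 -> saving r cM.
Proof.
move=> lb rr1 r2; have /andP[r0 _] := rr1.
apply: (@saving_div _ r cM (Iser P) r0 r2) => // eps e0.
have [C C0 H] := Jser_growth lb rr1 e0.
exists (3 * C); first by rewrite mulr_gt0.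
move=> t n; rewrite IserE fpsS1; apply: le_trans (fpsS_mul_le _ n r0 (H t)) _.
have [_ _ h] := normc_cline1 t; have t1 := ge1_1Dnorm t; have t0 := gt0_1Dnorm t.
rewrite mulrA ler_wpM2r ?powR_ge0//.
have -> : 3 * C = 3 * (1 + `|t|) * (C / (1 + `|t|)) by field; rewrite gt_eqF.
by rewrite ler_pM2r ?divr_gt0//; lra.
Qed.

Lemma saving_NR rr r : logbd rr -> 0 < r < rr -> r < 2 -> saving r (fun v => cN v + -1 * rampN v).
Proof.
move=> lb rr1 r2; have /andP[r0 _] := rr1.
apply: (@saving_div _ r _ (fun t => S t * Gcoef t (fun v => cN v + -1 * rampN v)) r0 r2) => // eps e0.
have [C C0 H] := Yser_growth lb rr1 e0.
have d0 : 0 < 2 - r by rewrite subr_gt0.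
exists (2 / (2 - r) * C * 2); first by rewrite !mulr_gt0// invr_gt0.
move=> t n; have [c2 ct] := normc_cline_ge t; have t0 := gt0_1Dnorm t.
have P0 : 0 <= C * (1 + `|t|) * (1 + `|t|) `^ eps.
  by rewrite !mulr_ge0 ?powR_ge0 ?(ltW C0) ?(ltW t0).
apply: le_trans (fpsS_div (Gcoef_NR t) r0 r2 c2 P0 (H t) n) _.
rewrite ler_pdivrMr; last by exact: lt_le_trans c2.
have -> : 2 / (2 - r) * (C * (1 + `|t|) * (1 + `|t|) `^ eps) =
  2 / (2 - r) * C * 2 * (1 + `|t|) `^ eps * ((1 + `|t|) / 2) by field; rewrite gt_eqF.
by rewrite ler_wpM2l// !mulr_ge0 ?powR_ge0 ?invr_ge0 ?(ltW C0) ?(ltW d0).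
Qed.

(** For |t| >= 2 the centre minus 1 has modulus at least 2, so [fpsS_div] divides by s - 1 at radius
    r < 2, away from the pole. *)
Lemma Zser_growth rr r : logbd rr -> 0 < r < rr -> r < 2 -> forall eps, 0 < eps ->
  exists2 C : R, 0 < C & forall t n, 2 <= `|t| -> nc (Zser P t n) * r ^+ n <= C * n.+1%:R * (1 + `|t|) `^ eps.
Proof.
move=> lb rr1 r2 eps e0; have /andP[r0 _] := rr1.
have [C C0 H] := Yser_growth lb rr1 e0.
have d0 : 0 < 2 - r by rewrite subr_gt0.
exists (2 / (2 - r) * C * 2); first by rewrite !mulr_gt0// invr_gt0.
move=> t n t2; have [ct ct2 _] := normc_cline1 t; have t0 := gt0_1Dnorm t.
have P0 : 0 <= C * (1 + `|t|) * (1 + `|t|) `^ eps.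
  by rewrite !mulr_ge0 ?powR_ge0 ?(ltW C0) ?(ltW t0).
have E : fpsS (cline t - 1) * Zser P t = Yser t by rewrite -fpsS1.
have c2 := le_trans t2 ct.
apply: le_trans (fpsS_div E r0 r2 c2 P0 (H t) n) _.
rewrite ler_pdivrMr; last by exact: lt_le_trans c2.
have -> : 2 / (2 - r) * (C * (1 + `|t|) * (1 + `|t|) `^ eps) =
  2 / (2 - r) * C * 2 * (1 + `|t|) `^ eps * ((1 + `|t|) / 2) by field; rewrite gt_eqF.
have A0 : 0 <= 2 / (2 - r) * C * 2 by rewrite !mulr_ge0 ?invr_ge0 ?(ltW C0) ?(ltW d0).
have h0 := mulr_ge0 A0 (powR_ge0 (1 + `|t|) eps).
have h1 : 0 <= (1 + `|t|) / 2 by rewrite divr_ge0 ?(ltW t0).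
apply: (ler_pM h0 h1 _ ct2).
by rewrite ler_wpM2r ?powR_ge0// ler_peMr// ler1n.
Qed.

Section Cases.
Variable th : R.
Hypotheses (th_gt0 : 0 < th) (th_lt1 : th < 1).
Let rr : R := 2 - th.
Let rr_gt0 : 0 < rr. Proof. by rewrite /rr subr_gt0 (lt_trans th_lt1)// ltr1n. Qed.

Let pS : polybounded rr (fun t => S t). Proof. exact: polybounded_S. Qed.
Let pS1 : polybounded rr (fun t => S t - 1).
Proof.
rewrite (_ : (fun t => S t - 1) = (fun t => S t + fpsC (-1))).
  by apply: polyboundedD pS (polybounded_const _ rr_gt0).
by apply/funext => t; congr (_ + _); rewrite -fpsC1; apply/funext => -[|n]; rewrite fpsNE //= oppr0.
Qed.
Let pp : polybounded rr pser.
Proof.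
apply: (polybounded_Gcoef (@expdom_cst R 1 1 ler01) _ th_lt1 (lexx _)).
by exists 1 => // v v0; rewrite normr1 mul1r -[leLHS]expR0 ler_expR mulr_ge0// ltW.
Qed.

(** Here both Y and 1/Y are under control, so Y'/Y is bounded as the product of Y' and 1/Y. *)
Lemma logbd_NM : expO th EN -> expO th cM -> logbd rr.
Proof.
move=> bN bM; have pN := polybounded_Gcoef expdom_EN bN th_lt1 (lexx rr).
have pI : polybounded rr (Iser P).
  exact: polyboundedM pS (polybounded_Gcoef expdom_cM bM th_lt1 (lexx rr)).
have pY : polybounded rr Yser.
  rewrite (_ : Yser = fun t => fpsC rho%:C%C * S t + S t * ((S t - 1) * Gcoef t EN)).
    by apply: polyboundedD; apply: polyboundedM => //; [exact: polybounded_const rr_gt0|exact: polyboundedM].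
  by apply/funext => t; exact: YserE.
have pJ : polybounded rr Jser.
  rewrite (_ : Jser = fun t => fpsC (rho^-1)%:C%C * (pser t - Iser P t * Gcoef t EN)).
    apply: polyboundedM; first exact: polybounded_const rr_gt0.
    by apply: polyboundedD pp (polyboundedN (polyboundedM pI pN)).
  by apply/funext => t; exact: JserE.
apply: (logbd_Yser pY).
rewrite (_ : laser = fun t => fpsD (Yser t) * Jser t).
  exact: polyboundedM (polybounded_D pY) pJ.
by apply/funext => t; rewrite fpsD_Yser -mulrA YserJser mulr1.
Qed.

Let pla : expO th Epsi -> polybounded rr laser.
Proof.
move=> bP; rewrite (_ : laser = fun t => fpsC 1 + S t * Gcoef t Epsi).
  apply: polyboundedD; first exact: polybounded_const rr_gt0.
  exact: polyboundedM pS (polybounded_Gcoef expdom_Epsi bP th_lt1 (lexx rr)).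
by apply/funext => t; rewrite laserE fpsC1.
Qed.

(** 1/Y = I / (s - 1) is recovered as -I' - (Y'/Y) I, again without dividing by s - 1. *)
Lemma logbd_psiM : expO th Epsi -> expO th cM -> logbd rr.
Proof.
move=> bP bM; have pI : polybounded rr (Iser P).
  exact: polyboundedM pS (polybounded_Gcoef expdom_cM bM th_lt1 (lexx rr)).
apply: logbd_Jser (pla bP).
rewrite (_ : Jser = fun t => - fpsD (Iser P t) + - (laser t * Iser P t)).
  by apply: polyboundedD; apply: polyboundedN; [exact: polybounded_D|exact: polyboundedM (pla bP) pI].
by apply/funext => t; rewrite fpsD_Iser /laser /Jser; ring.
Qed.

Lemma logbd_psiN : expO th Epsi -> expO th EN -> logbd rr.
Proof.
move=> bP bN; have pN := polybounded_Gcoef expdom_EN bN th_lt1 (lexx rr).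
apply: logbd_Yser (pla bP).
rewrite (_ : Yser = fun t => fpsC rho%:C%C * S t + S t * ((S t - 1) * Gcoef t EN)).
  by apply: polyboundedD; apply: polyboundedM => //; [exact: polybounded_const rr_gt0|exact: polyboundedM].
by apply/funext => t; exact: YserE.
Qed.

End Cases.

End Series.

(** * Estimates and exponents *)

Section Landau.
Variable R : realType.
Implicit Types (f g : R -> R) (b x C th v u : R).

Lemma bigO_defP f b :
  (\forall k \near +oo_R, \forall x \near +oo_R, `|f x| <= k * `|x `^ b|) <->
  exists2 C, 0 < C & exists X0, forall x, X0 <= x -> `|f x| <= C * x `^ b.
Proof.
split=> [[k [kr kP]]|[C C0 [X0 H]]].
  have {kP} := kP (Num.max 1 (k + 1)).
  rewrite lt_max ltrDl ltr01 orbT => /(_ isT) [X0 [_ HX]].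
  exists (Num.max 1 (k + 1)); first by rewrite lt_max ltr01.
  exists (X0 + 1) => x X0x; have Xx : X0 < x by apply: lt_le_trans X0x; rewrite ltrDl.
  by have /= := HX x Xx; rewrite (ger0_norm (powR_ge0 _ _)).
exists C; split; first by rewrite gtr0_real.
move=> k Ck; exists X0; split; first exact: num_real.
move=> x /= /ltW X0x; apply: le_trans (H x X0x) _.
by rewrite (ger0_norm (powR_ge0 _ _)) ler_wpM2r ?powR_ge0// ltW.
Qed.

Lemma bigO_addP f g b : (forall x, f x = g x +O_(x \near +oo_R) (x `^ b)) <->
  exists2 C, 0 < C & exists X0, forall x, X0 <= x -> `|f x - g x| <= C * x `^ b.
Proof.
apply: iff_trans (bigO_defP (f - g) b).
apply: iff_trans (eqaddOP (pinfty_filter_on R) f g (fun x => x `^ b)).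
split=> [H|E x]; first by apply/funext => x; exact: H.
exact: (congr1 (fun h => h x) E).
Qed.

Lemma bigO_eqP f b : (forall x, f x =O_(x \near +oo_R) (x `^ b)) <->
  exists2 C, 0 < C & exists X0, forall x, X0 <= x -> `|f x| <= C * x `^ b.
Proof.
apply: iff_trans (bigO_defP f b).
apply: iff_trans (eqOP (pinfty_filter_on R) (fun x => x `^ b) f).
split=> [H|E x]; first by apply/funext => x; exact: H.
exact: (congr1 (fun h => h x) E).
Qed.

Lemma powR_expR b v : (expR v) `^ b = expR (b * v).
Proof. by rewrite /powR gt_eqF ?expR_gt0// expRK. Qed.

(* [g] is a counting function and [a] its density in the scale [x = expR v]. *)
Lemma expR_linear_bound g a b : b < 1 -> 0 <= a ->
  {homo (g \o expR) : u v / u <= v} -> (forall v, 0 <= g (expR v)) ->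
  (exists2 C, 0 < C & exists X0, forall x, X0 <= x -> `|g x - a * x| <= C * x `^ b) ->
  exists C1, forall v, 0 <= v -> g (expR v) <= C1 * expR v.
Proof.
move=> b1 a0 mg g0 [C C0 [X0 H]]; pose X := expR `|X0|.
have XX : X0 <= X by apply: le_trans (ler_norm _) _; have := expR_ge1Dx `|X0|; rewrite -/X; lra.
exists (a + C + g X) => v v0; have e1 : 1 <= expR v by rewrite -[leLHS]expR0 ler_expR.
have [vX|vX] := leP (expR v) X.
  have vX' : v <= `|X0| by rewrite -ler_expR.
  have /= h := mg _ _ vX'; have gX : 0 <= g X := g0 _.
  apply: (@le_trans _ _ (g X * expR v)); first by apply: le_trans h _; rewrite ler_peMr.
  by rewrite ler_wpM2r ?expR_ge0// lerDr addr_ge0// ltW.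
have := H _ (le_trans XX (ltW vX)); rewrite powR_expR => h.
have h2 : C * expR (b * v) <= C * expR v by rewrite ler_pM2l// ler_expR ler_piMl// ltW.
have := le_trans (ler_norm _) (le_trans h h2).
have : 0 <= g X * expR v by rewrite mulr_ge0 ?expR_ge0//; exact: g0.
by lra.
Qed.

Lemma expO_of_eventually f C v0 th : 0 <= th -> 0 <= v0 -> expdom C 1 f ->
  (exists2 B, 0 < B & forall v, v0 <= v -> `|f v| <= B * expR (th * v)) -> expO th f.
Proof.
move=> th0 v00 fC [B B0 H]; have C0 := expdom_ge0 fC.
exists (B + C * expR v0) => [|v vge]; first by rewrite ltr_pwDl// mulr_ge0// expR_ge0.
have [vv|vv] := leP v0 v.
  by apply: le_trans (H v vv) _; rewrite ler_wpM2r ?expR_ge0// lerDl mulr_ge0// expR_ge0.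
apply: le_trans (fC.2 v vge) _; rewrite mul1r.
apply: (@le_trans _ _ (C * expR v0)); first by rewrite ler_wpM2l// ler_expR ltW.
rewrite -[leLHS]mulr1; apply: ler_pM => //; rewrite ?mulr_ge0 ?expR_ge0//.
  by rewrite lerDr ltW.
by rewrite -[leLHS]expR0 ler_expR mulr_ge0.
Qed.

Lemma expO_expR f (g : R -> R) C b th : b <= th -> 0 <= th -> expdom C 1 g ->
  (forall v, 0 <= v -> g v = f (expR v)) ->
  (exists2 C, 0 < C & exists X0, forall x, X0 <= x -> `|f x| <= C * x `^ b) -> expO th g.
Proof.
move=> bth th0 gC gf [B B0 [X0 H]].
apply: (@expO_of_eventually g C `|X0| th) => //; exists B => // v vX.
have v0 : 0 <= v by apply: le_trans vX.
have Xv : X0 <= expR v.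
  by apply: le_trans (ler_norm _) _; apply: le_trans vX _; have := expR_ge1Dx v; lra.
rewrite gf//; apply: le_trans (H _ Xv) _; rewrite powR_expR ler_pM2l// ler_expR.
by rewrite ler_wpM2r.
Qed.

Lemma expO_expRV f (g : R -> R) v0 th : (forall v, g v = f (expR v)) ->
  (exists2 B, 0 < B & forall v, v0 <= v -> `|g v| <= B * expR (th * v)) ->
  exists2 C, 0 < C & exists X0, forall x, X0 <= x -> `|f x| <= C * x `^ th.
Proof.
move=> gf [B B0 H]; exists B => //; exists (expR v0) => x vx.
have x0 : 0 < x by apply: lt_le_trans vx; exact: expR_gt0.
have e : x = expR (ln x) by rewrite lnK// posrE.
rewrite [in leLHS]e -gf [x in leRHS]e powR_expR; apply: H.
by rewrite -ler_expR -e.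
Qed.

Lemma small_expR (a K m : R) : m < 1 -> (forall v, 0 <= v -> `|a| * expR v <= K * expR (m * v)) -> a = 0.
Proof.
move=> m1 H; apply/eqP; apply/negP => /negP a0.
have p0 : 0 < `|a| by rewrite normr_gt0.
have d0 : 0 < 1 - m by rewrite subr_gt0.
have K0 : 0 <= K by have := H 0 (lexx _); rewrite mulr0 expR0 !mulr1; exact: le_trans.
pose v := K / (`|a| * (1 - m)).
have v0 : 0 <= v by rewrite divr_ge0// mulr_ge0 ?(ltW p0) ?(ltW d0).
have := H v v0; rewrite (_ : expR v = expR ((1 - m) * v) * expR (m * v)); last first.
  by rewrite -expRD; congr expR; ring.
rewrite mulrA ler_pM2r ?expR_gt0// => h.
have h1 := expR_ge1Dx ((1 - m) * v).
have := le_trans (ler_wpM2l (ltW p0) h1) h.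
rewrite mulrDr mulr1 (_ : `|a| * ((1 - m) * v) = K); last first.
  by rewrite /v; field; rewrite !gt_eqF.
by rewrite gerDr leNgt p0.
Qed.

Lemma pick_radius th th' : 0 < th -> th < 1 -> th < th' ->
  exists r : R, [/\ 1 < r, r < 2 - th, r < 2 & 2 - r < th'].
Proof.
move=> th0 th1 thth; have h : Num.max 1 (2 - th') < 2 - th by rewrite gt_max; apply/andP; split; lra.
have [r] := lt_mid h; rewrite gt_max => /andP[r1 r2] r3; exists r; split => //; lra.
Qed.

End Landau.

(** * From the logarithmic bound to the three exponents and the bound 1/2 *)

Section Exponents.
Variables (R : realType) (P : gprimes R) (rho C1 C2 : R).
Implicit Types (t r v u th : R) (n : nat).
Hypothesis NC : forall v, 0 <= v -> gN P (expR v) <= C1 * expR v.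
Hypothesis psiC : forall v, 0 <= v -> gpsi P (expR v) <= C2 * expR v.
Hypothesis rho_gt0 : 0 < rho.
Variable th : R.
Hypotheses (th_gt0 : 0 < th) (th_lt1 : th < 1).
Hypothesis lb : logbd P (2 - th).

Let radius r : 1 < r -> r < 2 - th -> 0 < r < 2 - th.
Proof. by move=> r1 ->; rewrite (lt_trans ltr01 r1). Qed.

Lemma Epsi_of_logbd th' : th < th' ->
  exists2 B, 0 < B & forall u, 11 <= u -> `|Epsi P u| <= B * expR (th' * u).
Proof.
move=> thth; have [r [r1 r2 r3 r4]] := pick_radius th_gt0 th_lt1 thth.
apply: (tauberian (expdom_Epsi psiC) r1 r3 (saving_Epsi psiC lb (radius r1 r2) r3) r4 ler01).
move=> u v u0 uv _; rewrite !mul1r /Epsi.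
have := countle_nondecreasing (@pln_finite _ P) (@plog_ge0 _ P) uv; rewrite -/(cpsi P _) -/(cpsi P _).
by have := expR_ge0 (th' * v); lra.
Qed.

Lemma cM_of_logbd th' : th < th' -> expO th (EN P rho) ->
  exists2 B, 0 < B & forall u, 11 <= u -> `|cM P u| <= B * expR (th' * u).
Proof.
move=> thth [C C0 HC]; have [r [r1 r2 r3 r4]] := pick_radius th_gt0 th_lt1 thth.
have K0 : 0 <= rho + 2 * C by rewrite addr_ge0 ?mulr_ge0 ?(ltW rho_gt0) ?(ltW C0).
apply: (tauberian (expdom_cM NC) r1 r3 (saving_cM NC psiC lb (radius r1 r2) r3) r4 K0).
move=> u v u0 uv _; have v0 := le_trans u0 uv.
(* [M] alone is not monotone, but 1 + mu >= 0; the regularity of N needed to return to [M] comes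
   from the estimate of [EN]. *)
have h1 : cM P u + cN P u <= cM P v + cN P v.
  have E w : cM P w + cN P w = countle predT (gln P) (fun n : gint => gmu R n + gone R n) w.
    by rewrite /cM /cN /countle -big_split.
  rewrite !E; apply: countle_nondecreasing uv; first exact: gln_finite.
  by move=> n; have := gmu_le1 R n; rewrite ler_norml /gone => /andP[? _]; lra.
have hu := le_trans (ler_norm _) (HC u u0); have hv := le_trans (ler_norm _) (HC v v0).
have hu' := HC u u0; rewrite ler_norml in hu'; have /andP[hu1 hu2] := hu'.
have hv' := HC v v0; rewrite ler_norml in hv'; have /andP[hv1 hv2] := hv'.
have e1 : C * expR (th * u) <= C * expR (th' * v).
  rewrite ler_pM2l// ler_expR; apply: (@le_trans _ _ (th * v)); first by rewrite ler_pM2l.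
  by rewrite ler_wpM2r// ltW.
have e2 : C * expR (th * v) <= C * expR (th' * v) by rewrite ler_pM2l// ler_expR ler_wpM2r// ltW.
have e3 : 0 <= C * (expR v - expR u) by rewrite mulr_ge0 ?(ltW C0)// subr_ge0 ler_expR.
have e4 : 0 <= rho * expR (th' * v) by rewrite mulr_ge0 ?expR_ge0// ltW.
by rewrite /EN in hu1 hu2 hv1 hv2; lra.
Qed.

(** [tauberian] applies to N - W, and [ramp_asymptotic] then gives N an asymptotic slope [L]. The
    weak exponent [th0] is there to identify [L] with [rho]. *)
Lemma EN_of_logbd th' th0 : th < th' -> th' < 1 -> th0 < 1 -> expO th0 (EN P rho) ->
  exists2 B, 0 < B & forall u, 11 <= u -> `|EN P rho u| <= B * expR (th' * u).
Proof.
move=> thth th'1 th01 [C C0 HC]; have [r [r1 r2 r3 r4]] := pick_radius th_gt0 th_lt1 thth.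
have c1 := C1_gt0 NC; have th'0 : 0 < th' by apply: lt_trans thth.
have K0 : 0 <= C1 * expR 1 by rewrite mulr_ge0 ?expR_ge0// ltW.
have gnn (n : gint) : predT n -> 0 <= gln P n by move=> _; exact: gln_ge0.
have ef := expdom_NR NC.
have [B [B0 HB]] : exists B, 0 < B /\ forall v, 0 <= v ->
    `|cN P v + -1 * rampN P v| <= B * expR (th' * v).
  suff [B ? ?] : expO th' (fun v => cN P v + -1 * rampN P v) by exists B.
  apply: (expO_of_eventually (v0 := 11) (ltW th'0) _ ef) => //.
  apply: (tauberian ef r1 r3 (saving_NR NC psiC lb (radius r1 r2) r3) r4 K0).
  move=> u v u0 uv v1; have v0 := le_trans u0 uv.
  have /andP[_ h1] := ramp_sub (@gln_finite _ P) (@gone_ge0 R) uv.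
  have h2 := countle_nondecreasing (@gln_finite _ P) (@gone_ge0 R) uv.
  have h3 := count_gone NC v0.
  rewrite -/(cN P _) -/(cN P _) in h1 h2 h3; rewrite -/(rampN P _) -/(rampN P _) in h1.
  have h4 : (v - u) * cN P v <= (v - u) * (C1 * expR v) by rewrite ler_wpM2l// subr_ge0.
  have h5 : (v - u) * expR v <= expR 1 * (expR v - expR u).
    have e : expR v = expR u * expR (v - u) by rewrite -expRD addrC subrK.
    have e1 : expR v <= expR 1 * expR u by rewrite -expRD ler_expR; lra.
    have e2 : (v - u) * expR u <= expR v - expR u.
      by rewrite e -{3}[expR u]mulr1 -mulrBr mulrC ler_pM2l ?expR_gt0//; have := expR_ge1Dx (v - u); lra.
    apply: (@le_trans _ _ ((v - u) * (expR 1 * expR u))); first by rewrite ler_wpM2l// subr_ge0.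
    by rewrite mulrCA ler_pM2l ?expR_gt0.
  have h6 : (v - u) * (C1 * expR v) <= C1 * expR 1 * (expR v - expR u).
    by rewrite mulrCA -mulrA ler_pM2l.
  have h7 : 0 <= C1 * expR 1 * expR (th' * v) by rewrite mulr_ge0 ?expR_ge0.
  by lra.
have HB' v : 0 <= v -> `|countle predT (gln P) (@gone R) v - ramp predT (gln P) (@gone R) v| <= B * expR (th' * v).
  by move=> v0; have := HB v v0; rewrite mulN1r.
have [L [B' HL]] := ramp_asymptotic gnn (@gln_finite _ P) (@gone_ge0 R) (count_gone NC) th'0 th'1 HB'.
have HN v : 0 <= v -> `|cN P v - L * expR v| <= (B + B') * expR (th' * v).
  move=> v0; rewrite -(subrK (rampN P v) (cN P v)) -addrA mulrDl.
  by apply: le_trans (ler_normD _ _) (lerD (HB' v v0) (HL v v0)).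
have BB : 0 <= B + B'.
  by have := HN 0 (lexx _); rewrite mulr0 expR0 !mulr1; exact: le_trans.
have E : L - rho = 0.
  apply: (@small_expR _ _ (B + B' + C) (Num.max th' th0)); first by rewrite gt_max th'1.
  move=> v v0; rewrite -{1}[expR v](ger0_norm (expR_ge0 v)) -normrM.
  have -> : (L - rho) * expR v = EN P rho v - (cN P v - L * expR v) by rewrite /EN; ring.
  apply: le_trans (ler_normB _ _) _; rewrite mulrDl addrC; apply: lerD.
    apply: le_trans (HN v v0) _; rewrite ler_wpM2l// ler_expR ler_wpM2r// le_max lexx//.
  apply: le_trans (HC v v0) _; rewrite ler_pM2l// ler_expR ler_wpM2r// le_max lexx orbT//.
exists (B + B' + 1) => [|u u11]; first by rewrite ltr_wpDl.
have u0 : 0 <= u by apply: le_trans u11.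
have := HN u u0; rewrite (_ : L = rho); last by apply/eqP; rewrite -subr_eq0 E.
by move=> h; apply: le_trans h _; rewrite ler_wpM2r ?expR_ge0// lerDl.
Qed.

Lemma half_le_of_logbd th0 : th0 < 1 -> expO th0 (EN P rho) -> 2^-1 <= th.
Proof.
move=> th01 [C C0 HC]; rewrite leNgt; apply/negP => th2.
have h32 : 3 / 2 < 2 - th by lra.
have [r r32 r2] := lt_mid h32.
have rlt2 : r < 2 by have t0 := th_gt0; lra.
have c1 := C1_gt0 NC; have c6 : 0 < 6 * C1 by rewrite mulr_gt0.
have rh2 : 0 < rho / 2 by rewrite divr_gt0.
have d0 : 0 < 1 - th0 by rewrite subr_gt0.
have rr : 0 < r < 2 - th by rewrite r2 andbT; lra.
pose Q := C * (1 + expR th0); have Q0 : 0 < Q by rewrite mulr_gt0// addr_gt0 ?expR_gt0.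
(* From [u0] on, the errors at u and u + 1 are together at most rho exp(u) / 2; as e >= 2, the
   increment of N is then at least rho exp(u) / 2. *)
pose u0 := 2 * Q / (rho * (1 - th0)).
have u00 : 0 <= u0 by rewrite divr_ge0// mulr_ge0// ltW.
apply: (@mean_value _ _ predT (gln P) (@gone R) C1 r (6 * C1) (rho / 2) u0) => //.
- by move=> n _; exact: gln_ge0.
- exact: gln_finite.
- exact: count_gone.
- by move=> t n; exact: (normc_Zser_le NC).
- by move=> eps e0; exact: (Zser_growth NC psiC lb rr rlt2 e0).
move=> u uu; have ug : 0 <= u by apply: le_trans uu.
have ug1 : 0 <= u + 1 by rewrite addr_ge0.
have := HC u ug; rewrite ler_norml => /andP[_ h1].
have := HC (u + 1) ug1; rewrite ler_norml => /andP[h2 _].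
rewrite /EN in h1 h2; rewrite -/(cN P _) -/(cN P _).
have e1 : 2 * expR u <= expR (u + 1).
  by rewrite expRD mulrC ler_pM2l ?expR_gt0//; have := expR_ge1Dx (1 : R); lra.
have e2 : expR (th0 * (u + 1)) = expR th0 * expR (th0 * u).
  by rewrite -expRD; congr expR; ring.
have e3 : Q * expR (th0 * u) <= rho / 2 * expR u.
  have -> : expR u = expR ((1 - th0) * u) * expR (th0 * u) by rewrite -expRD; congr expR; ring.
  rewrite mulrA ler_pM2r ?expR_gt0//.
  apply: (@le_trans _ _ (rho / 2 * ((1 - th0) * u0))).
    by rewrite /u0 le_eqVlt; apply/orP; left; apply/eqP; field; rewrite !gt_eqF.
  rewrite ler_pM2l//; apply: (@le_trans _ _ ((1 - th0) * u)); first by rewrite ler_pM2l.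
  by have := expR_ge1Dx ((1 - th0) * u); lra.
rewrite e2 in h2; have := ler_wpM2l (ltW rho_gt0) e1.
by rewrite /Q in e3; lra.
Qed.

End Exponents.

Theorem theorem1 (R : realType) (P : gprimes R)
    (zetaP : zeta_abscissa_of_convergence P 1)
    (rho alpha beta gamma : R) (rho_gt0 : 0 < rho)
    (alpha_lt1 : alpha < 1) (beta_lt1 : beta < 1) (gamma_lt1 : gamma < 1)
    (psiP : forall eps : R, 0 < eps -> psi_estimate P (alpha + eps))
    (NP : forall eps : R, 0 < eps -> N_estimate P rho (beta + eps))
    (MP : forall eps : R, 0 < eps -> M_estimate P (gamma + eps))
    (psiP_opt : forall eps : R, eps < 0 -> ~ psi_estimate P (alpha + eps))
    (NP_opt : forall eps : R, eps < 0 -> ~ N_estimate P rho (beta + eps))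
    (MP_opt : forall eps : R, eps < 0 -> ~ M_estimate P (gamma + eps)) :
  forall a b c : R, perm_eq [:: a; b; c] [:: alpha; beta; gamma] ->
    b <= a -> c <= b -> a = b /\ 2^-1 <= a.
Proof.
have gN_homo : {homo (gN P \o expR) : u v / u <= v}.
  by move=> u v uv /=; rewrite !gNE; apply: countle_nondecreasing uv; [exact: gln_finite|exact: gone_ge0].
have gpsi_homo : {homo (gpsi P \o expR) : u v / u <= v}.
  by move=> u v uv /=; rewrite !gpsiE; apply: countle_nondecreasing uv; [exact: pln_finite|exact: plog_ge0].
have gN0 v : 0 <= gN P (expR v) by rewrite gNE sumr_ge0// => n _; exact: gone_ge0.
have gpsi0 v : 0 <= gpsi P (expR v) by rewrite gpsiE sumr_ge0// => n _; exact: plog_ge0.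
pose mid x : R := (x + 1) / 2.
have midP x : x < 1 -> x < mid x /\ mid x < 1 by rewrite /mid => x1; split; lra.
have up (x y : R) : x < y -> exists2 eps, 0 < eps & x + eps = y.
  by move=> xy; exists (y - x); rewrite ?subr_gt0// addrC subrK.
have psi_le y : alpha < y -> psi_estimate P y by move=> /up[e e0 <-]; exact: psiP.
have N_le y : beta < y -> N_estimate P rho y by move=> /up[e e0 <-]; exact: NP.
have M_le y : gamma < y -> M_estimate P y by move=> /up[e e0 <-]; exact: MP.
have down (x y : R) : y < x -> exists2 eps, eps < 0 & x + eps = y.
  by move=> xy; exists (y - x); rewrite ?subr_lt0// addrC subrK.
have psi_opt y : psi_estimate P y -> alpha <= y.
  by move=> h; rewrite leNgt; apply/negP => /down[e e0 E]; apply: (psiP_opt e e0); rewrite E.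
have N_opt y : N_estimate P rho y -> beta <= y.
  by move=> h; rewrite leNgt; apply/negP => /down[e e0 E]; apply: (NP_opt e e0); rewrite E.
have M_opt y : M_estimate P y -> gamma <= y.
  by move=> h; rewrite leNgt; apply/negP => /down[e e0 E]; apply: (MP_opt e e0); rewrite E.
have [b1 b2] := midP _ beta_lt1; have [a1 a2] := midP _ alpha_lt1.
have [C1 NC] := expR_linear_bound b2 (ltW rho_gt0) gN_homo gN0 ((bigO_addP _ _ _).1 (N_le _ b1)).
have [C2 psiC] : exists C2, forall v, 0 <= v -> gpsi P (expR v) <= C2 * expR v.
  apply: (expR_linear_bound a2 ler01 gpsi_homo gpsi0).
  have [C C0 [X0 H]] := (bigO_addP _ _ _).1 (psi_le _ a1).
  by exists C => //; exists X0 => x Xx; rewrite mul1r; exact: H.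
have bN y th : beta < y -> y <= th -> 0 <= th -> expO th (EN P rho).
  move=> by1 yth th0; apply: (expO_expR yth th0 (expdom_EN rho NC) _ ((bigO_addP _ _ _).1 (N_le _ by1))).
  by move=> v _; rewrite /EN /cN -gNE.
have bpsi y th : alpha < y -> y <= th -> 0 <= th -> expO th (Epsi P).
  move=> by1 yth th0; apply: (expO_expR yth th0 (expdom_Epsi psiC) _ ((bigO_addP _ _ _).1 (psi_le _ by1))).
  by move=> v _; rewrite /Epsi /cpsi -gpsiE.
have bM y th : gamma < y -> y <= th -> 0 <= th -> expO th (cM P).
  move=> by1 yth th0; apply: (expO_expR yth th0 (expdom_cM NC) _ ((bigO_eqP _ _).1 (M_le _ by1))).
  by move=> v _; rewrite /cM -gME.
have limit (x th : R) : th < 1 -> (forall th', th < th' -> th' < 1 -> x <= th') -> x <= th.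
  move=> th1 h; rewrite leNgt; apply/negP => thx.
  have h1 : th < Num.min x 1 by rewrite lt_min thx.
  have [y y1] := lt_mid h1; rewrite lt_min => /andP[yx y2].
  by have := h y y1 y2; rewrite leNgt yx.
(* An exponent below 1 for N, however weak, is available whichever two estimates are in use. The
   maximum with 0 is taken since the exponents may be negative. *)
have bNw : exists2 th0, th0 < 1 & expO th0 (EN P rho).
  exists (Num.max (mid beta) 0); first by rewrite gt_max b2 ltr01.
  by apply: (bN _ _ b1); rewrite le_max lexx ?orbT.
have [th0 th01 bEN0] := bNw.
(* The bound for [gamma] uses an estimate of N with exponent [th] itself, whence the condition on
   [beta]. *)
have key th : 0 < th -> th < 1 -> logbd P (2 - th) ->
    [/\ 2^-1 <= th, alpha <= th, beta <= th & beta < th -> gamma <= th].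
  move=> t0 t1 lb; split.
  - exact: (half_le_of_logbd NC psiC rho_gt0 t0 lb th01 bEN0).
  - apply: (limit _ _ t1) => th' tt _; apply: psi_opt; apply/bigO_addP.
    apply: (expO_expRV (f := gpsi P - id) _ (Epsi_of_logbd psiC t0 t1 lb tt)).
    by move=> v; rewrite /Epsi /cpsi -gpsiE.
  - apply: (limit _ _ t1) => th' tt t'1; apply: N_opt; apply/bigO_addP.
    apply: (expO_expRV (f := fun x => gN P x - rho * x) _ (EN_of_logbd NC psiC t0 t1 lb tt t'1 th01 bEN0)).
    by move=> v; rewrite /EN /cN -gNE.
  - move=> bt; apply: (limit _ _ t1) => th' tt _; apply: M_opt; apply/bigO_eqP.
    have bE := bN _ _ (bt : beta < th) (lexx _) (ltW t0).
    apply: (expO_expRV _ (cM_of_logbd NC psiC rho_gt0 t0 t1 lb tt bE)).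
    by move=> v; rewrite /cM -gME.
have main th : 0 < th -> th < 1 -> (1 < count (< th)%R [:: alpha; beta; gamma])%N ->
    2^-1 <= th /\ all (<= th)%R [:: alpha; beta; gamma].
  move=> t0 t1 cnt.
  have lb : logbd P (2 - th).
    have [aT|aF] := ltP alpha th; have [bT|bF] := ltP beta th; have [cT|cF] := ltP gamma th.
    - exact: (logbd_psiN NC psiC t1 (bpsi _ _ aT (lexx _) (ltW t0)) (bN _ _ bT (lexx _) (ltW t0))).
    - exact: (logbd_psiN NC psiC t1 (bpsi _ _ aT (lexx _) (ltW t0)) (bN _ _ bT (lexx _) (ltW t0))).
    - exact: (logbd_psiM NC psiC t1 (bpsi _ _ aT (lexx _) (ltW t0)) (bM _ _ cT (lexx _) (ltW t0))).
    - by move: cnt; rewrite /= aT !ltNge bF cF.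
    - exact: (logbd_NM NC psiC rho_gt0 t0 t1 (bN _ _ bT (lexx _) (ltW t0)) (bM _ _ cT (lexx _) (ltW t0))).
    - by move: cnt; rewrite /= bT !ltNge aF cF.
    - by move: cnt; rewrite /= cT !ltNge aF bF.
    - by move: cnt; rewrite /= !ltNge aF bF cF.
  have [h2 ha hb hc] := key th t0 t1 lb; split => //=; rewrite ha hb /= andbT.
  (* If [th <= beta], the two exponents below [th] are [alpha] and [gamma], so the claim for [gamma]
     is already given. *)
  have [bt|bt] := ltP beta th; first exact: hc.
  by move: cnt; rewrite /= [beta < th]ltNge bt; case: ltP => // _; case: ltP => // /ltW.
move=> a b c abc ba cb.
have a1' : a < 1.
  have : all (< 1)%R [:: alpha; beta; gamma] by rewrite /= alpha_lt1 beta_lt1 gamma_lt1.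
  by rewrite -(perm_all _ abc) /= => /and3P[].
(* A number above the second largest exponent is above at least two of the three, so [main] applies
   and bounds the largest one as well. *)
have H th : 0 < th -> th < 1 -> b < th -> 2^-1 <= th /\ a <= th.
  move=> t0 t1 bt; have ct := le_lt_trans cb bt.
  have [h /allP hall] : 2^-1 <= th /\ all (<= th)%R [:: alpha; beta; gamma].
    apply: main => //; rewrite -(seq.permP abc) /= bt ct; by case: (a < th).
  by split => //; apply: hall; rewrite -(perm_mem abc) inE eqxx.
have bhalf : 2^-1 <= b.
  rewrite leNgt; apply/negP => b2'.
  (* A [th] between [b] and 1/2 would contradict [H]; the maximum with 0 keeps [th] positive when
     [b] is negative. *)
  have h1 : Num.max b 0 < 2^-1 by rewrite gt_max; apply/andP; split; [exact: b2'|lra].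
  have [th] := lt_mid h1; rewrite gt_max => /andP[bt t0] t2.
  have [|h _] := H th t0 _ bt; first by lra.
  by move: h; rewrite leNgt t2.
have ab : a = b.
  apply/eqP; rewrite eq_le ba andbT leNgt; apply/negP => b_a.
  (* A number strictly between the two largest exponents would, by [H], be an upper bound of the
     largest. *)
  have [th bt ta] := lt_mid b_a.
  have [|||_] := H th; [by lra|by lra|by []|].
  by rewrite leNgt ta.
by rewrite ab.
Qed.
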